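(* Let $\mathfrak g$ be a classical simple complex Lie algebra and let $\mathfrak l=\mathfrak k\ltimes\mathfrak n$ be a root subalgebra of $\mathfrak g$ that does not satisfy the cone condition. Then the following statements hold. (i) If $\mathfrak g\simeq\mathrm{sl}(n)$, $\mathrm{so}(2n+1)$ or $\mathrm{so}(2n)$, there exists an $\mathfrak l$-strictly infinite weight $\omega$. (ii) If $\mathfrak g\simeq\mathrm{sp}(2n)$, there exists an $\mathfrak l$-infinite weight $\omega$.
   Context: The base field is $\mathbb C$; fix a Cartan subalgebra $\mathfrak h$ of $\mathfrak g$, with roots $\Delta(\mathfrak g)$ and root spaces $\mathfrak g^\alpha$. A root subalgebra is a subalgebra $\mathfrak l\supset\mathfrak h$. Put $\Delta(\mathfrak l)=\{\alpha:\mathfrak g^\alpha\subset\mathfrak l\}$, $\Delta(\mathfrak k)=\{\alpha\in\Delta(\mathfrak l):-\alpha\in\Delta(\mathfrak l)\}$, $\Delta(\mathfrak n)=\Delta(\mathfrak l)\setminus\Delta(\mathfrak k)$, $\mathfrak k=\mathfrak h\oplus\bigoplus_{\alpha\in\Delta(\mathfrak k)}\mathfrak g^\alpha$, $\mathfrak n=\bigoplus_{\alpha\in\Delta(\mathfrak n)}\mathfrak g^\alpha$, so $\mathfrak l=\mathfrak k\ltimes\mathfrak n$. A Borel subalgebra $\mathfrak b\supset\mathfrak h$ is fixed with $\mathfrak n\subset\mathfrak b$. $\mathrm{Sing}_{\mathfrak b\cap\mathfrak k}(\mathfrak g/\mathfrak l)=\{\alpha\in\Delta(\mathfrak g)\setminus\Delta(\mathfrak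 l):\alpha+\delta\notin\Delta(\mathfrak g)\ \forall\delta\in\Delta(\mathfrak b)\cap\Delta(\mathfrak k)\}$. The cone condition for $\mathfrak l$ is $\mathrm{Cone}_{\mathbb Q}(\Delta(\mathfrak n))\cap\mathrm{Cone}_{\mathbb Q}(\mathrm{Sing}_{\mathfrak b\cap\mathfrak k}(\mathfrak g/\mathfrak l))=\{0\}$, where $\mathrm{Cone}_{\mathbb Q}(I)$ is the $\mathbb Q_{\ge0}$-span of $I$. Two roots are strongly orthogonal if neither their sum nor their difference is a root or zero. A relation is an expression $\omega=\sum_{i}a_i\alpha_i=\sum_{i}b_i\beta_i$ with $\omega\ne0$, $a_i,b_i\in\mathbb Z_{>0}$, $\alpha_i\in\mathrm{Sing}_{\mathfrak b\cap\mathfrak k}(\mathfrak g/\mathfrak l)$, $\beta_i\in\Delta(\mathfrak n)$. A weight $\omega\in\mathfrak h^*$ is two-sided with respect to $\mathfrak l$ if it is the weight of some relation and, among all relations with this weight, there is one for which $[\mathfrak g^{\alpha_i},\mathfrak n]\subset\mathfrak n$ for all $i$. A weight $\omega$ has a strongly orthogonal decomposition with respect to $\Delta(\mathfrak n)$ if $\omega=b_1\beta_1+\dots+b_k\beta_k$ with $b_i\in\mathbb Z_{>0}$ and pairwise strongly orthogonal $\beta_i\in\Delta(\mathfrak n)$. $\omega$ is $\mathfrak l$-strictly infinite (in $\mathfrak g$) if it is two-sided with respect to $\mathfrak l$ and has a strongly orthogonal decomposition with respect to $\Delta(\mathfrak n)$. $\omega$ is $\mathfrak l$-infinite if there is a root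 subalgebra $\mathfrak t$ of $\mathfrak g$ containing $\mathfrak k$ such that $\omega$ is $\mathfrak l'$-strictly infinite in $\mathfrak t$, where $\mathfrak l'=\mathfrak l\cap\mathfrak t=\mathfrak k\ltimes(\mathfrak t\cap\mathfrak n)$, i.e. the previous definitions hold with $\mathfrak g,\mathfrak l,\mathfrak n,\mathfrak b$ replaced by $\mathfrak t,\mathfrak l',\mathfrak t\cap\mathfrak n,\mathfrak b\cap\mathfrak t$. *)

(* Defs.v *)
From HB Require Import structures.
From mathcomp Require Import all_boot all_algebra.
From mathcomp Require Export classical_sets reals.
From mathcomp Require Export complex.

Set Implicit Arguments.
Unset Strict Implicit.
Unset Printing Implicit Defensive.

Import GRing.Theory.

Local Open Scope classical_set_scope.
Local Open Scope ring_scope.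

HB.mixin Record Vector_isLieAlgebra (F : fieldType) (L : Type)
    of Vector F L := {
  lie : L -> L -> L;
  lie_linearl : forall (a : F) (x y z : L),
    lie (a *: x + y) z = a *: lie x z + lie y z;
  lie_linearr : forall (a : F) (x y z : L),
    lie x (a *: y + z) = a *: lie x y + lie x z;
  liexx : forall x : L, lie x x = 0;
  lie_jacobi : forall x y z : L,
    lie x (lie y z) + lie y (lie z x) + lie z (lie x y) = 0
}.

#[short(type="lieAlgType")]
HB.structure Definition LieAlgebra (F : fieldType) :=
  { L of Vector_isLieAlgebra F L & Vector F L }.

Section LieSubalgebras.
Variables (F : fieldType) (g : lieAlgType F).
Implicit Types (U V : {vspace g}).

Definition lieprod U V : {vspace g} :=
  <<[seq lie x y | x <- vbasis U, y <- vbasis V]>>%VS.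

Definition lie_subalgebra U : Prop :=
  forall x y, x \in U -> y \in U -> lie x y \in U.

Definition lie_ideal U : Prop := forall x y, y \in U -> lie x y \in U.

Definition lie_simple : Prop :=
  (exists x y : g, lie x y != 0) /\
  (forall U, lie_ideal U -> U = 0%VS \/ U = fullv).

Definition lie_nilpotent U : Prop :=
  exists k, iter k (lieprod U) U = 0%VS.

Definition lie_solvable U : Prop :=
  exists k, iter k (fun V => lieprod V V) U = 0%VS.

Definition self_normalizing U : Prop :=
  forall x, (forall y, y \in U -> lie x y \in U) -> x \in U.

Definition cartan_subalgebra U : Prop :=
  [/\ lie_subalgebra U, lie_nilpotent U & self_normalizing U].

Definition borel_subalgebra U : Prop :=
  [/\ lie_subalgebra U, lie_solvable U &
      forall V, lie_subalgebra V -> lie_solvable V -> (U <= V)%VS -> V = U].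

Definition root_subalgebra (h U : {vspace g}) : Prop :=
  lie_subalgebra U /\ (h <= U)%VS.

Definition lie_iso_matrix n (S : set 'M[F]_n) : Prop :=
  exists f : {linear g -> 'M[F]_n},
    [/\ injective f,
        forall x y, f (lie x y) = f x *m f y - f y *m f x &
        range f = S].

End LieSubalgebras.

Section ClassicalAlgebras.
Variable F : fieldType.

Definition sl n : set 'M[F]_n := [set A | \tr A = 0].

Definition so n : set 'M[F]_n := [set A | A^T = - A].

Definition symplectic_mx n : 'M[F]_(n + n) := block_mx 0 1%:M (- 1%:M) 0.

(* sp n is the symplectic algebra of rank n, acting on F^(2n). *)
Definition sp n : set 'M[F]_(n + n) :=
  [set A | A^T *m symplectic_mx n + symplectic_mx n *m A = 0].

End ClassicalAlgebras.

Arguments sl F n : clear implicits.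
Arguments so F n : clear implicits.
Arguments sp F n : clear implicits.

Definition type_A (F : fieldType) (g : lieAlgType F) : Prop :=
  exists n, lie_iso_matrix g (sl F n).

Definition type_B (F : fieldType) (g : lieAlgType F) : Prop :=
  exists n, lie_iso_matrix g (so F (2 * n + 1)%N).

Definition type_C (F : fieldType) (g : lieAlgType F) : Prop :=
  exists n, lie_iso_matrix g (sp F n).

Definition type_D (F : fieldType) (g : lieAlgType F) : Prop :=
  exists n, lie_iso_matrix g (so F (2 * n)%N).

(* Low-rank members of the four families that are not simple (sl(1), so(2),
   so(4), ...) are excluded by lie_simple. *)
Definition classical_simple (F : fieldType) (g : lieAlgType F) : Prop :=
  lie_simple g /\ [\/ type_A g, type_B g, type_C g | type_D g].

Section RootSubalgebras.
Variables (F : fieldType) (g : lieAlgType F) (h : {vspace g}).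
Local Notation wt := 'Hom(subvs_of h, F^o).
Implicit Types (t l b : {vspace g}) (alpha beta omega : wt).

Definition lin_span (A : set g) : set g :=
  [set x | exists2 s : seq g, [set` s] `<=` A & x \in <<s>>%VS].

Definition root_space alpha : set g :=
  [set x | forall y : subvs_of h, lie (vsval y) x = (alpha y : F) *: x].

(* For t = fullv this is the set of roots of g. *)
Definition Delta t : set wt :=
  [set alpha | [/\ alpha != 0, exists2 x, x != 0 & root_space alpha x &
                   root_space alpha `<=` [set` t]]].

Definition Delta_k l : set wt :=
  [set alpha | Delta l alpha /\ Delta l (- alpha)].

Definition Delta_n l : set wt := Delta l `\` Delta_k l.

Definition part_k l : set g :=
  lin_span ([set` h] `|` \bigcup_(alpha in Delta_k l) root_space alpha).

Definition part_n l : set g :=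
  lin_span (\bigcup_(alpha in Delta_n l) root_space alpha).

(* From here on, t is the root subalgebra of g playing the role of the
   ambient algebra, with l and b contained in t; t = fullv gives the notions
   for g itself. *)

Definition Sing t l b : set wt :=
  [set alpha | (Delta t `\` Delta l) alpha /\
     forall delta, Delta b delta -> Delta_k l delta ->
       ~ Delta t (alpha + delta)].

Definition coneQ (I : set wt) : set wt :=
  [set omega | exists s : seq (rat * wt),
     (forall p, p \in s -> 0 <= p.1 /\ I p.2) /\
     omega = \sum_(p <- s) (ratr p.1 : F) *: p.2].

Definition cone_condition t l b : Prop :=
  coneQ (Delta_n l) `&` coneQ (Sing t l b) = [set 0].

Definition strongly_orthogonal t alpha beta : Prop :=
  [/\ ~ Delta t (alpha + beta), alpha + beta <> 0,
      ~ Delta t (alpha - beta) & alpha - beta <> 0].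

Definition is_relation t l b omega p (a : 'I_p -> nat)
    (alpha : 'I_p -> wt) q (c : 'I_q -> nat)
    (beta : 'I_q -> wt) : Prop :=
  [/\ omega <> 0,
      omega = \sum_i alpha i *+ a i,
      omega = \sum_j beta j *+ c j,
      forall i, (0 < a i)%N /\ Sing t l b (alpha i) &
      forall j, (0 < c j)%N /\ Delta_n l (beta j)].

Definition two_sided t l b omega : Prop :=
  exists p (a : 'I_p -> nat) (alpha : 'I_p -> wt)
         q (c : 'I_q -> nat) (beta : 'I_q -> wt),
    is_relation t l b omega a alpha c beta /\
    forall i x y, root_space (alpha i) x -> part_n l y -> part_n l (lie x y).

Definition strongly_orthogonal_decomposition t l omega : Prop :=
  exists k (c : 'I_k -> nat) (beta : 'I_k -> wt),
    [/\ omega = \sum_i beta i *+ c i,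
        forall i, (0 < c i)%N /\ Delta_n l (beta i) &
        forall i j, i != j -> strongly_orthogonal t (beta i) (beta j)].

Definition strictly_infinite t l b omega : Prop :=
  two_sided t l b omega /\ strongly_orthogonal_decomposition t l omega.

Definition infinite_weight l b omega : Prop :=
  exists t : {vspace g},
    [/\ root_subalgebra h t, part_k l `<=` [set` t] &
        strictly_infinite t (l :&: t)%VS (b :&: t)%VS omega].

End RootSubalgebras.

(* Main.v *)
Require Import Defs.
From HB Require Import structures.
From mathcomp Require Import all_boot all_order all_algebra ring zify.
From mathcomp Require Import boolp classical_sets reals complex.

Set Implicit Arguments.
Unset Strict Implicit.
Unset Printing Implicit Defensive.

Import Order.TTheory GRing.Theory Num.Theory.

(** The roots of a classical Lie algebra are differences [e x - e y] of weights of
    the defining representation. The indices [x] form a finite set with an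
    involution [neg] such that [e (neg y) - e (neg x) = e x - e y]: a root is an
    ordered pair of indices, with exactly the two names [(x, y)] and
    [(neg y, neg x)], and two roots can only add up to a root by sharing an index,
    [(e x - e y) + (e y - e z)]. The record [coordinates] collects these facts.
    They hold for every Cartan subalgebra [h], because [h] is the diagonal in some
    basis ([sl_frame], [skew_frame]). This is proved directly: the semisimple parts
    of elements of [h] lie in [h], their common centralizer is [h] by an argument
    of Engel type, and a trace computation shows that their weight spaces are lines.

    Write [x ~< y] for the order on indices generated by the roots of [n], and let
    the cone condition fail through a relation between singular roots and roots of
    [n]. Draw an arrow from [x] to [y] for every singular root [e x - e y] and an
    arrow from [y] to [x] for every root [e x - e y] of [n]. If [e b - e a] is a
    root of [n] occurring in the relation, there is a path from [b] to [a]: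
    otherwise the set [C] of the indices reachable from [b] defines the linear form
    [e x |-> (x in C) - (neg x in C)], which is nonpositive on the singular roots,
    nonnegative on the roots of [n], and positive on [e b - e a]
    ([cone_solution]).

    Hence there is a cycle. Singular roots can be replaced in it by two-sided ones,
    going up along roots of [n] ([sing_connect]), and a cycle can be shortened, by
    composing consecutive arrows or by raising a pair of indices to a two-sided
    root, until it gives two two-sided roots [e x - e y] and [e u - e v] with
    [x ~< v], and with [u = y] or [u ~< y] ([solutionP]). The weight wanted is
    [omega = (e x - e y) + (e u - e v) = (e x - e v) + (e u - e y)].
    The right-hand side consists of roots of [n], except that [e x - e (neg x)] is
    not a root of an orthogonal algebra, in which case it splits at an intermediate
    index ([decompose]). If the four indices are distinct up to sign the roots
    obtained are strongly orthogonal ([disjoint_decomposition]); otherwise [omega]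
    is a single difference, a root of [n] or split as before ([telescoping]), or,
    for two long roots, twice a root of [n].

    One configuration is left, for [sp] only: [e x - e (neg x)] is a long root,
    [e p - e q] a short one, and
    [omega = (e x - e q) + (e p - e (neg x))], where the difference of the two
    summands is a root. This root is removed by passing to the subalgebra [t]
    spanned by [h], [k] and the root spaces of suitable pairs
    ([long_short_infinite]), and so [omega] is only infinite with respect to [l]. *)

(** * Pairs of signed indices *)

Section Admissible.
Variables (X : finType) (neg : X -> X) (lk : rel X) (lng : bool).
Hypotheses (negK : involutive neg) (lk_sym : symmetric lk)
  (lk_trans : transitive lk) (lk_neg : forall x y, lk (neg x) (neg y) = lk x y).

(** The pairs [(x, y)] for which [e x - e y] is a root. The relation [lk] separates
    the weights of a representation from those of its dual, and [lng] tells whether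
    the long roots [e x - e (neg x)] exist. *)
Definition adm x y := [&& lk x y, x != y & lng || (x != neg y)].

Lemma neg_eq x y : (neg x == neg y) = (x == y).
Proof. exact: (inj_eq (can_inj negK)). Qed.

Lemma neg_eqC x y : (x == neg y) = (y == neg x).
Proof. by rewrite -neg_eq negK eq_sym. Qed.

Lemma admC x y : adm x y = adm y x.
Proof. by rewrite /adm lk_sym eq_sym neg_eqC. Qed.

Lemma adm_neg x y : adm (neg y) (neg x) = adm x y.
Proof.
by rewrite /adm lk_neg lk_sym neg_eq negK [y == x]eq_sym [neg y == x]eq_sym.
Qed.

Lemma adm_lk x y : adm x y -> lk x y.
Proof. by case/and3P. Qed.

Lemma adm_neq x y : adm x y -> x <> y.
Proof. by case/and3P=> _ /eqP. Qed.

Lemma admNneg x y : ~~ lng -> adm x y -> x <> neg y.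
Proof. by move=> /negPf nl /and3P[_ _]; rewrite nl => /eqP. Qed.

Variant link_spec x y : Prop :=
| LinkAdm of adm x y
| LinkEq of x = y
| LinkNeg of ~~ lng & x = neg y.

Lemma linkP x y : lk x y -> link_spec x y.
Proof.
move=> lxy; have [->|nxy] := eqVneq x y; first exact: LinkEq.
case: (boolP lng) => [l|nl]; first by apply: LinkAdm; rewrite /adm lxy nxy l.
have [->|nxNy] := eqVneq x (neg y); first exact: LinkNeg.
by apply: LinkAdm; rewrite /adm lxy nxy nxNy orbT.
Qed.

(** Closed sets of roots. The pairs [(x, y)] and [(neg y, neg x)] name the same
    root. *)
Definition subsystem (R : rel X) :=
  [/\ forall x y, R x y -> adm x y,
      forall x y, R (neg y) (neg x) = R x y &
      forall x y z, R x y -> R y z -> adm x z -> R x z].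

(** The strict order spanned by a closed set [R] without opposite roots. A chain of
    roots from [x] to [neg x] need not add up to a root, so that [R] alone is not
    transitive. *)
Definition elt (R : rel X) x y :=
  R x y || (y == neg x) && [exists w, R x w && R w y].

Section Order.
Variables (R : rel X).
Hypotheses (sR : subsystem R) (R_anti : forall x y, R x y -> ~~ R y x).

Let Radm x y : R x y -> adm x y. Proof. by case: sR => h _ _; apply: h. Qed.
Let Rneg x y : R (neg y) (neg x) = R x y. Proof. by case: sR => _ h _; apply: h. Qed.
Let Rtrans x y z : R x y -> R y z -> adm x z -> R x z.
Proof. by case: sR => _ _; apply. Qed.
Let Rlk x y : R x y -> lk x y. Proof. by move/Radm/adm_lk. Qed.
Let Rasym x y : R x y -> R y x -> False.
Proof. by move=> /R_anti/negP. Qed.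

Lemma eltW x y : R x y -> elt R x y. Proof. by rewrite /elt => ->. Qed.

Lemma elt_lk x y : elt R x y -> lk x y.
Proof.
case/orP=> [/Rlk//|/andP[_ /existsP[w /andP[/Rlk xw /Rlk wy]]]].
exact: lk_trans xw wy.
Qed.

Lemma elt_neg x y : elt R (neg y) (neg x) = elt R x y.
Proof.
rewrite /elt Rneg negK [neg x == y]eq_sym; congr (_ || _ && _).
apply/existsP/existsP=> -[w /andP[a b]]; exists (neg w).
  by rewrite -Rneg negK b -Rneg negK a.
by rewrite !Rneg b a.
Qed.

Lemma elt_adm x y : elt R x y -> adm x y -> R x y.
Proof.
case/orP=> // /andP[/eqP-> /existsP[w /andP[xw wx]]] a.
exact: Rtrans xw wx a.
Qed.

Lemma elt2 x y z : R x y -> R y z -> elt R x z.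
Proof.
move=> xy yz; case: (linkP (lk_trans (Rlk xy) (Rlk yz))) => [a|e|_ e].
- exact/eltW/(Rtrans xy yz a).
- by subst z; case: (Rasym xy yz).
- apply/orP; right; rewrite e negK eqxx -e /=; apply/existsP; exists y.
  by rewrite xy.
Qed.

Let elt_trans1 x w z : R x w -> R w (neg x) -> R (neg x) z -> elt R x z.
Proof.
move=> xw wx xz; case: (linkP (lk_trans (Rlk wx) (Rlk xz))) => [a|e|_ e].
- exact: elt2 xw (Rtrans wx xz a).
- by subst z; case: (Rasym wx xz).
- by subst w; move: xw; rewrite -Rneg negK => /Rasym; case/(_ xz).
Qed.

(** Two passages through pairs [(x, neg x)] in a row cannot occur: they would
    compose to a pair and its opposite in [R]. *)
Lemma elt_trans : transitive (elt R).
Proof.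
move=> y x z /orP[xy|/andP[/eqP-> /existsP[w /andP[xw wx]]]];
  case/orP=> [yz|/andP[/eqP ez /existsP[w' /andP[yw wy]]]].
- exact: elt2 xy yz.
- rewrite ez -elt_neg negK; apply: (@elt_trans1 y (neg w')).
  + by rewrite -Rneg negK -ez.
  + by rewrite -Rneg !negK.
  + by rewrite Rneg.
- exact: elt_trans1 xw wx yz.
- have := elt_trans1 xw wx yw; rewrite ez negK in wy * => /elt_adm xw'.
  by case: (Rasym wy (xw' _)); rewrite admC; apply: Radm.
Qed.

Lemma elt_irr x : elt R x x = false.
Proof.
apply/negP=> /orP[/Radm/adm_neq//|/andP[_ /existsP[w /andP[xw wx]]]].
exact: Rasym xw wx.
Qed.

Definition rank x := #|[pred z | elt R x z]|.

Lemma elt_rank x y : elt R x y -> rank y < rank x.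
Proof.
move=> xy; apply: proper_card; apply/properP; split.
  by apply/fintype.subsetP=> z; rewrite !inE; apply: elt_trans.
by exists y; rewrite !inE ?elt_irr.
Qed.

End Order.

(** * Cycles of singular roots and roots of the nilradical *)

Section Core.
Variables (L B : rel X).
(** For the roots [L] of [l], these are the roots of [k] and those of [n]. *)
Definition symR x y := L x y && L y x.
Definition nilR x y := L x y && ~~ L y x.
Local Notation K := symR.
Local Notation N := nilR.
Local Notation "x ~< y" := (elt N x y) (at level 70, no associativity).
Hypotheses (sL : subsystem L) (sB : subsystem B)
  (B_anti : forall x y, B x y -> ~~ B y x)
  (NB : forall x y, N x y -> B x y)
  (KB : forall x y, K x y -> B x y || B y x).

(** A root of [k] that can be added to [e x - e y] replaces either [x] or [y]. *)
Definition sing x y :=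
  [&& adm x y, ~~ L x y,
      [forall z, K z x && B z x ==> ~~ adm z y] &
      [forall z, K y z && B y z ==> ~~ adm x z]].

(** The singular roots whose root space normalizes [n]. The clause on [N y x] rules
    out brackets with opposite root vectors, which fall into [h]. *)
Definition sing2 x y :=
  [&& sing x y, ~~ N y x,
      [forall z, N z x && adm z y ==> N z y] &
      [forall z, N y z && adm x z ==> N x z]].

(** A cycle of steps is a positive relation between two-sided singular roots and
    differences of indices that are comparable for [n]. *)
Definition step x y := sing2 x y || (y ~< x).

(** The two roots add up to [(e x - e v) + (e u - e y)], where the first difference
    is positive and the second one nonnegative for [n]. *)
Definition solution :=
  exists x y u v, [/\ sing2 x y, sing2 u v, x ~< v & (u == y) || (u ~< y)].

Let Ladm x y : L x y -> adm x y. Proof. by case: sL => h _ _; apply: h. Qed.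
Let Lneg x y : L (neg y) (neg x) = L x y. Proof. by case: sL => _ h _; apply: h. Qed.
Let Ltrans x y z : L x y -> L y z -> adm x z -> L x z.
Proof. by case: sL => _ _; apply. Qed.
Let Bneg x y : B (neg y) (neg x) = B x y. Proof. by case: sB => _ h _; apply: h. Qed.
Let Btrans x y z : B x y -> B y z -> adm x z -> B x z.
Proof. by case: sB => _ _; apply. Qed.

Lemma KC x y : K x y = K y x. Proof. exact: andbC. Qed.
Lemma K_neg x y : K (neg y) (neg x) = K x y. Proof. by rewrite /symR !Lneg. Qed.
Lemma N_neg x y : N (neg y) (neg x) = N x y. Proof. by rewrite /nilR !Lneg. Qed.
Lemma K_adm x y : K x y -> adm x y. Proof. by case/andP=> /Ladm. Qed.
Lemma N_adm x y : N x y -> adm x y. Proof. by case/andP=> /Ladm. Qed.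
Lemma K_L x y : K x y -> L x y. Proof. by case/andP. Qed.
Lemma N_L x y : N x y -> L x y. Proof. by case/andP. Qed.
Lemma L_NK x y : L x y -> N x y \/ K x y.
Proof. by rewrite /nilR /symR => ->; case: (L y x); [right|left]. Qed.
Lemma N_NK x y : N x y -> K x y -> False.
Proof. by case/andP=> _ /negP h /andP[]. Qed.
Lemma N_anti x y : N x y -> ~~ N y x.
Proof. by case/andP=> lxy h; rewrite /nilR lxy andbF. Qed.

Lemma KN x y z : K x y -> N y z -> adm x z -> N x z.
Proof.
case/andP=> xy yx /andP[yz zy] a; rewrite /nilR (Ltrans xy yz a) /=.
by apply/negP=> zx; case/negP: zy; apply: Ltrans zx xy _; rewrite admC Ladm.
Qed.

Lemma NK x y z : N x y -> K y z -> adm x z -> N x z.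
Proof.
by move=> xy yz a; rewrite -N_neg; apply: (@KN _ (neg y)); rewrite ?K_neg ?N_neg ?adm_neg.
Qed.

Lemma K_trans x y z : K x y -> K y z -> adm x z -> K x z.
Proof.
case/andP=> xy yx /andP[yz zy] a; rewrite /symR (Ltrans xy yz a) /=.
by apply: Ltrans zy yx _; rewrite admC.
Qed.

Lemma subsystemN : subsystem N.
Proof.
split=> [x y /N_adm//|x y|x y z xy yz a]; first exact: N_neg.
rewrite /nilR (Ltrans (N_L xy) (N_L yz) a); apply/negP=> zx.
case/andP: yz => yz /negP; apply.
by apply: Ltrans zx (N_L xy) _; rewrite admC Ladm.
Qed.

Let ltT y x z : x ~< y -> y ~< z -> x ~< z.
Proof. exact: (elt_trans subsystemN N_anti). Qed.
Let ltI x : x ~< x -> False. Proof. by rewrite (elt_irr subsystemN N_anti). Qed.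
Let ltA x y : x ~< y -> y ~< x -> False.
Proof. by move=> xy yx; apply: ltI (ltT xy yx). Qed.
Let ltNg x y : (neg y ~< neg x) = (x ~< y). Proof. exact: (elt_neg subsystemN). Qed.
Let lt_adm x y : x ~< y -> adm x y -> N x y.
Proof. exact: (elt_adm subsystemN). Qed.
Let lt_lk x y : x ~< y -> lk x y. Proof. exact: (elt_lk subsystemN). Qed.
Let NW x y : N x y -> x ~< y. Proof. exact: eltW. Qed.

(** An inequality composed with a root of [k] can only be lost by reaching
    [neg x]. *)
Lemma ltK x y z : x ~< y -> K y z -> x ~< z \/ [/\ ~~ lng, z = neg x & N x y].
Proof.
move=> xy yz; have lxz := lk_trans (lt_lk xy) (adm_lk (K_adm yz)).
case/orP: xy => [xy|].
  case: (linkP lxz) => [a|e|nl e]; first by left; apply/NW/(NK xy yz a).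
    by subst z; move: yz; rewrite KC => /(N_NK xy).
  by right; split=> //; rewrite e negK.
case/andP=> [/eqP ey /existsP[w /andP[xw wy]]]; left.
have lwz := lk_trans (adm_lk (N_adm wy)) (adm_lk (K_adm yz)).
case: (linkP lwz) => [a|e|_ e].
- exact: ltT (NW xw) (NW (NK wy yz a)).
- by subst z; move: yz; rewrite KC => /(N_NK wy).
- by apply: NW; rewrite -N_neg -e -ey.
Qed.

Lemma Klt x y z : K x y -> y ~< z -> x ~< z \/ [/\ ~~ lng, z = neg x & N y z].
Proof.
rewrite -K_neg -ltNg => xy yz; case: (ltK yz xy) => [|[nl e h]].
  by rewrite ltNg; left.
by right; split=> //; [rewrite -[x]negK e negK|rewrite -N_neg].
Qed.

Lemma ltKlt x y z w : x ~< y -> K y z -> z ~< w -> x ~< w.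
Proof.
move=> xy yz zw; case: (ltK xy yz) => [h|[_ ez _]]; first exact: ltT h zw.
case: (Klt yz zw) => [h|[_ ew _]]; first exact: ltT xy h.
by subst z w; rewrite ltNg in zw; case: (ltA xy zw).
Qed.

Local Notation rk := (rank B).
Lemma rkB x y : B x y -> rk y < rk x.
Proof. by move=> xy; apply: (elt_rank sB B_anti); apply: eltW. Qed.
Lemma rkBN x y : B x y -> rk (neg x) < rk (neg y).
Proof. by rewrite -Bneg => /rkB. Qed.

Lemma sing_adm x y : sing x y -> adm x y. Proof. by case/and4P. Qed.
Lemma sing_L x y : sing x y -> L x y -> False.
Proof. by case/and4P=> _ /negP. Qed.
Lemma sing_l x y z : sing x y -> K z x -> B z x -> adm z y -> False.
Proof.
case/and4P=> _ _ /forallP/(_ z)/implyP h _ k b; apply/negP/h.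
by rewrite k.
Qed.
Lemma sing_r x y z : sing x y -> K y z -> B y z -> adm x z -> False.
Proof.
case/and4P=> _ _ _ /forallP/(_ z)/implyP h k b; apply/negP/h.
by rewrite k.
Qed.

Lemma sing_intro x y : adm x y -> ~~ L x y ->
  (forall z, K z x -> B z x -> adm z y -> False) ->
  (forall z, K y z -> B y z -> adm x z -> False) -> sing x y.
Proof.
move=> a l h1 h2; apply/and4P; split=> //; apply/forallP=> z; apply/implyP=> /andP[k b].
  by apply/negP; apply: h1 k b.
by apply/negP; apply: h2 k b.
Qed.

Lemma sing_neg x y : sing x y -> sing (neg y) (neg x).
Proof.
move=> s; apply: sing_intro; rewrite ?adm_neg ?Lneg ?(sing_adm s) //.
- by apply/negP; apply: sing_L.
- by move=> z; rewrite -K_neg -Bneg -adm_neg !negK; apply: sing_r.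
- by move=> z; rewrite -K_neg -Bneg -adm_neg !negK; apply: sing_l.
Qed.

Lemma sing2_sing x y : sing2 x y -> sing x y. Proof. by case/and4P. Qed.
Lemma sing2_l x y z : sing2 x y -> N z x -> adm z y -> N z y.
Proof.
case/and4P=> _ _ /forallP/(_ z)/implyP h _ n a; apply: h.
by rewrite n.
Qed.
Lemma sing2_r x y z : sing2 x y -> N y z -> adm x z -> N x z.
Proof.
case/and4P=> _ _ _ /forallP/(_ z)/implyP h n a; apply: h.
by rewrite n.
Qed.
Lemma sing2_N x y : sing2 x y -> N y x -> False.
Proof. by case/and4P=> _ /negP. Qed.

Lemma sing2_intro x y : sing x y -> (N y x -> False) ->
  (forall z, N z x -> adm z y -> N z y) ->
  (forall z, N y z -> adm x z -> N x z) -> sing2 x y.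
Proof.
move=> s n h1 h2; apply/and4P; split=> //; first exact/negP.
  by apply/forallP=> z; apply/implyP=> /andP[]; apply: h1.
by apply/forallP=> z; apply/implyP=> /andP[]; apply: h2.
Qed.

Lemma sing2_neg x y : sing2 x y -> sing2 (neg y) (neg x).
Proof.
move=> s; apply: sing2_intro.
- exact/sing_neg/sing2_sing.
- by rewrite N_neg; apply: sing2_N.
- by move=> z; rewrite -!(N_neg z) -adm_neg !negK; apply: sing2_r.
- by move=> z; rewrite -(N_neg _ z) -(N_neg (neg y) z) -adm_neg !negK; apply: sing2_l.
Qed.

(** The rank of [x] for the order of [b], plus that of [neg y] since [e x - e y]
    grows when [y] goes down. *)
Definition height x y := rk x + rk (neg y).

Lemma height_neg x y : height (neg y) (neg x) = height x y.
Proof. by rewrite /height negK addnC. Qed.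

Lemma height_l x x' y : B x' x -> height x y < height x' y.
Proof. by move=> b; rewrite ltn_add2r rkB. Qed.

Lemma height_r x y y' : B y y' -> height x y < height x y'.
Proof. by move=> b; rewrite ltn_add2l rkBN. Qed.

Lemma height_max (Q : rel X) x y : Q x y ->
  exists u v, Q u v /\ forall u' v', Q u' v' -> height u' v' <= height u v.
Proof.
move=> q; pose P := [pred p : X * X | Q p.1 p.2].
have Pxy : P (x, y) by [].
case: (arg_maxnP (fun p => height p.1 p.2) Pxy) => -[u v] /= quv h.
by exists u, v; split=> // u' v' q'; apply: (h (u', v')).
Qed.

(** The pairs obtained from [(x, y)] by adding a root of [n] and still outside [L].
    A singular root is two-sided when there is none and its opposite is not in
    [n]. *)
Definition above x y u v :=
  [&& adm u v, ~~ L u v & N u x && (v == y) || (u == x) && N y v].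

Lemma above_neg x y u v : above (neg y) (neg x) (neg v) (neg u) = above x y u v.
Proof.
rewrite /above adm_neg Lneg !N_neg !neg_eq orbC.
by rewrite [(u == x) && _]andbC [(v == y) && _]andbC.
Qed.

(** A pair [(u, y)] above [(x, y)] that is not singular is raised by a root of [k].
    Raising [u] stays above [(x, y)]. Raising [y] is impossible as in [(x, y)],
    except to [neg x], and then the new pair is above [(x, y)] under its other
    name. *)
Lemma above_up x y u : sing x y -> above x y u y -> N u x -> sing u y \/
  exists u' v', above x y u' v' /\ height u y < height u' v'.
Proof.
move=> s /and3P[a l _] nux.
case: (boolP (sing u y)) => [|ns]; [by left|right].
case: (pickP (fun z => [&& K z u, B z u & adm z y])) => [z /and3P[k b az]|h1].
  have lz : ~~ L z y by apply: contraNN l => lz; apply: Ltrans lz a; rewrite K_L // KC.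
  case: (linkP (lk_trans (adm_lk (K_adm k)) (adm_lk (N_adm nux)))) => [azx|e|nl e].
  - exists z, y; split; last exact: height_l.
    by rewrite /above az lz (KN k nux azx) eqxx.
  - by subst z; move: k; rewrite KC => /(N_NK nux).
  - subst z; case: (sing_l (z := neg u) s).
    + by rewrite -K_neg negK.
    + by rewrite -Bneg negK.
    case: (linkP (x := neg u) (y := y)) => // [|e|_ /(can_inj negK) e].
    + apply: lk_trans (adm_lk (sing_adm s)).
      by rewrite -lk_neg negK lk_sym; apply: adm_lk (K_adm k).
    + by case: (admNneg nl a); rewrite -e negK.
    + by case: (adm_neq a).
case: (pickP (fun z => [&& K y z, B y z & adm u z])) => [z /and3P[k b az]|h2]; last first.
  case/negP: ns; apply: sing_intro => // z k b az.
    by have := h1 z; rewrite /= k b az.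
  by have := h2 z; rewrite /= k b az.
have lz : ~~ L u z.
  by apply: contraNN l => lz; apply: Ltrans lz _ a; rewrite K_L // KC.
case: (linkP (lk_trans (adm_lk (sing_adm s)) (adm_lk (K_adm k)))) => [axz|e|nl e].
- by case: (sing_r s k b axz).
- by subst z; case: (sing_L s); rewrite K_L // KC.
have {}e : z = neg x by rewrite e negK.
subst z; exists x, (neg u).
have kx : K x (neg y) by rewrite -K_neg negK.
have auy : adm u (neg y).
  case: (linkP (lk_trans (adm_lk (N_adm nux)) (adm_lk (K_adm kx)))) => // [eu|_].
    by subst u; move: nux; rewrite /= => /N_NK; case; rewrite KC.
  by rewrite negK => eu; case: (adm_neq a).
have nu : N y (neg u) by rewrite -N_neg negK; apply: NK nux kx auy.
have e : L x (neg u) = L u (neg x) by rewrite -Lneg negK.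
split; last first.
  rewrite /height negK addnC ltn_add2r; apply: rkB.
  by rewrite -Bneg negK.
by rewrite /above e lz nu eqxx orbT andbT -adm_neg negK az.
Qed.

Lemma sing_progress x y : sing x y -> [\/ sing2 x y, N y x |
  exists u v, [/\ sing u v, height x y < height u v &
                 (N u x /\ v = y) \/ (u = x /\ N y v)]].
Proof.
move=> s; case: (boolP (N y x)) => [|nyx]; first by constructor 2.
case: (boolP [exists u, exists v, above x y u v]) => [|na]; last first.
  constructor 1; apply: sing2_intro => // [|z nz az|z nz az].
  - by move/negP: nyx.
  - case: (boolP (L z y)) => [/L_NK[//|k]|l].
      case/negP: nyx; apply: KN (nz) _; first by rewrite KC.
      by rewrite admC (sing_adm s).
    case/existsP: na; exists z; apply/existsP; exists y.
    by rewrite /above az l nz eqxx.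
  - case: (boolP (L x z)) => [/L_NK[//|k]|l].
      by case/negP: nyx; apply: NK nz _ _; rewrite 1?KC // admC (sing_adm s).
    case/existsP: na; exists x; apply/existsP; exists z.
    by rewrite /above az l nz eqxx orbT.
case/existsP=> u0 /existsP[v0 /height_max[u [v [q hm]]]]; constructor 3.
have suv : sing u v.
  have [_ _ /orP[/andP[nu /eqP ev]|/andP[/eqP eu nv]]] := and3P q.
    subst v; case: (above_up s q nu) => // -[u' [v' [q' hh]]].
    by move: (hm _ _ q'); rewrite leqNgt hh.
  subst u; have q2 : above (neg y) (neg x) (neg v) (neg x) by rewrite above_neg.
  rewrite -[x]negK -[v]negK; apply: sing_neg.
  case: (above_up (sing_neg s) q2) => [||[u' [v' [q' hh]]]] //.
    by rewrite N_neg.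
  move: q' hh; rewrite -[u']negK -[v']negK above_neg !height_neg => /hm.
  by rewrite height_neg leqNgt => /negP.
exists u, v; split=> //.
  have [_ _ /orP[/andP[nu /eqP->]|/andP[/eqP-> nv]]] := and3P q.
    exact/height_l/NB.
  exact/height_r/NB.
have [_ _ /orP[/andP[nu /eqP->]|/andP[/eqP-> nv]]] := and3P q; [by left|by right].
Qed.

(** Induction on the height: a singular root which is neither two-sided nor opposite
    to a root of [n] is the difference of a singular root of larger height and a
    root of [n]. *)
Lemma sing_connect x y : sing x y -> connect step x y.
Proof.
pose M := (#|X| + #|X|).
have hM u v : height u v <= M by rewrite leq_add // max_card.
have [n] := ubnP (M - height x y).
elim: n x y => // n IH x y lt s; case: (sing_progress s) => [s2|nyx|].
- by apply: connect1; rewrite /step s2.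
- by apply: connect1; rewrite /step (NW nyx) orbT.
case=> u [v [suv hh c]].
have cuv : connect step u v.
  apply: IH suv; apply: leq_trans (ltn_sub2l (leq_trans hh (hM _ _)) hh) _.
  by rewrite -ltnS.
case: c => [[nu ev]|[eu nv]].
  subst v; apply: connect_trans cuv; apply: connect1.
  by rewrite /step (NW nu) orbT.
subst u; apply: connect_trans cuv (connect1 _).
by rewrite /step (NW nv) orbT.
Qed.

(** Among the pairs outside [L] with ends in two sets closed under raising, one of
    maximal height is two-sided unless its opposite is in [n]: every root of [k] or
    [n] which raises it leads into [L], and a root of [k] cannot lead into [L] from
    outside. *)
Lemma raise_pair (Q1 Q2 : pred X) x y :
  (forall u z, Q1 u -> N z u -> Q1 z) ->
  (forall u z, Q1 u -> K z u -> B z u -> Q1 z) ->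
  (forall v z, Q2 v -> N v z -> Q2 z) ->
  (forall v z, Q2 v -> K v z -> B v z -> Q2 z) ->
  Q1 x -> Q2 y -> adm x y -> ~~ L x y ->
  exists u v, [/\ Q1 u, Q2 v, adm u v & sing2 u v \/ N v u].
Proof.
move=> n1 k1 n2 k2 qx qy a l.
pose Q u v := [&& adm u v, ~~ L u v, Q1 u & Q2 v].
have [u [v [q hm]]] : exists u v, Q u v /\
    forall u' v', Q u' v' -> height u' v' <= height u v.
  by apply: (@height_max Q x y); rewrite /Q a l qx qy.
have {q}[auv luv qu qv] := and4P q; exists u, v; split=> //.
have hu z : Q1 z -> B z u -> adm z v -> L z v.
  move=> qz b az; apply: contraTT (height_l v b) => lz.
  by rewrite -leqNgt; apply: hm; rewrite /Q az lz qz qv.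
have hv z : Q2 z -> B v z -> adm u z -> L u z.
  move=> qz b az; apply: contraTT (height_r u b) => lz.
  by rewrite -leqNgt; apply: hm; rewrite /Q az lz qz qu.
case: (boolP (N v u)) => [|nvu]; [by right|left].
apply: sing2_intro => [|/(negP nvu)//|z nz az|z nz az].
- apply: sing_intro => // z k b az; case/negP: luv.
    by apply: Ltrans (hu z (k1 _ _ qu k b) b az) auv; rewrite K_L // KC.
  by apply: Ltrans (hv z (k2 _ _ qv k b) b az) _ auv; rewrite K_L // KC.
- case: (L_NK (hu z (n1 _ _ qu nz) (NB nz) az)) => // k.
  by case/negP: nvu; apply: KN nz _; rewrite 1?KC // admC.
- case: (L_NK (hv z (n2 _ _ qv nz) (NB nz) az)) => // k.
  by case/negP: nvu; apply: NK nz _ _; rewrite 1?KC // admC.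
Qed.

(** Raising [u ~< y] by a root of [k] can only leave the indices below [y] by
    reaching [neg y]. The second condition prevents this, and is itself kept by
    raising. *)
Definition below y u := (u ~< y) && (K (neg y) u && B (neg y) u ==> (neg y ~< y)).

Lemma below_N y u z : below y u -> N z u -> below y z.
Proof.
case/andP=> uy _ nz; have zy := ltT (NW nz) uy; rewrite /below zy /=.
apply/implyP=> /andP[k _]; case: (Klt k (NW nz)) => [h|[_ e _]]; first exact: ltT h uy.
by move: uy; rewrite e negK => /ltI.
Qed.

Lemma below_K y u z : below y u -> K z u -> B z u -> below y z.
Proof.
case/andP=> uy /implyP bad kz bz.
have h : K (neg y) z -> B (neg y) z -> neg y ~< y.
  move=> k b; have lk1 := lk_trans (adm_lk (K_adm k)) (adm_lk (K_adm kz)).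
  case: (linkP lk1) => [a|e|_ e].
  - by apply: bad; rewrite (K_trans k kz a) (Btrans b bz a).
  - by rewrite {1}e.
  - by move: uy; rewrite -(can_inj negK e) => /ltI.
case: (Klt kz uy) => [zy|[nl e nuy]].
  by rewrite /below zy; apply/implyP=> /andP[].
have {}e : z = neg y by rewrite e negK.
subst z; rewrite /below bad ?kz //=.
by apply/implyP=> /andP[/K_adm/adm_neq].
Qed.

(** A root of [k] that raises the left end of the sum raises that of [(x, y)],
    unless it turns [(x, y)] into [(neg y, y)], in which case its other name raises
    [(y, z)]. *)
Lemma sing_compose_l x y z w : sing x y -> sing y z -> adm x z ->
  K w x -> B w x -> adm w z -> False.
Proof.
move=> s1 s2 axz k b awz; have [a1 a2] := (sing_adm s1, sing_adm s2).
case: (linkP (lk_trans (adm_lk (K_adm k)) (adm_lk a1))) => [awy|e|nl e].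
- exact: sing_l s1 k b awy.
- by subst w; case: (sing_L s1); rewrite K_L // KC.
subst w; case: (sing_l (z := neg x) s2).
- by rewrite -K_neg negK.
- by rewrite -Bneg negK.
have l1 : lk (neg x) z.
  apply: lk_trans (adm_lk a2); rewrite -lk_neg negK lk_sym.
  exact: adm_lk (K_adm k).
case: (linkP l1) => // [e|_ /(can_inj negK) e]; last by case: (adm_neq axz).
by case: (admNneg nl axz); rewrite -e negK.
Qed.

Lemma sing2_compose_l x y z w : sing2 x y -> sing2 y z -> adm x z ->
  N w x -> adm w z -> N w z.
Proof.
move=> s1 s2 axz n awz.
have [a1 a2] := (sing_adm (sing2_sing s1), sing_adm (sing2_sing s2)).
case: (linkP (lk_trans (adm_lk (N_adm n)) (adm_lk a1))) => [awy|e|nl e].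
- exact: sing2_l s2 (sing2_l s1 n awy) awz.
- by subst w; case: (sing2_N s1 n).
subst w; have n' : N (neg x) y by rewrite -N_neg negK.
have l1 := lk_trans (adm_lk (N_adm n')) (adm_lk a2).
case: (linkP l1) => [a|e|_ /(can_inj negK) e]; last by case: (adm_neq axz).
- have := sing2_l s2 n' a; rewrite -N_neg negK => n2.
  rewrite -N_neg negK; apply: sing2_l s1 n2 _.
  by rewrite -adm_neg negK.
- by case: (admNneg nl axz); rewrite -e negK.
Qed.

Lemma sing2_compose x y z : sing2 x y -> sing2 y z -> adm x z -> ~~ L x z -> sing2 x z.
Proof.
move=> s1 s2 a l; have [s1' s2'] := (sing2_neg s1, sing2_neg s2).
have a' : adm (neg z) (neg x) by rewrite adm_neg.
apply: sing2_intro => [|n|w|w n aw]; last 2 first.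
- exact: sing2_compose_l s1 s2 a.
- have := @sing2_compose_l (neg z) (neg y) (neg x) (neg w) s2' s1' a'.
  by rewrite !N_neg adm_neg; apply.
- apply: sing_intro => // w; first exact: sing_compose_l (sing2_sing s1) (sing2_sing s2) a.
  move=> k b aw; have := @sing_compose_l (neg z) (neg y) (neg x) (neg w)
    (sing2_sing s2') (sing2_sing s1') a'.
  by rewrite K_neg Bneg adm_neg; apply.
- case: (sing2_N s2); apply: sing2_l s1 n _.
  by rewrite admC (sing_adm (sing2_sing s2)).
Qed.

Lemma lt_sing2 x y : x ~< y -> sing2 x y -> False.
Proof.
move=> xy /sing2_sing s; apply: (sing_L s).
exact: N_L (lt_adm xy (sing_adm s)).
Qed.

(** The pair [(q, p)] is raised to a two-sided root that forms a solution with
    [(x, y)]. The opposite of the raised pair is not in [n], for this would give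
    [x ~< y]. *)
Lemma raised_solution x y p q : sing2 x y -> x ~< p -> adm q p -> ~~ L q p ->
  below y q -> below (neg x) (neg p) -> solution.
Proof.
move=> s xp a l bq bp.
have [||||u [v [bu bv av]]] :=
  @raise_pair (below y) (fun v => below (neg x) (neg v)) q p _ _ _ _ bq bp a l.
- exact: below_N.
- exact: below_K.
- by move=> v z bv n; apply: below_N bv _; rewrite N_neg.
- by move=> v z bv k b; apply: below_K bv _ _; rewrite ?K_neg ?Bneg.
have xv : x ~< v by rewrite -ltNg; case/andP: bv.
have uy : u ~< y by case/andP: bu.
case=> [s2|/NW vu]; first by exists x, y, u, v; rewrite uy orbT.
by case: (lt_sing2 (ltT (ltT xv vu) uy) s).
Qed.

(** Consecutive two-sided roots [(x, y)] and [(y, neg x)], whose sum is not a root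
    in orthogonal types. Raising [(y, p)] works here because [y] itself can only be
    raised to indices below [y]: by the singularity of both roots, no root of [k]
    raises it. *)
Lemma telescoped_solution x y p : ~~ lng -> sing2 x y -> sing2 y (neg x) -> x ~< p ->
  adm y p -> ~~ L y p -> below (neg x) (neg p) -> solution.
Proof.
move=> nl s1 s2 xp a l bp; pose Q u := (u == y) || below y u.
have [a1 a2] := (sing_adm (sing2_sing s1), sing_adm (sing2_sing s2)).
have hN u z : Q u -> N z u -> Q z.
  case/orP=> [/eqP->|bu] n; last by rewrite /Q (below_N bu n) orbT.
  apply/orP; right; rewrite /below (NW n) /=; apply/implyP=> /andP[k _].
  case: (linkP (lk_trans (adm_lk (N_adm n)) (adm_lk a2))) => [azx|e|_ e].
  - have := sing2_l s2 n azx; rewrite -N_neg negK => n2.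
    have k2 : K (neg z) y by rewrite -K_neg negK.
    by case: (sing_L (sing2_sing s1)); apply/N_L/(NK n2 k2 a1).
  - by subst z; case: (sing2_N s2 n).
  - by rewrite negK in e; subst z; case: (sing_L (sing2_sing s1) (N_L n)).
have hK u z : Q u -> K z u -> B z u -> Q z.
  case/orP=> [/eqP->|bu] k b; last by rewrite /Q (below_K bu k b) orbT.
  case: (linkP (lk_trans (adm_lk (K_adm k)) (adm_lk a2))) => [azx|e|_ e].
  - by case: (sing_l (sing2_sing s2) k b azx).
  - by subst z; case: (sing_L (sing2_sing s2)); rewrite K_L // KC.
  - by rewrite negK in e; subst z; case: (sing_L (sing2_sing s1) (K_L k)).
have [|||u [v [bu bv av]]] :=
  @raise_pair Q (fun v => below (neg x) (neg v)) y p hN hK _ _ _ bp a l.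
- by move=> v z bv n; apply: below_N bv _; rewrite N_neg.
- by move=> v z bv k b; apply: below_K bv _ _; rewrite ?K_neg ?Bneg.
- by rewrite /Q eqxx.
have xv : x ~< v by rewrite -ltNg; case/andP: bv.
case=> [s|/NW vu].
  by exists x, y, u, v; split=> //; case/orP: bu => [->//|/andP[-> _]]; rewrite orbT.
case: (@lt_sing2 x y _ s1); move: (ltT xv vu).
by case/orP: bu => [/eqP->//|/andP[uy _] xu]; apply: ltT uy.
Qed.

Section ShortCycle.
Variable n : nat.
Hypothesis IH : forall b a s,
  size s < n -> b ~< a -> path step b s -> last b s = a -> solution.

(** A case analysis on the first two steps, after shorter cycles have been ruled
    out; the first one is then a two-sided root, and so is the last one. If the
    second step is a two-sided root too, the two are composed when their sum is a
    root outside [L]. If it goes down, from [v1] to [v2], the pair [(v2, a)] is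
    raised. The exception is [v2 = neg a], where [(v2, a)] is not a root. *)
Lemma shorten_cycle b a s : size s <= n -> b ~< a -> path step b s -> last b s = a ->
  solution \/ exists v s', [/\ ~~ lng, s = v :: neg a :: s', sing2 b v & neg a ~< v].
Proof.
case: s => [|v1 s1]; first by move=> _ ba _ e; move: ba; rewrite -e => /ltI.
move=> sz ba /= /andP[st1 p1] e1.
case/orP: st1 => [s1b|v1b]; last first.
  by left; apply: (IH (s := s1)) e1 => //; apply: ltT v1b ba.
have a1 := sing_adm (sing2_sing s1b).
case: (lastP s1) => [|s' a'] in sz p1 e1 *.
  by rewrite /= in e1; subst v1; case: (lt_sing2 ba s1b).
rewrite last_rcons in e1; subst a'.
have {p1}[p' st'] : path step v1 s' /\ step (last v1 s') a.
  by move: p1; rewrite rcons_path => /andP[].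
rewrite /= size_rcons in sz.
set u := last v1 s' in st'; case/orP: (st') => [sua|au]; last first.
  left; apply: (IH (b := b) (a := u) (s := v1 :: s')) => //=.
    exact: ltT ba au.
  by rewrite /step s1b p'.
have belowa : below (neg b) (neg a).
  rewrite /below ltNg ba /= negK; apply/implyP=> /andP[].
  rewrite -K_neg -Bneg negK => k bb.
  have aua := sing_adm (sing2_sing sua).
  case: (linkP (lk_trans (adm_lk aua) (adm_lk (K_adm k)))) => [aub|e|_ e].
  - by case: (sing_r (sing2_sing sua) k bb aub).
  - by case: (sing_L (sing2_sing sua)); rewrite e K_L // KC.
  - by rewrite negK in e; rewrite e in sua; case: (lt_sing2 ba sua).
have ltbv1 : b ~< v1 -> False by move=> h; apply: lt_sing2 h s1b.
(* the cycle has a second step: a single root from [b] to [a] contradicts [b ~< a] *)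
have [v2 [s2 [es p2 e2 sz2 stv]]] : exists v2 s2, [/\ rcons s' a = v2 :: s2,
    path step v2 s2, last v2 s2 = a, (size s2).+2 <= n & step v1 v2].
  subst u; case: s' p' st' sz {sua} => [|v2 s2] /=.
    by move=> _ st' sz; exists a, [::].
  case/andP=> st2 p2 st' sz; exists v2, (rcons s2 a).
  by rewrite rcons_path p2 st' last_rcons size_rcons sz.
rewrite es; case/orP: stv => [s12|v21].
- have a2 := sing_adm (sing2_sing s12); left.
  case: (linkP (lk_trans (adm_lk a1) (adm_lk a2))) => [abv|e|nl e].
  + case: (boolP (L b v2)) => [/L_NK[nb|k]|l].
    * by exists b, v1, v1, v2; rewrite eqxx (NW nb).
    * have k' : K v2 b by rewrite KC.
      case: (Klt k' ba) => [h|[nl ea nba]].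
        by apply: (IH (b := v2) (a := a) (s := s2)) => //; apply: ltnW.
      case: s2 p2 e2 sz2 es => [|v3 s3] /=.
        move=> _ ev _ _; subst v2.
        by case: (N_NK nba k).
      case/andP=> st3 p3 e3 sz3 _; case/orP: st3 => [s23|v32].
        have bk : B b v2.
          case/orP: (KB k) => // b2; case: (sing_l (sing2_sing s1b) k' b2).
          by rewrite admC.
        have l3 := lk_trans (adm_lk (K_adm k)) (adm_lk (sing_adm (sing2_sing s23))).
        case: (linkP l3) => [a3|e|_ e].
        - by case: (sing_l (sing2_sing s23) k bk a3).
        - apply: (IH (b := b) (a := a) (s := s3)) => //; last by rewrite e.
            by apply: leq_trans sz3; rewrite ltnS ltnW.
          by rewrite e.
        - have := sing2_neg s23; rewrite -e -[neg v2]ea.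
          by move/(lt_sing2 ba).
      case: (ltK v32 k') => [h|[_ eb _]].
        apply: (IH (b := v3) (a := a) (s := s3)) => //.
          by apply: leq_trans sz3; rewrite ltnS ltnW.
        exact: ltT h ba.
      by move: v32; rewrite -ltNg -ea -eb => /(ltA ba).
    * apply: (IH (b := b) (a := a) (s := v2 :: s2)) => //=.
      by rewrite /step (sing2_compose s1b s12 abv l) p2.
  + by subst v2; apply: (IH (b := b) (a := a) (s := s2)) => //; apply: ltnW.
  + have e' : v2 = neg b by rewrite e negK.
    subst v2; have l1 : lk v1 a.
      by apply: lk_trans (lt_lk ba); rewrite lk_sym adm_lk.
    have a1a : adm v1 a.
      case: (linkP l1) => // [ea|_ ea]; first by case: ltbv1; rewrite ea.
      have := sing2_neg s12; rewrite negK ea negK => /lt_sing2.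
      by case.
    case: (boolP (L v1 a)) => [/L_NK[n1|k1]|l1a].
    * by apply: (IH (b := v1) (a := a) (s := neg b :: s2)) => //=; [exact: NW|
        rewrite /step s12 p2].
    * have k1' : K a v1 by rewrite KC.
      case: (ltK ba k1') => [/ltbv1//|[_ e1 _]].
      by case: (admNneg nl a1); rewrite e1 negK.
    * exact: (telescoped_solution nl s1b s12 ba a1a l1a belowa).
- have l2 : lk v2 a.
    apply: lk_trans (lt_lk ba); apply: lk_trans (lt_lk v21) _.
    by rewrite lk_sym adm_lk.
  case: (linkP l2) => [a2|e|nl e].
  + left; case: (boolP (L v2 a)) => [/L_NK[n2|k2]|l2a].
    * apply: (IH (b := v2) (a := a) (s := s2)) => //; last exact: NW.
      exact: ltnW.
    * by case: ltbv1; apply: ltKlt ba _ v21; rewrite KC.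
    * case: s2 es p2 e2 sz2 => [|v3 s3] /= es p2 e2 sz2.
        by case: (adm_neq a2).
      case/andP: p2 => /orP[s23|v32] p3; last first.
        apply: (IH (b := b) (a := a) (s := v1 :: v3 :: s3)) => //=.
        by rewrite /step s1b (ltT v32 v21) orbT.
      apply: (raised_solution s1b ba a2 l2a) belowa.
      rewrite /below v21; apply/implyP=> /andP[k bb].
      have a3 := sing_adm (sing2_sing s23).
      case: (linkP (lk_trans (adm_lk (K_adm k)) (adm_lk a3))) => [a4|e|nl e].
      - by case: (sing_l (sing2_sing s23) k bb a4).
      - by case: (sing_L (sing2_sing s23)); rewrite -e K_L // KC.
      - move: s23; rewrite -(can_inj negK e) => s23.
        by case: (lt_sing2 v21 s23).
  + by case: ltbv1; apply: ltT ba _; rewrite -e.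
  + by right; exists v1, s2; rewrite -e; split.
Qed.

End ShortCycle.

(** In the exceptional case of [shorten_cycle] the cycle is rotated so that it
    starts with [neg a ~< v]. If it is exceptional again, the two roots found,
    one of them under its other name, form a solution. *)
Lemma cycle_solution b a s : b ~< a -> path step b s -> last b s = a -> solution.
Proof.
have [n] := ubnP (size s); elim: n b a s => // n IH b a s sz ba p e.
have h b' a' s' : size s' < n -> b' ~< a' -> path step b' s' ->
  last b' s' = a' -> solution by apply: IH.
case: (shorten_cycle h sz ba p e) => // -[v [s' [nl es s1 av]]].
subst s; move: p e; rewrite /= => /and3P[p1 p2 p3] e.
case: (shorten_cycle (b := neg a) (a := v) (s := rcons (rcons s' b) v) h) => //.
- by rewrite !size_rcons.
- by rewrite !rcons_path !last_rcons p3 e p1 /step ba orbT.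
- by rewrite last_rcons.
move=> [w [s2 [_ _ s2w vw]]].
exists b, v, (neg w), a; split=> //; first by rewrite -[a]negK; apply: sing2_neg.
by rewrite -ltNg negK vw orbT.
Qed.

(** The form in which the cycle comes out of the cone condition: arrows are
    singular roots and roots of [n]. *)
Lemma solutionP b a :
  N b a -> connect (fun x y => sing x y || N y x) b a -> solution.
Proof.
move=> ba cba; have /connectP[p pp e] : connect step b a.
  apply: connect_sub cba => x y /orP[|n]; first exact: sing_connect.
  by apply: connect1; rewrite /step (NW n) orbT.
exact: cycle_solution (NW ba) pp (esym e).
Qed.

End Core.
End Admissible.

Local Open Scope ring_scope.

(** * Jordan decomposition *)

Section JordanChevalley.
Variables (F : numClosedFieldType) (n' : nat).
Local Notation n := n'.+1.
Implicit Types (A B : 'M[F]_n).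

Lemma nilpotent_trace A m : A ^+ m = 0 -> \tr A = 0.
Proof.
move=> Am0; have [rs rsE] := closed_field_poly_normal (char_poly A).
rewrite (monicP (char_poly_monic A)) scale1r in rsE.
have rs0 r : r \in rs -> r = 0.
  move=> rrs; have : root (char_poly A) r by rewrite rsE root_prod_XsubC.
  rewrite -eigenvalue_root_char => /eigenvalueP[v vA v0].
  have vAk k : v *m A ^+ k = r ^+ k *: v.
    elim: k => [|k IH]; first by rewrite expr0 scale1r mulmx1.
    by rewrite exprSr mulmxA IH -scalemxAl vA scalerA -exprSr.
  have := vAk m; rewrite Am0 mulmx0 => /esym/eqP.
  by rewrite scaler_eq0 (negPf v0) orbF expf_eq0 => /andP[_ /eqP].
have cA : char_poly A = 'X^n.
  rewrite rsE; have <- : size rs = n.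
    by apply: succn_inj; rewrite -(size_char_poly A) rsE size_prod_XsubC.
  move: rs0; elim: rs {rsE} => [|r rs IH] h; first by rewrite big_nil expr0.
  rewrite big_cons (h r) ?mem_head // subr0 IH ?exprS //.
  by move=> x xs; apply: h; rewrite inE xs orbT.
have := @char_poly_trace F n A isT; rewrite cA coefXn /=.
by rewrite ltn_eqF // => /eqP; rewrite eq_sym oppr_eq0 => /eqP.
Qed.

Lemma prod_dvdp (rs : seq F) m (q : {poly F}) : uniq rs ->
  (forall r, r \in rs -> ('X - r%:P) ^+ m %| q) ->
  \prod_(r <- rs) ('X - r%:P) ^+ m %| q.
Proof.
elim: rs => [|r rs IH] /=; first by rewrite big_nil dvd1p.
case/andP=> rrs urs h; rewrite big_cons Gauss_dvdp; last first.
  rewrite coprimep_expl // big_seq.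
  elim/big_ind: _ => [|p1 p2|x xrs]; first exact: coprimep1.
    by rewrite coprimepMr => -> ->.
  rewrite coprimep_expr // coprimep_XsubC root_XsubC.
  by apply: contraNneq rrs => <-.
rewrite h ?mem_head // IH // => x xs; apply: h.
by rewrite inE xs orbT.
Qed.

(** The Chinese remainder theorem, one root at a time. *)
Lemma interpolation_poly (rs : seq F) m : uniq rs ->
  exists p : {poly F}, forall r, r \in rs -> ('X - r%:P) ^+ m %| p - r%:P.
Proof.
elim: rs => [|r rs IH] /=; first by exists 0.
case/andP=> rrs /IH[p hp].
pose f := \prod_(x <- rs) ('X - x%:P) ^+ m; pose e := ('X - r%:P) ^+ m.
have cfe : coprimep f e.
  rewrite /f /e coprimep_expr // big_seq.
  elim/big_ind: _ => [|p1 p2|x xrs]; first by rewrite coprime1p.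
    by rewrite coprimepMl => -> ->.
  rewrite coprimep_expl // coprimep_sym coprimep_XsubC root_XsubC.
  by apply: contraNneq rrs => <-.
have /Bezout_eq1_coprimepP[[u v] /= uv] := cfe.
have uv1 : v * e = 1 - u * f by rewrite -uv addrC addKr.
exists (p * (v * e) + r%:P * (u * f)) => x; rewrite inE => /predU1P[->|xrs].
  have -> : p * (v * e) + r%:P * (u * f) - r%:P = (p - r%:P) * v * e.
    by rewrite -[in RHS]mulrA uv1; ring.
  exact: dvdp_mulIr.
have -> : p * (v * e) + r%:P * (u * f) - x%:P = (p - x%:P) + (r%:P - p) * u * f.
  by rewrite uv1; ring.
rewrite dvdp_addr ?hp // dvdp_mull // /f (big_rem x) //=.
exact: dvdp_mulIl.
Qed.

(** The semisimple part is a polynomial in [A] which is congruent to each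
    eigenvalue [r] modulo a high power of ['X - r]; both claims follow from the
    theorem of Cayley and Hamilton. *)
Lemma jordan_chevalley A : exists p : {poly F},
  diagonalizable (horner_mx A p) /\ exists m, (A - horner_mx A p) ^+ m = 0.
Proof.
have [rs rsE] := closed_field_poly_normal (char_poly A).
rewrite (monicP (char_poly_monic A)) scale1r in rsE.
pose us := undup rs; pose m := (size rs).+1.
have kill q : (forall r, r \in us -> ('X - r%:P) ^+ m %| q) -> horner_mx A q = 0.
  move=> /(prod_dvdp (undup_uniq rs)) h.
  have /dvdpP[w ->] : char_poly A %| q.
    apply: dvdp_trans h; rewrite rsE -prodr_undup_exp_count.
    rewrite -/us; elim: us => [|r us IH]; first by rewrite !big_nil dvdpp.
    rewrite !big_cons dvdp_mul // dvdp_exp2l //.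
    exact: leq_trans (count_size _ _) (leqnSn _).
  by rewrite rmorphM /= Cayley_Hamilton mulr0.
have [p hp] := interpolation_poly m (undup_uniq rs).
exists p; split.
  apply/diagonalizableP; exists us; first exact: undup_uniq.
  apply: mxminpoly_min; rewrite rmorph_prod /=.
  have -> : \prod_(i <- us) horner_mx (horner_mx A p) ('X - i%:P) =
            horner_mx A (\prod_(i <- us) (p - i%:P)).
    rewrite rmorph_prod; apply: eq_bigr => i _.
    by rewrite !rmorphB /= horner_mx_X !horner_mx_C.
  apply: kill => r rus; rewrite (big_rem r) //=.
  by rewrite dvdp_mulr // hp.
exists m; rewrite -{1}(horner_mx_X A) -rmorphB -rmorphXn /=.
apply: kill => r rus; apply: dvdp_exp2r.
have -> : 'X - p = ('X - r%:P) - (p - r%:P) by ring.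
rewrite dvdp_sub //; apply: dvdp_trans (hp r rus).
by rewrite exprS dvdp_mulIl.
Qed.

End JordanChevalley.

(** * Lie subalgebras *)

Section LieBasics.
Variables (F : fieldType) (g : lieAlgType F).
Implicit Types (x y z : g) (U V W : {vspace g}).

Lemma lie_is_linear x : linear (lie x).
Proof. by move=> a y z; rewrite lie_linearr. Qed.

HB.instance Definition _ x := GRing.isLinear.Build F g g _ (lie x) (lie_is_linear x).

Lemma lieC x y : lie x y = - lie y x.
Proof.
have lD u v w : lie (u + v) w = lie u w + lie v w.
  by rewrite -[u]scale1r lie_linearl !scale1r.
have := liexx (x + y); rewrite lD !linearD /= !liexx addr0 add0r => /eqP.
by rewrite addr_eq0 => /eqP.
Qed.

Lemma lieZl a x y : lie (a *: x) y = a *: lie x y.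
Proof. by rewrite lieC linearZ /= -scalerN -lieC. Qed.

Lemma lie0l x : lie 0 x = 0. Proof. by rewrite lieC linear0 oppr0. Qed.

Lemma lie_suml I (r : seq I) (P : pred I) (u : I -> g) x :
  lie (\sum_(i <- r | P i) u i) x = \sum_(i <- r | P i) lie (u i) x.
Proof. by rewrite lieC linear_sum -sumrN; apply: eq_bigr => i _; rewrite -lieC. Qed.

Lemma lie_leibniz x y z : lie x (lie y z) = lie (lie x y) z + lie y (lie x z).
Proof.
have /eqP := lie_jacobi x y z; rewrite -addrA addr_eq0 => /eqP->.
by rewrite opprD addrC -lieC [lie z x]lieC linearN opprK.
Qed.

Lemma mem_lieprod U V x y : x \in U -> y \in V -> lie x y \in lieprod U V.
Proof.
move=> xU yV; rewrite (coord_vbasis xU) (coord_vbasis yV) lie_suml.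
apply: memv_suml => i _; rewrite lieZl linear_sum /=; apply/memvZ/memv_suml => j _.
rewrite linearZ /=; apply/memvZ/memv_span/allpairsP.
exists ((vbasis U)`_i, (vbasis V)`_j) => /=.
by split=> //; apply: mem_nth; rewrite size_tuple.
Qed.

Lemma lieprod_sub U V W :
  (forall x y, x \in U -> y \in V -> lie x y \in W) -> (lieprod U V <= W)%VS.
Proof.
move=> h; apply/span_subvP => _ /allpairsP[[x y] /= [xU yV ->]].
by apply: h; apply: vbasis_mem.
Qed.

(** Replaces a possibly infinite family by a finite one without deciding the
    property; it serves to diagonalize all the semisimple elements of [h] at
    once. *)
Lemma finite_spanning (Q : g -> Prop) : exists s : seq g,
  (forall x, x \in s -> Q x) /\ forall x, Q x -> x \in <<s>>%VS.
Proof.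
suff: forall k (s : seq g), (\dim {:g} - \dim <<s>> < k)%N ->
    (forall x, x \in s -> Q x) -> exists s : seq g,
    (forall x, x \in s -> Q x) /\ forall x, Q x -> x \in <<s>>%VS.
  by move=> /(_ (\dim {:g} - \dim <<[::] : seq g>>).+1 [::]); apply.
elim=> // k IH s lt sQ.
case: (pselect (exists x, Q x /\ x \notin <<s>>%VS)) => [[x [Qx xs]]|no].
  apply: (IH (x :: s)); last by move=> y; rewrite inE => /predU1P[->|/sQ].
  have ds : (\dim <<s>> < \dim <<x :: s>>)%N.
    rewrite ltnNge; apply: contraNN xs => le.
    have /eqP -> : <<s>>%VS == <<x :: s>>%VS.
      by rewrite eqEdim le andbT span_cons addvSr.
    by rewrite memv_span ?mem_head.
  rewrite -ltnS; apply: leq_trans lt; rewrite ltnS ltn_sub2l //.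
  exact: leq_trans ds (dimvS (subvf _)).
exists s; split=> // x Qx; apply: contrapT => /negP xs.
by apply: no; exists x.
Qed.

Section Cartan.
Variable (h : {vspace g}).
Hypotheses (hsub : lie_subalgebra h) (hself : self_normalizing h).

Lemma iter_lieprod_sub k : (iter k (lieprod h) h <= h)%VS.
Proof.
elim: k => //= k IH; apply: lieprod_sub => x y xh yk.
by apply: hsub => //; apply: subvP IH _ yk.
Qed.

(** The descent of Engel's theorem. Suppose [x] satisfies [Q] and lies outside [h],
    and that the term [C i.+1] of the lower central series of [h] sends it into [h].
    Moving [x] by elements of [C i] as long as it stays outside [h] makes [C i] send
    it into [h]. At [i = 0] it normalizes [h], a contradiction. *)
Lemma engel_self_normalizing (Q : g -> Prop) k :
  iter k (lieprod h) h = 0%VS ->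
  (forall x y, Q x -> y \in h -> Q (lie y x)) ->
  (forall x y, Q x -> y \in h -> exists m, iter m (lie y) x \in h) ->
  forall x, Q x -> x \in h.
Proof.
pose C i := iter i (lieprod h) h => Ck Qlie Qnil x0 Qx0.
apply: contrapT => x0h.
have inC i z y : z \in h -> y \in C i -> lie z y \in C i.+1 by apply: mem_lieprod.
have Ch i z : z \in C i -> z \in h by move/(subvP (iter_lieprod_sub i)).
have {x0h Qx0} : exists x, [/\ Q x, x \notin h & forall z, z \in C k -> lie z x \in h].
  exists x0; split=> //; first exact/negP.
  by move=> z; rewrite /C Ck memv0 => /eqP->; rewrite lie0l mem0v.
elim: k {Ck} => [|i IH] [x [Qx xh Cx]].
  case/negP: xh; apply: hself => y yh.
  by rewrite lieC memvN; apply: Cx.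
apply: IH; suff: forall s : seq g, {subset s <= C i} -> exists x,
    [/\ Q x, x \notin h, forall z, z \in C i.+1 -> lie z x \in h &
        forall y, y \in s -> lie y x \in h].
  move=> /(_ (vbasis (C i)) (fun y => @vbasis_mem _ _ y _)) [x' [Qx' x'h Cx' sx']].
  exists x'; split=> // z zC; rewrite (coord_vbasis zC) lie_suml.
  apply: memv_suml => j _; rewrite lieZl memvZ // sx' //.
  by rewrite mem_nth ?size_tuple.
elim=> [|y s IHs] sC; first by exists x.
have [|x' [Qx' x'h Cx' sx']] := IHs.
  by move=> z zs; apply: sC; rewrite inE zs orbT.
have yC : y \in C i by apply: sC; rewrite mem_head.
have yh := Ch _ _ yC.
pose I w := [/\ Q w, forall z, z \in C i.+1 -> lie z w \in h &
                forall z, z \in s -> lie z w \in h].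
have Istep w : I w -> I (lie y w).
  case=> Qw Cw sw; split=> [|z zC|z zs]; first exact: Qlie.
    rewrite lie_leibniz memvD //; last by apply: hsub (Cw _ zC).
    exact/Cw/(inC _ _ _ (Ch _ _ zC) yC).
  have zC : z \in C i by apply: sC; rewrite inE zs orbT.
  rewrite lie_leibniz memvD //; last by apply: hsub (sw _ zs).
  exact/Cw/(inC _ _ _ (Ch _ _ zC) yC).
have Iiter m : I (iter m (lie y) x') by elim: m => //= m; apply: Istep.
have exm : exists m, iter m (lie y) x' \in h by apply: Qnil.
case: (ex_minnP exm) => -[|m] mh mmin; first by rewrite /= mh in x'h.
exists (iter m (lie y) x'); have [Qw Cw sw] := Iiter m.
split=> // [|z]; first by apply/negP => /mmin; rewrite ltnn.
by rewrite inE => /predU1P[->|/sw].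
Qed.

End Cartan.

End LieBasics.

Lemma subrACA (V : zmodType) (a b c d : V) : a - c - (b - d) = (a - b) - (c - d).
Proof. by rewrite !opprB addrACA [RHS]addrACA; congr (_ + _); rewrite addrC. Qed.

(** As in the binomial formula: applying the difference once lowers one of the two
    exponents. *)
Lemma iter_sub_nilpotent (V : zmodType) (u v : V -> V) :
  {morph u : x y / x - y} -> {morph v : x y / x - y} ->
  (forall x, u (v x) = v (u x)) -> forall a b x,
  iter a u x = 0 -> iter b v x = 0 -> iter (a + b) (fun x => u x - v x) x = 0.
Proof.
move=> uB vB uv; pose w x := u x - v x.
have u0 : u 0 = 0 by rewrite -{1}(subrr 0) uB subrr.
have v0 : v 0 = 0 by rewrite -{1}(subrr 0) vB subrr.
have w0 k : iter k w 0 = 0 by elim: k => //= k ->; rewrite /w u0 v0 subrr.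
have wB k : {morph iter k w : x y / x - y}.
  elim: k => [//|k IH] x y; rewrite !iterS IH /w uB vB.
  by rewrite !opprB addrACA [RHS]addrACA; congr (_ + _); rewrite addrC.
have uI k x : u (iter k v x) = iter k v (u x) by elim: k => //= k <-.
have vI k x : v (iter k u x) = iter k u (v x) by elim: k => //= k <-.
suff: forall k a b x, (a + b = k)%N -> iter a u x = 0 -> iter b v x = 0 -> iter k w x = 0.
  by move=> h a b x; apply: h.
elim=> [[] [] //= a b x|k IH [|a] [|b] x] //=.
- by move=> _ -> _; rewrite w0; rewrite /w u0 v0 subrr.
- by move=> _ _ ->; rewrite w0; rewrite /w u0 v0 subrr.
move=> [ab] ua vb; rewrite -iterS iterSr {2}/w wB.
have -> : iter k w (u x) = 0.
  by apply: (IH a b.+1) => //; [rewrite -iterSr|rewrite -[RHS]u0 -vb -(uI b.+1)].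
have -> : iter k w (v x) = 0.
  by apply: (IH a.+1 b); [rewrite addSn -addnS|rewrite -[RHS]v0 -ua -(vI a.+1)|rewrite -iterSr].
by rewrite subrr.
Qed.

(** * Semisimple elements of a Cartan subalgebra *)

Section MatrixAd.
Variables (F : numClosedFieldType) (n' : nat).
Local Notation n := n'.+1.
Implicit Types (A B S X : 'M[F]_n).

Definition mxad B X := B * X - X * B.

Lemma mxadB B : {morph mxad B : X Y / X - Y}.
Proof.
by move=> X Y; rewrite /mxad mulrBr mulrBl subrACA.
Qed.

Lemma mxad_comm A B X : A * B = B * A -> mxad A (mxad B X) = mxad B (mxad A X).
Proof.
move=> AB; rewrite /mxad !mulrBr !mulrBl !mulrA AB -!mulrA AB !mulrA.
by rewrite subrACA.
Qed.

Lemma mxad_nilpotent A m X : A ^+ m = 0 -> iter (m + m) (mxad A) X = 0.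
Proof.
move=> Am0; have iL k : iter k (fun Y => A * Y) X = A ^+ k * X.
  by elim: k => [|k /= ->]; rewrite ?mul1r // exprS mulrA.
have iR k : iter k (fun Y => Y * A) X = X * A ^+ k.
  by elim: k => [|k /= ->]; rewrite ?mulr1 // exprSr mulrA.
apply: (@iter_sub_nilpotent _ (fun Y => A * Y) (fun Y => Y * A)).
- by move=> Y Z; rewrite mulrBr.
- by move=> Y Z; rewrite mulrBl.
- by move=> Y; rewrite mulrA.
- by rewrite iL Am0 mul0r.
- by rewrite iR Am0 mulr0.
Qed.

Lemma diagonalizable_conj S : diagonalizable S ->
  exists P d, [/\ P \in unitmx & S = invmx P *m diag_mx d *m P].
Proof.
case=> P Pu /(diagonalizable_forLR Pu)[d ->]; exists P, d.
by split=> //; rewrite mxpoly.conjVmx.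
Qed.

(** In an eigenbasis of [S] the operator [mxad S] multiplies each matrix entry by a
    difference of eigenvalues, so its generalized kernel is its kernel. *)
Lemma diagonalizable_ad S k X : diagonalizable S -> iter k (mxad S) X = 0 ->
  S * X = X * S.
Proof.
move=> /diagonalizable_conj[P [d [Pu SE]]].
set D := diag_mx d => Xk; pose c X := P *m X *m invmx P.
have cM Y Z : c (Y * Z) = c Y * c Z.
  by rewrite /c -![_ * _]/(_ *m _) !mulmxA mulmxKV.
have cI Y : c (invmx P *m Y *m P) = Y.
  by rewrite /c !mulmxA mulmxV // mul1mx mulmxK.
have cB Y Z : c (Y - Z) = c Y - c Z by rewrite /c mulmxBr mulmxBl.
have cinj : injective c.
  move=> Y Z /(congr1 (fun W => invmx P *m W *m P)).
  by rewrite /c !mulmxA !mulVmx // !mul1mx !mulmxKV.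
have cS : c S = D by rewrite SE cI.
have dL (Y : 'M[F]_n) i j : (D * Y) i j = d 0 i * Y i j by rewrite [D * Y]mul_diag_mx mxE.
have dR (Y : 'M[F]_n) i j : (Y * D) i j = Y i j * d 0 j by rewrite [Y * D]mul_mx_diag mxE.
have {}Xk : iter k (mxad D) (c X) = 0.
  have <- : c (iter k (mxad S) X) = iter k (mxad D) (c X).
    by elim: k {Xk} => //= k <-; rewrite {1}/mxad cB !cM cS.
  by rewrite Xk /c mulmx0 mul0mx.
apply: cinj; rewrite !cM cS; apply/matrixP=> i j.
have ij : (d 0 i - d 0 j) ^+ k * c X i j = 0.
  have <- : iter k (mxad D) (c X) i j = (d 0 i - d 0 j) ^+ k * c X i j.
    elim: k {Xk} => [|k IH]; first by rewrite mul1r.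
    rewrite iterS /mxad [LHS]mxE [X in _ + X = _]mxE dL dR IH exprS.
    by ring.
  by rewrite Xk mxE.
rewrite dL dR; move/eqP: ij.
rewrite mulf_eq0 expf_eq0 subr_eq0 => /orP[/andP[_ /eqP->]|/eqP->].
  by rewrite mulrC.
by rewrite mulr0 mul0r.
Qed.

Lemma diagonalizable_nilpotent0 S m : diagonalizable S -> S ^+ m = 0 -> S = 0.
Proof.
move=> /diagonalizable_conj[P [d [Pu ->]]] Sm.
have e k : (invmx P *m diag_mx d *m P) ^+ k = invmx P *m (diag_mx d) ^+ k *m P.
  elim: k => [|k IH]; first by rewrite !expr0 mulmx1 mulVmx.
  by rewrite !exprS IH -![_ * _]/(_ *m _) !mulmxA mulmxK.
have Dm : (diag_mx d) ^+ m = 0.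
  have := congr1 (fun W => P *m W *m invmx P) Sm.
  by rewrite /= e mulmx0 mul0mx !mulmxA mulmxV // mul1mx mulmxK.
suff -> : d = 0 by rewrite linear0 mulmx0 mul0mx.
apply/rowP=> i; rewrite mxE; have /matrixP/(_ i i) := Dm.
have -> : diag_mx d ^+ m = diag_mx (\row_j d 0 j ^+ m).
  elim: m {Sm Dm} => [|m IH].
    by apply/matrixP=> j k; rewrite !mxE; case: eqP => [->|]; rewrite ?mxE.
  rewrite exprS IH [_ * _]mul_diag_mx; apply/matrixP=> j k; rewrite !mxE exprS.
  by rewrite mulrnAr.
rewrite !mxE eqxx mulr1n => /eqP; rewrite expf_eq0 => /andP[_ /eqP//].
Qed.

End MatrixAd.

Section CartanMatrices.
Variables (F : numClosedFieldType) (g : lieAlgType F) (h : {vspace g}) (n' : nat).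
Local Notation n := n'.+1.
Hypothesis hC : cartan_subalgebra h.

(** The image contains the semisimple parts of its elements. *)
Definition jordan_stable (f : g -> 'M[F]_n) := forall y (p : {poly F}),
  diagonalizable (horner_mx (f y) p) ->
  (exists m, (f y - horner_mx (f y) p) ^+ m = 0) ->
  exists s, f s = horner_mx (f y) p.

Definition lie_embedding (f : g -> 'M[F]_n) :=
  injective f /\ forall x y, f (lie x y) = f x *m f y - f y *m f x.

Definition toral (f : g -> 'M[F]_n) a := a \in h /\ diagonalizable (f a).

Section Frame.
Variable f : {linear g -> 'M[F]_n}.
Hypotheses (fL : lie_embedding f) (fJ : jordan_stable f).

Let finj : injective f. Proof. by case: fL. Qed.
Let flie x y : f (lie x y) = mxad (f x) (f y). Proof. by case: fL => _ ->. Qed.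

Lemma iter_ad k x y : f (iter k (lie y) x) = iter k (mxad (f y)) (f x).
Proof. by elim: k => //= k <-; rewrite flie. Qed.

Lemma cartan_ad_nilpotent : exists k, iter k (lieprod h) h = 0%VS /\
  forall x y, x \in h -> y \in h -> iter k (lie y) x = 0.
Proof.
case: hC => _ [k hk] _; exists k; split=> // x y xh yh.
apply/eqP; rewrite -memv0 -hk; elim: {hk} k => //= k IH.
exact: mem_lieprod.
Qed.

Lemma toral_central a x : toral f a -> x \in h -> lie a x = 0.
Proof.
move=> [ah da] xh; have [k [_ /(_ x a xh ah) e]] := cartan_ad_nilpotent.
apply: finj; rewrite linear0 flie /mxad (diagonalizable_ad (k := k) da) ?subrr //.
by rewrite -iter_ad e linear0.
Qed.

(** The semisimple part of [y] acts on [h] as a difference of two commuting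
    nilpotent operators, those of [y] and of its nilpotent part. Being
    diagonalizable it centralizes [h], and so it lies in [h]. *)
Lemma toral_part y : y \in h ->
  exists a, toral f a /\ exists m, (f y - f a) ^+ m = 0.
Proof.
move=> yh; have [p [dp [m pm]]] := jordan_chevalley (f y).
have [s sE] := fJ dp (ex_intro _ m pm).
rewrite -sE in dp pm; exists s; split; last by exists m.
split=> //; have [k [_ hk]] := cartan_ad_nilpotent.
case: hC => _ _; apply=> x xh.
have cy : f y * f s = f s * f y by rewrite sE; apply: comm_mx_horner.
suff -> : lie s x = 0 by apply: mem0v.
apply: finj; rewrite linear0 flie /mxad.
rewrite (diagonalizable_ad (k := k + (m + m)) dp) ?subrr //.
have -> : mxad (f s) = fun X => mxad (f y) X - mxad (f y - f s) X.
  apply/funext=> X; rewrite /mxad mulrBl mulrBr.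
  by rewrite [Z in _ = _ - Z]subrACA subKr.
apply: (iter_sub_nilpotent (u := mxad (f y)) (v := mxad (f y - f s))).
- exact: mxadB.
- exact: mxadB.
- by move=> X; apply: mxad_comm; rewrite mulrBr mulrBl cy.
- by rewrite -iter_ad hk ?linear0.
- exact: mxad_nilpotent.
Qed.

(** On the centralizer of the toral elements an element of [h] acts as its nilpotent
    part does, and Engel's argument applies. *)
Lemma toral_centralizer x : (forall a, toral f a -> lie a x = 0) -> x \in h.
Proof.
have [k [hk _]] := cartan_ad_nilpotent; case: (hC) => hsub _ hself.
apply: (engel_self_normalizing hsub hself
  (Q := fun x => forall a, toral f a -> lie a x = 0) hk) => {}x y Qx yh.
  by move=> a ta; rewrite lie_leibniz (toral_central ta yh) lie0l Qx // linear0 addr0.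
have [a [ta [m am]]] := toral_part yh; exists (m + m)%N.
suff -> : iter (m + m) (lie y) x = 0 by apply: mem0v.
apply: finj; rewrite linear0 iter_ad -(mxad_nilpotent (f x) am).
have ca : f y * f a = f a * f y.
  have := toral_central ta yh; move/(congr1 f); rewrite flie linear0 => /eqP.
  by rewrite subr_eq0 => /eqP.
have Qi j : mxad (f a) (iter j (mxad (f y)) (f x)) = 0.
  elim: j => [|j IH] /=; first by rewrite -flie Qx // linear0.
  by rewrite mxad_comm // IH /mxad mulr0 mul0r subrr.
elim: (m + m)%N => //= j IH; rewrite -IH.
by have := Qi j; rewrite /mxad mulrBl mulrBr subrACA => ->; rewrite subr0.
Qed.

Lemma toral_frame : exists P, P \in unitmx /\
  forall a, toral f a -> is_diag_mx (P *m f a *m invmx P).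
Proof.
have [s [sT sS]] := finite_spanning (toral f).
have /codiagonalizableP [P Pu /allP Pd] : {in map f s &, forall A B, comm_mx A B} /\
    {in map f s, forall A, diagonalizable A}.
  split=> [_ _ /mapP[a /sT ta ->] /mapP[b /sT tb ->]|_ /mapP[a /sT[_ ta] ->] //].
  have := toral_central ta tb.1; move/(congr1 f); rewrite flie linear0 => /eqP.
  by rewrite subr_eq0 => /eqP.
exists P; split=> // a /sS as_; rewrite (@coord_span _ _ _ (in_tuple s) a as_).
apply/is_diag_mxP => i j ij; rewrite linear_sum mulmx_sumr mulmx_suml summxE.
rewrite big1 // => k _; rewrite linearZ /= -scalemxAr -scalemxAl mxE.
have := Pd (f (in_tuple s)`_k) _; rewrite /= /similar_to conjumx // => h'.
rewrite (is_diag_mxP (h' _)) ?mulr0 //.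
by apply: map_f; rewrite mem_nth.
Qed.

End Frame.

End CartanMatrices.

Section DiagonalFrame.
Variables (F : numClosedFieldType) (g : lieAlgType F) (h : {vspace g}) (n' : nat).
Local Notation n := n'.+1.
Hypothesis hC : cartan_subalgebra h.
Variable f : {linear g -> 'M[F]_n}.
Hypotheses (fL : lie_embedding f) (fJ : jordan_stable f)
  (fD : forall a, toral h f a -> is_diag_mx (f a)).

Let finj : injective f. Proof. by case: fL. Qed.
Let flie x y : f (lie x y) = mxad (f x) (f y). Proof. by case: fL => _ ->. Qed.

(** Indices of the same weight for the toral elements. *)
Definition ceq i j := `[< forall a, toral h f a -> f a i i = f a j j >].

Lemma ceqP i j : reflect (forall a, toral h f a -> f a i i = f a j j) (ceq i j).
Proof. exact: asboolP. Qed.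

Lemma toral_entry a i j : toral h f a -> f a i j = f a i i *+ (i == j).
Proof.
move=> /fD /is_diag_mxP d; case: (eqVneq i j) => [->//|ij].
by rewrite d.
Qed.

Lemma toral_lie a x i j : toral h f a ->
  f (lie a x) i j = (f a i i - f a j j) * f x i j.
Proof.
move=> ta; rewrite flie /mxad [LHS]mxE [X in _ + X = _]mxE !mxE (bigD1 i) //= big1; last first.
  by move=> k ki; rewrite toral_entry // eq_sym (negPf ki) mul0r.
rewrite addr0 (bigD1 j) //= big1; last first.
  by move=> k kj; rewrite [f a k j]toral_entry // (negPf kj) mulr0.
by rewrite addr0; ring.
Qed.

Lemma cartan_entry x i j : x \in h -> ~~ ceq i j -> f x i j = 0.
Proof.
move=> xh /asboolPn/existsNP[a /not_implyP[ta /eqP/negPf aij]].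
have := toral_central hC fL ta xh; move/(congr1 f)/matrixP/(_ i j).
rewrite linear0 toral_lie // mxE => /eqP.
by rewrite mulf_eq0 subr_eq0 aij /= => /eqP.
Qed.

Lemma cartanP x : (forall i j, ~~ ceq i j -> f x i j = 0) -> x \in h.
Proof.
move=> hx; apply: (toral_centralizer hC fL fJ) => a ta; apply: finj.
apply/matrixP=> i j; rewrite toral_lie // linear0 mxE.
case: (boolP (ceq i j)) => [/ceqP/(_ a ta) ->|/hx->]; last by rewrite mulr0.
by rewrite subrr mul0r.
Qed.

(** An element [x] of [h] preserves the weight spaces and acts on each as a scalar
    plus a nilpotent matrix. When the scalar is zero, [f x] and its square have
    trace zero there. *)
Lemma class_trace x i0 : x \in h -> exists a, [/\ toral h f a,
  \sum_(k | ceq i0 k) f x k k = f a i0 i0 *+ #|[pred k | ceq i0 k]| &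
  f a i0 i0 = 0 -> \sum_(k | ceq i0 k) (f x * f x) k k = 0].
Proof.
move=> xh; have [a [ta [m am]]] := toral_part hC fL fJ xh.
pose D : 'M[F]_n := diag_mx (\row_k (ceq i0 k)%:R).
have trD (B : 'M[F]_n) : \sum_(k | ceq i0 k) B k k = \tr (B * D).
  rewrite [B * D]mul_mx_diag /mxtrace big_mkcond; apply: eq_bigr => k _.
  by rewrite !mxE; case: ifP => _; rewrite ?mulr1 ?mulr0.
have Dc (B : 'M[F]_n) : (forall i j, ~~ ceq i j -> B i j = 0) -> B * D = D * B.
  move=> hB; rewrite [B * D]mul_mx_diag [D * B]mul_diag_mx.
  apply/matrixP=> i j; rewrite !mxE mulrC.
  case: (boolP (ceq i j)) => [/ceqP c|/hB->]; last by rewrite !mulr0.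
  congr (_%:R * _); congr nat_of_bool; apply/ceqP/ceqP=> c' b tb; rewrite (c' b tb) ?c //.
have xD := Dc _ (fun i j => @cartan_entry x i j xh).
have aD := Dc _ (fun i j => @cartan_entry a i j ta.1).
pose N := f x - f a; have ND : N * D = D * N by rewrite /N mulrBl mulrBr xD aD.
have NDm k : (N * D) ^+ k = N ^+ k * D ^+ k by rewrite exprMn_comm.
have Nx : \tr (N * D) = 0 by apply: (@nilpotent_trace _ _ _ m); rewrite NDm am mul0r.
have aDE : f a * D = f a i0 i0 *: D.
  apply/matrixP=> i j; rewrite [f a * D]mul_mx_diag !mxE [f a i j]toral_entry //.
  case: (eqVneq i j) => [<-|_] /=; last by rewrite !mulr0n mul0r mulr0.
  case: (boolP (ceq i0 i)) => [/ceqP c|_]; last by rewrite !mulr0n mul0rn !mulr0.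
  by rewrite (c a ta).
exists a; split=> //.
  rewrite trD -[f x](subrK (f a)) mulrDl linearD /= Nx add0r aDE linearZ /=.
  rewrite /mxtrace -mulr_natr; congr (_ * _); rewrite -sum1_card natr_sum.
  rewrite [RHS]big_mkcond; apply: eq_bigr => k _.
  by rewrite !mxE eqxx inE; case: ifP.
move=> a0; rewrite trD.
have aD0 : f a * D = 0 by rewrite aDE a0 scale0r.
have xN : f x * D = N * D by rewrite /N mulrBl aD0 subr0.
have -> : f x * f x * D = N * (N * D).
  by rewrite -mulrA xN ND mulrA xN -mulrA -ND.
apply: (@nilpotent_trace _ _ _ m); rewrite exprMn_comm ?am ?mul0r //.
by rewrite /GRing.comm ND mulrA ND.
Qed.

(** A matrix exchanging two basis vectors of a weight space has trace zero while its
    square has trace two, against [class_trace]. *)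
Lemma no_swap i j x : i != j -> ceq i j -> x \in h ->
  (forall k l, ceq i k ->
     f x k l = ((k == i) && (l == j) || (k == j) && (l == i))%:R) -> False.
Proof.
move=> ij cij xh hx; have [a [ta tr1 tr2]] := class_trace i xh.
have cii : ceq i i by apply/ceqP.
have a0 : f a i i = 0.
  have /eqP : f a i i *+ #|[pred k | ceq i k]| = 0.
    rewrite -tr1 big1 // => k ck; rewrite hx //.
    case: (eqVneq k i) => [->|_] /=; first by rewrite (negPf ij).
    by rewrite andbF.
  rewrite mulrn_eq0 => /orP[|/eqP//]; rewrite -leqn0 leqNgt.
  by case/negP; apply/card_gt0P; exists i; rewrite inE.
have /eqP := tr2 a0; rewrite (bigD1 i) //= (bigD1 j) /=; last by rewrite cij eq_sym.
rewrite big1; last first.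
  move=> k /andP[/andP[ck ki] kj]; rewrite mxE big1 // => l _.
  by rewrite hx // (negPf ki) (negPf kj) mul0r.
have ji : j != i by rewrite eq_sym.
rewrite !mxE (bigD1 j) //= big1; last first.
  by move=> l lj; rewrite hx // (negPf lj) andbF (negPf ij) mul0r.
rewrite [X in _ + (X + _)](bigD1 i) //= big1; last first.
  by move=> l li; rewrite hx // (negPf li) andbF (negPf ji) mul0r.
by rewrite !hx // !eqxx /= orbT !mulr1 !addr0 -(natrD _ 1 1) pnatr_eq0.
Qed.

End DiagonalFrame.

(** * Cartan subalgebras of classical algebras are diagonal *)

(** For [J = 1%:M] this is [so], for the symplectic matrix it is [sp]; a change of
    basis only changes [J]. *)
Definition skewJ (F : numClosedFieldType) n (J : 'M[F]_n) : set 'M[F]_n :=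
  [set A | A *m J + J *m A^T = 0].

Section DiagonalizableMore.
Variables (F : numClosedFieldType) (n' : nat).
Local Notation n := n'.+1.
Implicit Types (A S T P : 'M[F]_n).

Lemma diagonalizable_intro S P d : P \in unitmx ->
  S = invmx P *m diag_mx d *m P -> diagonalizable S.
Proof.
move=> Pu ->; exists P => //; rewrite /similar_to conjumx //.
by rewrite !mulmxA mulmxV // mul1mx mulmxK // diag_mx_is_diag.
Qed.

Lemma diagonalizable_sub S T : S * T = T * S ->
  diagonalizable S -> diagonalizable T -> diagonalizable (S - T).
Proof.
move=> ST dS dT.
have [] := (codiagonalizableP [:: S; T]).1.
  split=> [A B|A]; rewrite !inE; last by case/orP=> /eqP->.
  by do 2!case/orP=> /eqP->.
move=> P Pu /= /and3P[pS pT _]; exists P => //; move: pS pT.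
rewrite /similar_to !conjumx // => /is_diag_mxP pS /is_diag_mxP pT.
apply/is_diag_mxP => i j ij.
by rewrite mulmxBr mulmxBl [LHS]mxE [X in _ + X = _]mxE pS // pT // subr0.
Qed.

Lemma diagonalizable_conjmx S P : P \in unitmx ->
  diagonalizable (P *m S *m invmx P) -> diagonalizable S.
Proof.
move=> Pu [Q Qu]; rewrite /similar_to conjumx // => Qd.
have QP : Q *m P \in unitmx by rewrite unitmx_mul Qu.
exists (Q *m P) => //; rewrite /similar_to conjumx //.
have -> : invmx (Q *m P) = invmx P *m invmx Q by apply: (invrM (R := 'M[F]_n)).
by rewrite !mulmxA in Qd *.
Qed.

(** The map [k X = J X^T J^-1] is an anti-automorphism with [k A = - A]. So, with
    [S] the semisimple part of [A], [- k S] is a semisimple part of [A] as well. It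
    equals [S], because their difference is both diagonalizable and nilpotent. *)
Lemma skew_jordan (J A : 'M[F]_n) (p : {poly F}) m : J \in unitmx ->
  skewJ J A -> diagonalizable (horner_mx A p) -> (A - horner_mx A p) ^+ m = 0 ->
  skewJ J (horner_mx A p).
Proof.
move=> Ju AJ dS nS; set S := horner_mx A p in dS nS *.
pose k X := J *m X^T *m invmx J.
have kM X Y : k (X * Y) = k Y * k X.
  by rewrite /k [X * Y]/(X *m Y) trmx_mul -[k Y * _]/(_ *m _) !mulmxA mulmxKV.
have kB X Y : k (X - Y) = k X - k Y.
  by rewrite /k linearB /= mulmxBr mulmxBl.
have kA : k A = - A.
  rewrite /k; move/eqP: AJ; rewrite addrC addr_eq0 => /eqP->.
  by rewrite mulNmx mulmxK.
have cAS : A * S = S * A by apply: comm_mx_horner.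
have cAk : A * k S = k S * A.
  by have := congr1 k cAS; rewrite !kM kA mulrN mulNr => /oppr_inj.
have cSk : S * - k S = - k S * S.
  rewrite mulrN mulNr; congr (- _).
  by apply: comm_horner_mx.
have dk : diagonalizable (- k S).
  have [P [d [Pu SE]]] := diagonalizable_conj dS.
  have PTu : P^T \in unitmx by rewrite unitmx_tr.
  have JP : J *m P^T \in unitmx by rewrite unitmx_mul Ju unitmx_tr.
  apply: (@diagonalizable_intro _ (invmx (J *m P^T)) (- d)).
    by rewrite unitmx_inv.
  have QE : invmx (J *m P^T) = invmx P^T *m invmx J.
    by apply: (invrM (R := 'M[F]_n)).
  rewrite invmxK QE /k SE !trmx_mul tr_diag_mx trmx_inv linearN /= mulmxN mulNmx.
  by rewrite !mulmxA.
have nk : (A - - k S) ^+ m = 0.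
  have -> : A - - k S = - k (A - S) by rewrite kB kA opprB !opprK addrC.
  have kX j X : k X ^+ j = k (X ^+ j).
    elim: j => [|j IH]; last by rewrite exprS IH exprSr kM.
    by rewrite !expr0 /k trmx1 mulmx1 mulmxV.
  by rewrite exprNn kX nS /k linear0 mulmx0 mul0mx mulr0.
have : S - - k S = 0.
  apply: (@diagonalizable_nilpotent0 _ _ _ (m + m)).
    exact: diagonalizable_sub.
  pose u (X : 'M[F]_n) := (A - - k S) * X; pose v (X : 'M[F]_n) := (A - S) * X.
  have iu j X : iter j u X = (A - - k S) ^+ j * X.
    by elim: j => [|j /= ->]; [rewrite mul1r|rewrite /u /v mulrA -exprS].
  have iv j X : iter j v X = (A - S) ^+ j * X.
    by elim: j => [|j /= ->]; [rewrite mul1r|rewrite /u /v mulrA -exprS].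
  have : iter (m + m) (fun X => u X - v X) 1 = 0.
    apply: iter_sub_nilpotent.
    - by move=> X Y; rewrite /u mulrBr.
    - by move=> X Y; rewrite /v mulrBr.
    - move=> X; rewrite /u /v !mulrA; congr (_ * _).
      rewrite !mulrBl !mulrBr cAS cSk mulrN mulNr cAk.
      by rewrite subrACA.
    - by rewrite iu nk mul0r.
    - by rewrite iv nS mul0r.
  have -> : (fun X => u X - v X) = fun X => (S - - k S) * X.
    apply/funext => X; rewrite /u /v -mulrBl; congr (_ * _).
    by rewrite opprB addrC addrA subrK.
  move=> <-; elim: (m + m)%N => //= j <-.
  by rewrite exprS.
rewrite opprK => /eqP; rewrite addr_eq0 => /eqP Sk.
rewrite /skewJ /= Sk mulNmx {1}/k mulmxKV // -Sk addrC.
by rewrite subrr.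
Qed.

End DiagonalizableMore.

Section Frames.
Variables (F : numClosedFieldType) (g : lieAlgType F) (h : {vspace g}) (n' : nat).
Local Notation n := n'.+1.
Hypothesis hC : cartan_subalgebra h.

Lemma conj_frame (f : {linear g -> 'M[F]_n}) : lie_embedding f -> jordan_stable f ->
  exists (P : 'M[F]_n) (f' : {linear g -> 'M[F]_n}),
    [/\ P \in unitmx, forall x, f' x = P *m f x *m invmx P, lie_embedding f' &
        forall a, toral h f' a -> is_diag_mx (f' a)].
Proof.
move=> fL fJ; have [P [Pu Pd]] := toral_frame hC fL.
pose f' : {linear g -> 'M[F]_n} := (mulmxr (invmx P) \o (mulmx P \o f)).
exists P, f'; have f'E x : f' x = P *m f x *m invmx P by [].
split=> //; last first.
  by move=> a [ah da]; rewrite f'E; apply: Pd; split=> //; apply: diagonalizable_conjmx da.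
case: fL => finj flie; split=> [x y|x y].
  rewrite !f'E => /(congr1 (fun W => invmx P *m W *m P)).
  by rewrite !mulmxA !mulVmx // !mul1mx !mulmxKV // => /finj.
by rewrite !f'E flie mulmxBr mulmxBl !mulmxA !mulmxKV.
Qed.

(** In an eigenbasis of the toral elements [h] is the block diagonal, and a block of
    size two or more would contain the exchange of two basis vectors, which is
    traceless but excluded by [no_swap]. *)
Lemma sl_frame (f : {linear g -> 'M[F]_n}) : lie_embedding f -> range f = sl F n ->
  exists f' : {linear g -> 'M[F]_n}, [/\ lie_embedding f', range f' = sl F n &
    forall x, x \in h <-> is_diag_mx (f' x)].
Proof.
have slJ (f0 : {linear g -> 'M[F]_n}) : range f0 = sl F n -> jordan_stable f0.
  move=> fr y p _ [m nm]; have : sl F n (horner_mx (f0 y) p).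
    have : sl F n (f0 y) by rewrite -fr; exists y.
    rewrite /sl /= => ty; have := nilpotent_trace nm.
    by rewrite linearB /= ty sub0r => /eqP; rewrite oppr_eq0 => /eqP.
  by rewrite -fr => -[s _ sE]; exists s.
move=> fL fr; have [P [f' [Pu f'E f'L f'D]]] := conj_frame fL (slJ _ fr).
have trP A : \tr (P *m A *m invmx P) = \tr A.
  by rewrite mxtrace_mulC mulmxA mulVmx // mul1mx.
have fr' : range f' = sl F n.
  apply/seteqP; split=> [_ [x _ <-]|A tA].
    by rewrite /sl /= f'E trP; have : sl F n (f x) by rewrite -fr; exists x.
  have : sl F n (invmx P *m A *m P).
    by rewrite /sl /= mxtrace_mulC mulmxA mulmxV // mul1mx.
  rewrite -fr => -[x _ xE]; exists x => //.
  by rewrite f'E xE !mulmxA mulmxV // mul1mx mulmxK.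
exists f'; split=> // x.
have distinct i j : ceq h f' i j -> i = j.
  move=> cij; apply/eqP/negPn/negP => ij.
  have : sl F n (delta_mx i j + delta_mx j i).
    rewrite /sl /= linearD /= /mxtrace !big1 ?addr0 // => k _; rewrite mxE.
      by case: (eqVneq k j) => [->|_]; rewrite ?andbF // eq_sym (negPf ij).
    by case: (eqVneq k i) => [->|_]; rewrite ?andbF // (negPf ij).
  rewrite -fr' => -[y _ yE].
  apply: (no_swap hC f'L (slJ _ fr') f'D (x := y) ij cij) => [|k l ck].
    apply: (cartanP hC f'L (slJ _ fr') f'D) => k l; rewrite yE !mxE.
    case: (boolP (_ && _)) => [/andP[/eqP-> /eqP->]|_]; first by rewrite cij.
    case: (boolP (_ && _)) => [/andP[/eqP-> /eqP->]|_]; last by rewrite addr0.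
    case/negP; apply/ceqP => a ta; symmetry; move: a ta; exact/ceqP.
  rewrite yE !mxE; case: (eqVneq k i) => [->|ki] /=; last first.
    by rewrite add0r.
  by rewrite (negPf ij) /= addr0 orbF.
split=> [xh|/is_diag_mxP d].
  apply/is_diag_mxP => i j ij; apply: (cartan_entry hC f'L f'D xh).
  by apply: contraNN ij => /distinct->.
apply: (cartanP hC f'L (slJ _ fr') f'D) => i j cij; apply: d.
apply: contraNN cij => /eqP/val_inj->; exact/ceqP.
Qed.

(** For a form [J] the exchange of two basis vectors is not in the algebra, and its
    projection to the algebra is used instead. This is the exchange itself on a
    weight space of nonzero weight; the space of weight zero, which [J] pairs with
    itself, needs the separate argument of [zero_unique]. *)
Section SkewFrame.
Variables (e : F) (J : 'M[F]_n) (f : {linear g -> 'M[F]_n}).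
Hypotheses (eP : e = 1 \/ e = -1) (Ju : J \in unitmx) (Je : J^T = e *: J).
Hypotheses (fL : lie_embedding f) (fr : range f = skewJ J)
  (fD : forall a, toral h f a -> is_diag_mx (f a)).

Lemma skew_jordan_stable : jordan_stable f.
Proof.
move=> y p dp [m nm]; have : skewJ J (f y) by rewrite -fr; exists y.
move=> yJ; have := skew_jordan (J := J) Ju yJ dp nm.
by rewrite -fr => -[s _ sE]; exists s.
Qed.
Let fJ := skew_jordan_stable.
Local Notation K := (invmx J).
Local Notation ceq := (ceq h f).
Let cqP := @ceqP F g h n' f.

Let ee : e * e = 1.
Proof. by case: eP => ->; rewrite ?mulr1 // mulrNN mulr1. Qed.

Let Jsym i j : J j i = e * J i j.
Proof. by have /matrixP/(_ i j) := Je; rewrite !mxE. Qed.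

Let Ke : K^T = e *: K.
Proof.
have e0 : e != 0 by apply/eqP => e0; move/eqP: ee; rewrite e0 mul0r eq_sym oner_eq0.
rewrite trmx_inv Je invmxZ ?unitmxZ ?unitfE //.
by congr (_ *: _); apply: (mulfI e0); rewrite mulfV.
Qed.

Let Ksym i j : K j i = e * K i j.
Proof. by have /matrixP/(_ i j) := Ke; rewrite !mxE. Qed.

Lemma toral_J a i j : toral h f a -> J i j != 0 -> f a j j = - f a i i.
Proof.
move=> ta nz; have : skewJ J (f a) by rewrite -fr; exists a.
move=> /matrixP/(_ i j); rewrite !mxE (bigD1 i) //= big1; last first.
  by move=> k ki; rewrite (toral_entry fD _ _ ta) eq_sym (negPf ki) mul0r.
rewrite (bigD1 j) //= big1 => [|k kj]; last first.
  by rewrite mxE (toral_entry fD _ _ ta) eq_sym (negPf kj) mulr0.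
rewrite !addr0 mxE mulrC -mulrDr => /eqP; rewrite mulf_eq0 (negPf nz) /=.
by rewrite addrC addr_eq0 => /eqP.
Qed.

Lemma toral_K a i j : toral h f a -> K i j != 0 -> f a j j = - f a i i.
Proof.
move=> ta nz; have : skewJ J (f a) by rewrite -fr; exists a.
move=> /(congr1 (fun W => K *m W *m K)); rewrite mulmx0 mul0mx mulmxDr mulmxDl.
rewrite !mulmxA mulVmx // mul1mx -!mulmxA mulmxV // mulmx1.
move=> /matrixP/(_ i j); rewrite !mxE (bigD1 j) //= big1; last first.
  by move=> k kj; rewrite (toral_entry fD _ _ ta) (negPf kj) mulr0.
rewrite (bigD1 i) //= big1 => [|k ki]; last first.
  by rewrite mxE (toral_entry fD _ _ ta) (negPf ki) mul0r.
rewrite !addr0 mxE [X in _ + X]mulrC -mulrDr => /eqP; rewrite mulf_eq0 (negPf nz) /=.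
by rewrite addr_eq0 => /eqP.
Qed.

(** Twice the projection onto [skewJ J]. *)
Definition skew_proj (M : 'M[F]_n) := M - J *m M^T *m K.

Lemma skew_projP M : skewJ J (skew_proj M).
Proof.
have JKt : (J *m M^T *m K)^T = K *m M *m J.
  rewrite !trmx_mul trmxK Ke Je -!scalemxAl -!scalemxAr scalerA ee scale1r.
  by rewrite mulmxA.
rewrite /skewJ /= /skew_proj linearB /= JKt mulmxBl mulmxBr mulmxKV // !mulmxA.
by rewrite mulmxV // mul1mx addrA subrK subrr.
Qed.

Lemma conj_entry (M : 'M[F]_n) i j : (J *m M^T *m K) i j != 0 ->
  exists k l, [/\ J i k != 0, M l k != 0 & K l j != 0].
Proof.
move=> nz; apply: contrapT => no; case/eqP: nz; rewrite mxE big1 // => l _.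
rewrite mxE big_distrl big1 //= => k _; rewrite mxE; apply/eqP/negPn/negP => nz.
apply: no; exists k, l; move: nz; rewrite !mulf_eq0 !negb_or.
by case/andP=> /andP[-> ->] ->.
Qed.

Lemma skew_projE M i j : skew_proj M i j = M i j - (J *m M^T *m K) i j.
Proof. by rewrite /skew_proj [LHS]mxE [X in _ + X = _]mxE. Qed.

Lemma skew_proj_cartan (M : 'M[F]_n) : (forall i j, ~~ ceq i j -> M i j = 0) ->
  exists2 x, x \in h & f x = skew_proj M.
Proof.
move=> hM; have := skew_projP M; rewrite -fr => -[x _ xE]; exists x => //.
apply: (cartanP hC fL fJ fD) => i j cij; rewrite xE skew_projE hM // sub0r.
apply/eqP; rewrite oppr_eq0; apply/negPn/negP => nz.
have [k [l [Jik Mlk Klj]]] := conj_entry nz; case/negP: cij; apply/cqP => a ta.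
have /cqP ckl : ceq l k by apply: contraNT Mlk => /hM->.
by rewrite (toral_K ta Klj) (ckl a ta) (toral_J ta Jik) opprK.
Qed.

Definition zero_weight i := forall a, toral h f a -> f a i i = 0.

Lemma double_eq0 (x : F) : x = - x -> x = 0.
Proof.
move=> /eqP; rewrite -addr_eq0 -mulr2n mulrn_eq0 /= => /eqP->//.
Qed.

Lemma distinct_nonzero i j : ~ zero_weight i -> ceq i j -> i = j.
Proof.
move=> nzi cij; apply/eqP/negPn/negP => ij; apply: nzi.
have cji : ceq j i by apply/cqP => a ta; symmetry; move: a ta; apply/cqP.
pose M : 'M[F]_n := delta_mx i j + delta_mx j i.
have [|x xh xE] := @skew_proj_cartan M.
  move=> k l; rewrite !mxE.
  case: (boolP (_ && _)) => [/andP[/eqP-> /eqP->]|_]; first by rewrite cij.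
  case: (boolP (_ && _)) => [/andP[/eqP-> /eqP->]|_]; last by rewrite addr0.
  by rewrite cji.
apply: contrapT => {}nzi.
apply: (no_swap hC fL fJ fD (x := x) ij cij) => // k l ck.
rewrite xE; have -> : skew_proj M k l = M k l.
  rewrite skew_projE.
  case: (eqVneq ((J *m M^T *m K) k l) 0) => [->|]; first by rewrite subr0.
  case/conj_entry=> k' [l' [Jk Ml _]]; case: nzi => a ta.
  apply: double_eq0; have /cqP/(_ a ta) e1 := ck.
  have e2 : f a i i = f a k' k'.
    move: Ml; rewrite !mxE; case: (eqVneq k' j) => [->|].
      by move=> _; move/cqP: cij; apply.
    case: (eqVneq k' i) => [->//|]; rewrite !andbF addr0 eqxx //.
  by rewrite {1}e2 (toral_J ta Jk) -e1.
rewrite !mxE; case: (eqVneq k i) => [->|ki] /=; last by rewrite add0r.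
by rewrite (negPf ij) /= addr0 orbF.
Qed.

Lemma zero_ceq i j : zero_weight i -> zero_weight j -> ceq i j.
Proof. by move=> zi zj; apply/cqP => a ta; rewrite zi // zj. Qed.

(** An element of [h] supported on the space of weight zero is nilpotent by
    [toral_part], hence so is its square. *)
Lemma zero_trace j (M : 'M[F]_n) : zero_weight j ->
  (forall k l, M k l != 0 -> zero_weight k /\ zero_weight l) ->
  \tr (skew_proj M *m skew_proj M) = 0.
Proof.
move=> zj hM; have [|x xh xE] := @skew_proj_cartan M.
  move=> k l; apply: contraNeq => /hM[zk zl]; exact: zero_ceq.
have [a [ta _ h0]] := class_trace hC fL fJ fD j xh.
rewrite -(h0 (zj a ta)) /mxtrace [RHS]big_mkcond -xE; apply: eq_bigr => k _.
case: ifPn => // cjk; rewrite mxE big1 // => l _.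
suff -> : f x k l = 0 by rewrite mul0r.
apply/eqP/negPn/negP => nz; case/negP: cjk; apply: zero_ceq => //.
move: nz; rewrite xE skew_projE; case: (eqVneq (M k l) 0) => [->|/hM[]//].
rewrite sub0r oppr_eq0 => /conj_entry[k' [l' [Jk Ml _]]] b tb.
have [_ zk'] := hM _ _ Ml.
by have := toral_J tb Jk; rewrite zk' // => /esym/eqP; rewrite oppr_eq0 => /eqP.
Qed.

Lemma skew_proj_trace M1 M2 : \tr (skew_proj M1 *m skew_proj M2) =
  (\tr (M1 *m M2) - \tr (M1 *m J *m M2^T *m K)) *+ 2.
Proof.
have t3 : \tr (J *m M1^T *m K *m M2) = \tr (M1 *m J *m M2^T *m K).
  rewrite -mxtrace_tr !trmx_mul trmxK Ke Je -!scalemxAl -!scalemxAr scalerA ee scale1r.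
  rewrite [in LHS]mulmxA mxtrace_mulC.
  by rewrite !mulmxA.
have t4 : \tr (J *m M1^T *m K *m (J *m M2^T *m K)) = \tr (M1 *m M2).
  rewrite !mulmxA mulmxKV // mxtrace_mulC !mulmxA mulVmx // mul1mx.
  by rewrite -mxtrace_tr trmx_mul !trmxK mxtrace_mulC.
rewrite /skew_proj mulmxBl !mulmxBr !linearB /= t3 t4 !mulmxA.
by ring.
Qed.

(** Polarization of [zero_trace] at the matrix units [delta_mx k j] and
    [delta_mx j k]. *)
Lemma zero_form k j : zero_weight k -> zero_weight j -> J j k * K j k = 1.
Proof.
move=> zk zj.
pose M1 : 'M[F]_n := delta_mx k j; pose M2 : 'M[F]_n := delta_mx j k.
have s1 a b : M1 a b != 0 -> zero_weight a /\ zero_weight b.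
  by rewrite mxE pnatr_eq0 eqb0 negbK => /andP[/eqP-> /eqP->].
have s2 a b : M2 a b != 0 -> zero_weight a /\ zero_weight b.
  by rewrite mxE pnatr_eq0 eqb0 negbK => /andP[/eqP-> /eqP->].
have s12 a b : (M1 + M2) a b != 0 -> zero_weight a /\ zero_weight b.
  case: (eqVneq (M1 a b) 0) => [e1|/s1//].
  by rewrite mxE e1 add0r => /s2.
have pD : skew_proj (M1 + M2) = skew_proj M1 + skew_proj M2.
  by rewrite /skew_proj linearD /= mulmxDr mulmxDl opprD addrACA.
have := zero_trace zj s12; rewrite pD mulmxDl !(mulmxDr _ (skew_proj M1) (skew_proj M2)) !mxtraceD.
rewrite (zero_trace zj s1) (zero_trace zj s2) add0r addr0.
rewrite [X in _ + X]mxtrace_mulC -mulr2n skew_proj_trace => /eqP.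
rewrite !mulrn_eq0 /= subr_eq0 => /eqP.
have -> : \tr (M1 *m M2) = 1.
  rewrite mul_delta_mx /mxtrace (bigD1 k) //= big1 => [|a ak].
    by rewrite mxE !eqxx addr0.
  by rewrite mxE (negPf ak).
have -> : \tr (M1 *m J *m M2^T *m K) = J j k * K j k.
  rewrite trmx_delta /mxtrace (bigD1 k) //= big1 => [|a ak]; last first.
    rewrite mxE big1 // => b _; rewrite mxE big1 ?mul0r // => c _.
    by rewrite mxE big1 ?mul0r // => d _; rewrite mxE (negPf ak) mul0r.
  rewrite addr0 mxE (bigD1 j) //= big1 => [|b bj]; last first.
    rewrite mxE big1 ?mul0r // => c _.
    by rewrite [delta_mx _ _ _ _]mxE (negPf bj) andbF mulr0.
  rewrite addr0 mxE (bigD1 k) //= big1 => [|b bk]; last first.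
    by rewrite [delta_mx _ _ _ _]mxE (negPf bk) mulr0.
  rewrite addr0 mxE (bigD1 j) //= big1 => [|b bj]; last first.
    by rewrite mxE (negPf bj) andbF mul0r.
  by rewrite !mxE !eqxx !mul1r mulr1 addr0.
by move=> <-.
Qed.

(** If [d] is the dimension of the space of weight zero, the diagonal entry of
    [J *m K = 1] at an index of weight zero is a sum of [d] terms, all equal to [e]
    by [zero_form]. So [e *+ d = 1], and [d = 1] in characteristic zero. *)
Lemma zero_unique i j : zero_weight i -> zero_weight j -> i = j.
Proof.
move=> zi zj.
have nat0 m : m.+1%:R != 0 :> F by rewrite pnatr_eq0.
pose d := #|[pred k | ceq j k]|.
have ed : e *+ d = 1.
  have : (J *m K) j j = 1 by rewrite mulmxV // mxE eqxx.
  move=> <-; rewrite mxE -sumr_const [LHS]big_mkcond; apply: eq_bigr => k _.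
  rewrite inE; case: ifPn => cjk.
    have zk : zero_weight k by move=> a ta; rewrite -(cqP j k cjk a ta) zj.
    by rewrite (Ksym j k) mulrCA zero_form // mulr1.
  case: (eqVneq (J j k) 0) => [->|nz]; first by rewrite mul0r.
  case/negP: cjk; apply/cqP => a ta; rewrite (toral_J ta nz) zj // oppr0 //.
have cij : ceq j i by apply: zero_ceq.
case: eP ed => ->; last first.
  move/eqP; rewrite mulNrn eqr_oppLR -subr_eq0 opprK -(natrD _ d 1) addn1.
  by rewrite (negPf (nat0 d)).
move/eqP; rewrite pnatr_eq1 => /eqP d1.
have [x hx] := mem_card1 d1; have := hx i; have := hx j.
have cjj : ceq j j by apply/cqP.
by rewrite !inE cij cjj => /esym/eqP-> /esym/eqP->.
Qed.

Lemma skew_distinct i j : ceq i j -> i = j.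
Proof.
move=> cij; case: (pselect (zero_weight i)) => zi; last exact: distinct_nonzero.
have zj : zero_weight j by move=> a ta; rewrite -(cqP i j cij a ta) zi.
exact: zero_unique.
Qed.

Lemma skew_diag x : x \in h <-> is_diag_mx (f x).
Proof.
split=> [xh|/is_diag_mxP d].
  apply/is_diag_mxP => i j ij; apply: (cartan_entry hC fL fD xh).
  by apply: contraNN ij => /skew_distinct->.
apply: (cartanP hC fL fJ fD) => i j cij; apply: d.
apply: contraNN cij => /eqP/val_inj->; exact/cqP.
Qed.

(** The form pairs each weight with its opposite only, and the weight spaces are
    lines. *)
Lemma skew_monomial : exists neg : 'I_n -> 'I_n, [/\ involutive neg,
  forall i j, (J i j != 0) = (j == neg i) &
  forall i j, neg i = i -> neg j = j -> i = j].
Proof.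
have ex i : exists j, J i j != 0.
  apply: contrapT => no; have : (J *m K) i i = 0.
    rewrite mxE big1 // => k _; case: (eqVneq (J i k) 0) => [->|nz].
      by rewrite mul0r.
    by case: no; exists k.
  by rewrite mulmxV // mxE eqxx => /eqP; rewrite oner_eq0.
pose neg i := xchoose (ex i); have negI i : J i (neg i) != 0 := xchooseP (ex i).
have nz i j : J i j != 0 -> j = neg i.
  move=> nz; apply: skew_distinct; apply/cqP => a ta.
  by rewrite (toral_J ta nz) (toral_J ta (negI i)).
have Jc i j : J i j != 0 -> J j i != 0.
  by rewrite (Jsym i j) mulf_eq0 negb_or => ->; rewrite andbT; case: eP => ->;
     rewrite ?oppr_eq0 oner_eq0.
have zn i : neg i = i -> zero_weight i.
  move=> ni a ta; apply: double_eq0; by have := toral_J ta (negI i); rewrite ni.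
exists neg; split=> [i|i j|i j ni nj].
- by apply/esym/nz/Jc.
- by apply/idP/eqP => [/nz//|->].
- exact: zero_unique (zn i ni) (zn j nj).
Qed.

End SkewFrame.

Theorem skew_frame (f : {linear g -> 'M[F]_n}) e (J : 'M[F]_n) :
  lie_embedding f -> range f = skewJ J -> (e = 1 \/ e = -1) ->
  J \in unitmx -> J^T = e *: J ->
  exists (f' : {linear g -> 'M[F]_n}) (J' : 'M[F]_n) (neg : 'I_n -> 'I_n),
  [/\ lie_embedding f' /\ range f' = skewJ J',
      forall x, x \in h <-> is_diag_mx (f' x),
      J' \in unitmx /\ J'^T = e *: J',
      involutive neg /\ (forall i j, (J' i j != 0) = (j == neg i)) &
      forall i j, neg i = i -> neg j = j -> i = j].
Proof.
move=> fL fr eP Ju Je.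
have [P [f' [Pu f'E f'L f'D]]] := conj_frame fL (skew_jordan_stable Ju fr).
pose J' := P *m J *m P^T.
have Ju' : J' \in unitmx by rewrite !unitmx_mul Pu Ju unitmx_tr.
have Je' : J'^T = e *: J'.
  by rewrite /J' !trmx_mul trmxK Je -scalemxAl -scalemxAr mulmxA.
have PTi : P^T *m invmx P^T = 1%:M by rewrite mulmxV // unitmx_tr.
have iPT : invmx P^T *m P^T = 1%:M by rewrite mulVmx // unitmx_tr.
have skP A : skewJ J' (P *m A *m invmx P) <-> skewJ J A.
  have e1 : P *m A *m invmx P *m J' + J' *m (P *m A *m invmx P)^T =
            P *m (A *m J + J *m A^T) *m P^T.
    rewrite /J' !trmx_mul trmx_inv mulmxDr mulmxDl !mulmxA mulmxKV //.
    by congr (_ + _); rewrite -(mulmxA (P *m J)) PTi mulmx1.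
  rewrite /skewJ /= e1; split=> [|->]; last by rewrite mulmx0 mul0mx.
  move/(congr1 (fun W => invmx P *m W *m invmx P^T)).
  by rewrite mulmx0 mul0mx -!mulmxA PTi mulmx1 !mulmxA mulVmx // mul1mx.
have fr' : range f' = skewJ J'.
  apply/seteqP; split=> [_ [x _ <-]|A].
    by rewrite f'E; apply/skP; rewrite -fr; exists x.
  have -> : A = P *m (invmx P *m A *m P) *m invmx P.
    by rewrite !mulmxA mulmxV // mul1mx mulmxK.
  by move/skP; rewrite -fr => -[x _ <-]; exists x.
have [neg [n1 n2 n3]] := skew_monomial eP Ju' Je' f'L fr' f'D.
exists f', J', neg; split=> //.
exact: (skew_diag eP Ju' Je' f'L fr' f'D).
Qed.

End Frames.

(** * Coordinates on the roots *)

Section Interface.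
Variables (F : numClosedFieldType) (g : lieAlgType F) (h : {vspace g}).
Local Notation wt := 'Hom(subvs_of h, F^o).
Variables (X : finType) (neg : X -> X) (lk : rel X) (lng : bool).
Variables (e : X -> wt) (E : X -> X -> g).
Local Notation adm := (adm neg lk lng).

(** Antisymmetric functions of the indices are values of weights at an element of
    [h]. All the linear forms used below are obtained in this way. *)
Definition weights_separated := forall c : X -> int, (forall x, c (neg x) = - c x) ->
  exists H : subvs_of h, forall x y, lk x y -> (e x - e y) H = (c x - c y)%:~R :> F.

(** What the combinatorial part needs to know about a classical algebra: weights
    [e x], and vectors [E x y] spanning the root spaces of the [e x - e y]. *)
Record coordinates : Prop := Coordinates {
  coord_negK : involutive neg;
  coord_lkC : symmetric lk;
  coord_lkT : transitive lk;
  coord_lk_neg : forall x y, lk (neg x) (neg y) = lk x y;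
  coord_fixed : forall x y, neg x = x -> neg y = y -> x = y;
  coord_eval : weights_separated;
  coord_mirror : forall x y, lk x y -> e (neg y) - e (neg x) = e x - e y;
  coord_root : forall x y, adm x y -> root_space (e x - e y) (E x y) /\ E x y != 0;
  coord_line : forall x y v, adm x y -> root_space (e x - e y) v ->
    exists c, v = c *: E x y;
  coord_all : forall alpha v, alpha != 0 -> root_space alpha v -> v != 0 ->
    exists x y, adm x y /\ alpha = e x - e y;
  coord_bracket : forall x y z, adm x y -> adm y z -> adm x z ->
    lie (E x y) (E y z) != 0;
  coord_sl2 : forall x y, adm x y -> lie (lie (E x y) (E y x)) (E x y) != 0;
  coord_decomp : forall v, exists v0 (c : X -> X -> F), v0 \in h /\
    v = v0 + \sum_x \sum_(y | adm x y) c x y *: E x y;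
  coord_abelian : forall x y, x \in h -> y \in h -> lie x y = 0
}.

End Interface.

Section PairEquality.
Variables (F : numClosedFieldType) (g : lieAlgType F) (h : {vspace g}).
Local Notation wt := 'Hom(subvs_of h, F^o).
Variables (X : finType) (neg : X -> X) (lk : rel X) (e : X -> wt).
Hypotheses (negK : involutive neg)
  (fixed : forall x y, neg x = x -> neg y = y -> x = y)
  (sep : weights_separated neg lk e).

(** The value of [e x - e y] at the element of [h] given by the antisymmetrized
    indicator function of [s]. *)
Definition pvec x y s : int :=
  ((s == x)%:Z - (s == neg x)%:Z) - ((s == y)%:Z - (s == neg y)%:Z).

Let neqC x y : (x == neg y) = (y == neg x).
Proof. exact: neg_eqC. Qed.

Lemma pvec_eq x y i j : lk x y -> lk i j -> e x - e y = e i - e j ->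
  pvec x y =1 pvec i j.
Proof.
move=> lxy lij exy s; pose c t : int := (t == s)%:Z - (t == neg s)%:Z.
have cN t : c (neg t) = - c t.
  by rewrite /c opprB neg_eq // [neg t == s]eq_sym neqC.
have [H HE] := sep cN; have := HE x y lxy; rewrite exy (HE i j lij).
move/intr_inj; rewrite /c /pvec ![s == _]eq_sym.
by rewrite !(neqC _ s) ![s == neg _]eq_sym => ->.
Qed.

Lemma pair_eq1 x y j : x != y -> x != j -> pvec x y =1 pvec x j -> y = j.
Proof.
move=> xy xj v; have w s : (s == y)%:Z - (s == neg y)%:Z = (s == j)%:Z - (s == neg j)%:Z :> int.
  by have := v s; rewrite /pvec => /(canRL (subKr _)); rewrite subKr.
have [ey|ny] := eqVneq y (neg y).
  have := w j; rewrite -ey subrr eqxx.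
  case: (eqVneq j (neg j)) => [ej _|_ /eqP]; last by [].
  by rewrite (fixed (esym ey) (esym ej)).
have := w y; rewrite eqxx (negPf ny) subr0.
by case: (eqVneq y j) => // _; case: (y == neg j).
Qed.

(** The vector [pvec x y] is [1] or [2] at [x] and at [neg y] and not positive
    elsewhere, up to the at most one index fixed by [neg], where it vanishes. *)
Lemma root_pair_eq x y i j : x != y -> i != j -> lk x y -> lk i j ->
  e x - e y = e i - e j -> (i = x /\ j = y) \/ (i = neg y /\ j = neg x).
Proof.
move=> xy ij lxy lij /(pvec_eq lxy lij) v.
have vN a b : pvec (neg b) (neg a) =1 pvec a b.
  by move=> s; rewrite /pvec !negK; ring.
have vC a b : pvec b a =1 (fun s => - pvec a b s).
  by move=> s; rewrite /pvec /= [RHS]opprB.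
have caseX : i = x -> i = x /\ j = y.
  by move=> ei; subst i; rewrite -(pair_eq1 xy ij v); split.
have caseY : i = neg y -> i = neg y /\ j = neg x.
  move=> ei; subst i; split=> //; apply/esym/(@pair_eq1 (neg y)) => //.
    by rewrite neg_eq // eq_sym.
  by move=> s; rewrite vN v.
have caseXj : j = neg x -> i = neg y /\ j = neg x.
  move=> ej; subst j; split=> //; rewrite (@pair_eq1 x y (neg i)) ?negK //.
    by rewrite neg_eqC // eq_sym.
  by move=> s; rewrite v -[in LHS](negK i) vN.
have caseYj : j = y -> i = x /\ j = y.
  move=> ej; subst j; split=> //; apply/esym/(@pair_eq1 y).
  - by rewrite eq_sym.
  - by rewrite eq_sym.
  - by move=> s; rewrite vC [RHS]vC v.
have [ex|nx] := eqVneq x (neg x).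
  have ny : y == neg y = false.
    apply/negP => /eqP ey; case/eqP: xy; exact: fixed.
  have := v y; rewrite /pvec -ex eqxx ny [y == x]eq_sym (negPf xy).
  case: (eqVneq y j) => [/esym/caseYj|_]; first by left.
  case: (eqVneq y (neg i)) => [yi|_].
    by move=> _; right; rewrite ex; apply: caseY; rewrite yi negK.
  by case: (y == i); case: (y == neg j).
have := v x; rewrite /pvec eqxx (negPf nx) (negPf xy).
case: (eqVneq x i) => [/esym/caseX|_]; first by left.
case: (eqVneq x (neg j)) => [xj|_].
  by move=> _; right; apply: caseXj; rewrite xj negK.
by case: (x == neg i); case: (x == j); case: (x == neg y).
Qed.

End PairEquality.

Section DiagonalWeights.
Variables (F : numClosedFieldType) (g : lieAlgType F) (h : {vspace g}) (n' : nat).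
Local Notation n := n'.+1.
Local Notation wt := 'Hom(subvs_of h, F^o).
Variable f : {linear g -> 'M[F]_n}.

Definition dcoef i (y : subvs_of h) : F^o := f (vsval y) i i.

Lemma dcoef_is_linear i : linear (dcoef i).
Proof. by move=> a x y; rewrite /dcoef !linearP !mxE. Qed.

HB.instance Definition _ i :=
  GRing.isLinear.Build F (subvs_of h) F^o _ (dcoef i) (dcoef_is_linear i).

Definition dwt i : wt := linfun (dcoef i).

Lemma dwtE i H : dwt i H = f (vsval H) i i.
Proof. by rewrite lfunE. Qed.

Hypotheses (fL : lie_embedding f) (hd : forall x, x \in h <-> is_diag_mx (f x)).

Lemma cartan_off_diag x i j : x \in h -> i != j -> f x i j = 0.
Proof. by move=> /hd /is_diag_mxP d ij; apply: d. Qed.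

Lemma lie_diag x v i j : x \in h -> f (lie x v) i j = (f x i i - f x j j) * f v i j.
Proof.
case: fL => _ -> xh; rewrite [LHS]mxE [X in _ + X = _]mxE !mxE.
rewrite (bigD1 i) //= big1 => [|k ki]; last first.
  by rewrite (cartan_off_diag xh) ?mul0r // eq_sym.
rewrite (bigD1 j) //= big1 => [|k kj]; last first.
  by rewrite (cartan_off_diag xh) ?mulr0.
by ring.
Qed.

Lemma root_space_entry alpha v i j : root_space alpha v -> f v i j != 0 ->
  alpha = dwt i - dwt j.
Proof.
move=> rv nz; apply/lfunP => H; rewrite add_lfunE opp_lfunE !dwtE.
have := rv H; move/(congr1 (fun w => f w i j)); rewrite lie_diag ?subvsP //.
by rewrite linearZ /= mxE => /(mulIf nz).
Qed.

Lemma root_space_intro alpha v :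
  (forall i j, f v i j != 0 -> alpha = dwt i - dwt j) -> root_space alpha v.
Proof.
move=> hv H; case: fL => finj _; apply: finj; apply/matrixP=> i j.
rewrite lie_diag ?subvsP // linearZ /= mxE.
case: (eqVneq (f v i j) 0) => [->|/hv->]; first by rewrite !mulr0.
by rewrite add_lfunE opp_lfunE !dwtE.
Qed.

Lemma root_entry alpha v : alpha != 0 -> root_space alpha v -> v != 0 ->
  exists i j, [/\ i != j, f v i j != 0 & alpha = dwt i - dwt j].
Proof.
move=> a0 rv v0; apply: contrapT => no; case/eqP: v0.
case: fL => finj _; apply: finj; apply/matrixP=> i j; rewrite linear0 mxE.
apply/eqP/negPn/negP => nz; apply: no; exists i, j.
have ae := root_space_entry rv nz; split=> //.
by apply: contraNneq a0 => ij; rewrite ae ij subrr.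
Qed.

Lemma diag_abelian x y : x \in h -> y \in h -> lie x y = 0.
Proof.
move=> xh yh; case: fL => finj _; apply: finj; apply/matrixP=> i j.
rewrite lie_diag // linear0 mxE; have [->|ij] := eqVneq i j.
  by rewrite subrr mul0r.
by rewrite (cartan_off_diag yh ij) mulr0.
Qed.

End DiagonalWeights.

Section SlCoordinates.
Variables (F : numClosedFieldType) (g : lieAlgType F) (h : {vspace g}) (n' : nat).
Local Notation n := n'.+1.
Local Notation wt := 'Hom(subvs_of h, F^o).
Variable f : {linear g -> 'M[F]_n}.
Hypotheses (fL : lie_embedding f) (hd : forall x, x \in h <-> is_diag_mx (f x))
  (fr : range f = sl F n).
Local Notation w := (dwt h f).

Lemma sl_weights_separated (c : 'I_n -> int) : exists H : subvs_of h,
  forall i j, (w i - w j) H = (c i - c j)%:~R.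
Proof.
pose t : F := (\sum_i (c i)%:~R) / n%:R.
pose d : 'rV[F]_n := \row_i ((c i)%:~R - t).
have : sl F n (diag_mx d).
  rewrite /sl /= mxtrace_diag; under eq_bigr do rewrite mxE.
  by rewrite sumrB sumr_const card_ord -mulr_natr /t divfK ?subrr // pnatr_eq0.
rewrite -fr => -[x _ xE].
have xh : x \in h by apply/hd; rewrite xE diag_mx_is_diag.
exists (Subvs xh) => i j; rewrite add_lfunE opp_lfunE !dwtE /= xE !mxE !eqxx !mulr1n.
by rewrite rmorphB /= opprB addrA subrK.
Qed.

Lemma sl_delta i j : exists x, i != j -> f x = delta_mx i j.
Proof.
case: (eqVneq i j) => [_|ij]; first by exists 0.
have : sl F n (delta_mx i j).
  rewrite /sl /= /mxtrace big1 // => k _; rewrite mxE.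
  by case: eqP => [->|]; rewrite ?(negPf ij).
by rewrite -fr => -[x _ <-]; exists x.
Qed.

(** The second copy carries the weights of the dual representation, so that every
    root of [sl] has two names as well. *)
Definition slX := (bool * 'I_n)%type.
Definition sl_neg (x : slX) : slX := (~~ x.1, x.2).
Definition sl_link : rel slX := fun x y => x.1 == y.1.
Definition sl_e (x : slX) : wt := if x.1 then - w x.2 else w x.2.

Lemma sl_coordinates : exists E : slX -> slX -> g,
  coordinates sl_neg sl_link false sl_e E.
Proof.
have [D DE] : exists D : 'I_n -> 'I_n -> g, forall i j, i != j -> f (D i j) = delta_mx i j.
  have /choice[D DE] : forall p : 'I_n * 'I_n, exists x, p.1 != p.2 -> f x = delta_mx p.1 p.2.
    by move=> [i j]; apply: sl_delta.
  by exists (fun i j => D (i, j)) => i j; apply: (DE (i, j)).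
pose E (x y : slX) := if x.1 then D y.2 x.2 else D x.2 y.2.
have negK : involutive sl_neg by move=> [b i]; rewrite /sl_neg /= negbK.
have sep : weights_separated sl_neg sl_link sl_e.
  move=> c cN; have [H HE] := sl_weights_separated (fun i => c (false, i)).
  exists H => -[b i] [b' j] /eqP /= <-; case: b; rewrite /sl_e /=; last exact: HE.
  rewrite opprK addrC HE.
  have cT k : c (true, k) = - c (false, k) by rewrite -cN.
  by rewrite !cT opprK [in RHS]addrC.
have fixed x y : sl_neg x = x -> sl_neg y = y -> x = y by case: x => [[] i].
have admE b i b' j : adm sl_neg sl_link false (b, i) (b', j) = (b == b') && (i != j).
  rewrite /adm /sl_link /sl_neg /= !xpair_eqE.
  by case: b; case: b'; rewrite //= andbT.
have rootE b i j : sl_e (b, i) - sl_e (b, j) = if b then w j - w i else w i - w j.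
  by rewrite /sl_e; case: b => //=; rewrite opprK addrC.
have w_inj i j k l : i != j -> k != l -> w i - w j = w k - w l -> k = i /\ l = j.
  move=> ij kl e1.
  have := root_pair_eq negK fixed sep (x := (false, i)) (y := (false, j))
    (i := (false, k)) (j := (false, l)).
  rewrite !xpair_eqE /= !rootE /= => /(_ ij kl (eqxx _) (eqxx _) e1).
  by case=> [[[-> ] [->]]|[]].
have rE i j : i != j -> root_space (w i - w j) (D i j) /\ D i j != 0.
  move=> ij; split.
    apply: (root_space_intro fL hd) => k l; rewrite DE // mxE pnatr_eq0 eqb0 negbK.
    by case/andP=> /eqP-> /eqP->.
  apply/eqP => D0; have := DE i j ij; rewrite D0 linear0 => /matrixP/(_ i j)/eqP.
  by rewrite !mxE !eqxx eq_sym oner_eq0.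
have line i j v : i != j -> root_space (w i - w j) v -> exists c, v = c *: D i j.
  move=> ij rv; exists (f v i j); case: (fL) => finj _; apply: finj; apply/matrixP=> k l.
  rewrite linearZ /= DE // !mxE; case: (eqVneq (f v k l) 0) => [z|nz].
    case: eqP => [ki|_] /=; last by rewrite mulr0.
    by case: eqP => [lj|_] /=; [rewrite -ki -lj z mul0r|rewrite mulr0 z].
  have := root_space_entry fL hd rv nz.
  case: (eqVneq k l) => [->|kl]; last first.
    by move=> /(w_inj _ _ _ _ ij kl)[-> ->]; rewrite !eqxx mulr1.
  rewrite subrr => e0; have ji : j != i by rewrite eq_sym.
  have e1 : w i - w j = w j - w i by rewrite e0 -opprB e0 oppr0.
  by have [ji' _] := w_inj i j j i ij ji e1; rewrite ji' eqxx in ij.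
have brk i j k : i != j -> j != k -> i != k -> lie (D i j) (D j k) != 0.
  move=> ij jk ik; apply/eqP => l0; have [_ /(_ (D i j) (D j k))] := fL.
  rewrite l0 linear0 !DE // mul_delta_mx mul_delta_mx_0; last by rewrite eq_sym.
  by rewrite subr0 => /matrixP/(_ i k)/eqP; rewrite !mxE !eqxx eq_sym oner_eq0.
have sl2 i j : i != j -> lie (lie (D i j) (D j i)) (D i j) != 0.
  move=> ij; have ji : j != i by rewrite eq_sym.
  apply/eqP => l0; case: (fL) => _ flie; move/(congr1 f): l0.
  rewrite !flie linear0 !DE // !mul_delta_mx mulmxBl mulmxBr !mul_delta_mx.
  rewrite !mul_delta_mx_0 // subr0 sub0r opprK => /matrixP/(_ i j)/eqP.
  by rewrite !mxE !eqxx -(natrD _ 1 1) pnatr_eq0.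
exists E; split=> //.
- by move=> x y; rewrite /sl_link eq_sym.
- by move=> y x z /eqP xy /eqP yz; rewrite /sl_link xy yz.
- by move=> [[] i] [[] j].
- move=> [b i] [b' j] /eqP /= <-; rewrite /sl_neg /=.
  by rewrite !rootE; case: b.
- move=> [b i] [b' j]; rewrite admE => /andP[/eqP <- ij]; rewrite rootE /E /=.
  by case: b; apply: rE; rewrite // eq_sym.
- move=> [b i] [b' j] v; rewrite admE => /andP[/eqP <- ij]; rewrite rootE /E /=.
  by case: b; apply: line; rewrite // eq_sym.
- move=> alpha v a0 rv v0; have [i [j [ij _ ->]]] := root_entry fL hd a0 rv v0.
  by exists (false, i), (false, j); rewrite admE.
- move=> [b i] [b' j] [b2 k]; rewrite !admE => /andP[/eqP <- ij] /andP[/eqP <- jk] /andP[_ ik].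
  rewrite /E /=; case: b; last exact: brk.
  by rewrite lieC oppr_eq0; apply: brk; rewrite eq_sym.
- move=> [b i] [b' j]; rewrite admE => /andP[/eqP <- ij]; rewrite /E /=.
  by case: b; apply: sl2; rewrite // eq_sym.
- move=> v; pose d : 'rV[F]_n := \row_i f v i i.
  have : sl F n (diag_mx d).
    have : sl F n (f v) by rewrite -fr; exists v.
    by rewrite /sl /= mxtrace_diag => {2}<-; apply: eq_bigr => i _; rewrite mxE.
  rewrite -fr => -[v0 _ v0E].
  exists v0, (fun x y => if x.1 then 0 else f v x.2 y.2); split.
    by apply/hd; rewrite v0E diag_mx_is_diag.
  case: (fL) => finj _; apply: finj; rewrite linearD /= v0E.
  rewrite linear_sum /= (eq_bigr (fun x : slX => if x.1 then 0 else
     \sum_(j | j != x.2) f v x.2 j *: delta_mx x.2 j)); last first.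
    move=> [b i] _; rewrite linear_sum /=; case: b => /=.
      by rewrite big1 // => y _; rewrite scale0r linear0.
    rewrite (reindex_onto (fun j => (false, j)) snd) /=; last first.
      by move=> [b j]; rewrite admE => /andP[/eqP <-].
    apply: eq_big => [j|j]; first by rewrite admE eqxx !eqxx andbT eq_sym.
    by rewrite admE eqxx eqxx andbT /= => ij; rewrite linearZ /= /E /= DE.
  rewrite -(pair_bigA _ (fun b i => if b then 0 else \sum_(j | j != i) f v i j *: delta_mx i j)) /=.
  rewrite big_bool /= big1 // add0r {1}[f v]matrix_sum_delta.
  have -> : diag_mx d = \sum_i f v i i *: delta_mx i i.
    apply/matrixP=> i j; rewrite !mxE summxE (bigD1 i) //= big1 => [|k ki].
      by rewrite !mxE eqxx addr0 [j == i]eq_sym /=; case: (i == j); rewrite ?mulr1 ?mulr0.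
    by rewrite !mxE eq_sym (negPf ki) mulr0.
  by rewrite -big_split; apply: eq_bigr => i _; rewrite (bigD1 i).
- exact: diag_abelian fL hd.
Qed.

End SlCoordinates.

Section SkewCoordinates.
Variables (F : numClosedFieldType) (g : lieAlgType F) (h : {vspace g}) (n' : nat).
Local Notation n := n'.+1.
Variables (f : {linear g -> 'M[F]_n}) (J : 'M[F]_n) (neg : 'I_n -> 'I_n) (e : F).
Hypotheses (fL : lie_embedding f) (hd : forall x, x \in h <-> is_diag_mx (f x))
  (fr : range f = skewJ J) (eP : e = 1 \/ e = -1)
  (Ju : J \in unitmx) (Je : J^T = e *: J) (negK : involutive neg)
  (Jneg : forall i j, (J i j != 0) = (j == neg i))
  (fixed : forall i j, neg i = i -> neg j = j -> i = j).
Local Notation w := (dwt h f).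
Local Notation K := (invmx J).
Local Notation lng := (e == -1).
Local Notation link := (fun _ _ : 'I_n => true).
Local Notation adm := (adm neg link lng).
Local Notation j_ i := (J i (neg i)).

Let Jn0 i j : j != neg i -> J i j = 0.
Proof. by rewrite -Jneg negbK => /eqP. Qed.

Let j0 i : j_ i != 0. Proof. by rewrite Jneg. Qed.

Let jC i : J (neg i) i = e * j_ i.
Proof. by have /matrixP/(_ i (neg i)) := Je; rewrite !mxE. Qed.

Lemma skew_entry A i j : skewJ J A -> A i j * j_ j + j_ i * A (neg j) (neg i) = 0.
Proof.
move=> /matrixP/(_ i (neg j)); rewrite !mxE (bigD1 j) //= big1 => [|k kj]; last first.
  by rewrite Jn0 ?mulr0 // neg_eq // eq_sym.
rewrite (bigD1 (neg i)) //= big1 => [|k ki]; last by rewrite Jn0 // mul0r.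
by rewrite !addr0 mxE.
Qed.

Lemma inverse_entry i j : K i j = (j == neg i)%:R / J j i.
Proof.
have [->|ji] := eqVneq j (neg i).
  have : (K *m J) i i = 1 by rewrite mulVmx // mxE eqxx.
  rewrite mxE (bigD1 (neg i)) //= big1 => [|k kj]; last first.
    by rewrite Jn0 ?mulr0 //; apply: contraNneq kj => ->; rewrite negK.
  rewrite addr0 => /(canRL (mulfK _)) -> //.
  by rewrite Jneg negK.
have : (K *m J) i (neg j) = 0.
  rewrite mulVmx // mxE; case: eqP => // ei; case/eqP: ji.
  by rewrite ei negK.
rewrite mxE (bigD1 j) //= big1 => [|k kj]; last first.
  by rewrite Jn0 ?mulr0 // neg_eq // eq_sym.
by rewrite addr0 mul0r => /eqP; rewrite mulf_eq0 (negPf (j0 j)) orbF => /eqP.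
Qed.

(** The root vector [delta_mx x y - J (delta_mx y x) J^-1] has its two entries at the
    two names of the root. *)
Lemma root_vector_entry x y a b : skew_proj J (delta_mx x y) a b =
  ((a == x) && (b == y))%:R - ((a == neg y) && (b == neg x))%:R * (J a y / J b x).
Proof.
rewrite skew_projE mxE; congr (_ - _).
rewrite trmx_delta mxE (bigD1 x) //= big1 => [|k kx]; last first.
  rewrite mxE big1 ?mul0r // => l _.
  by rewrite [delta_mx _ _ _ _]mxE (negPf kx) andbF mulr0.
rewrite addr0 mxE (bigD1 y) //= big1 => [|k ky]; last first.
  by rewrite [delta_mx _ _ _ _]mxE (negPf ky) mulr0.
rewrite addr0 [delta_mx _ _ _ _]mxE !eqxx mulr1 inverse_entry.
have [->|ay] := eqVneq a (neg y) => /=; first by rewrite mulrCA.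
by rewrite (Jn0 (i := a)) ?mul0r // neg_eqC.
Qed.

Lemma skew_proj_id A : skewJ J A -> skew_proj J A = A *+ 2.
Proof.
move=> /eqP; rewrite addrC addr_eq0 => /eqP AJ.
by rewrite /skew_proj AJ mulNmx mulmxK // opprK mulr2n.
Qed.

Lemma skew_coordinates : exists E : 'I_n -> 'I_n -> g,
  coordinates neg link lng w E.
Proof.
have [E EE] : exists E : 'I_n -> 'I_n -> g, forall i j, f (E i j) = skew_proj J (delta_mx i j).
  have /choice[D DE] : forall p : 'I_n * 'I_n, exists x, f x = skew_proj J (delta_mx p.1 p.2).
    move=> p; have := skew_projP eP Ju Je (delta_mx p.1 p.2).
    by rewrite -fr => -[x _ <-]; exists x.
  by exists (fun i j => D (i, j)) => i j; apply: (DE (i, j)).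
have Enz x y a b : f (E x y) a b != 0 -> (a = x /\ b = y) \/ (a = neg y /\ b = neg x).
  rewrite EE root_vector_entry.
  case: (boolP ((a == x) && _)) => [/andP[/eqP-> /eqP->] _|_]; first by left.
  case: (boolP ((a == neg y) && _)) => [/andP[/eqP-> /eqP->] _|_]; first by right.
  by rewrite mul0r subr0 eqxx.
have admn x y : adm x y -> x != y by case/and3P.
have Exy x y : adm x y -> f (E x y) x y != 0.
  move=> a; rewrite EE root_vector_entry !eqxx /=.
  have [xy|nxy] := eqVneq x (neg y); last by rewrite mul0r subr0 oner_eq0.
  have yx : y = neg x by rewrite xy negK.
  have {a}/eqP l : lng.
    by case/and3P: a => _ _; rewrite {1}xy eqxx orbF.
  rewrite yx eqxx /= mul1r jC l mulN1r invrN mulrN divff // opprK.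
  by rewrite -(natrD _ 1 1) pnatr_eq0.
have sep : weights_separated neg link w.
  move=> c cN; pose d : 'rV[F]_n := \row_i (c i)%:~R.
  have : skewJ J (diag_mx d).
    rewrite /skewJ /= tr_diag_mx mul_diag_mx mul_mx_diag; apply/matrixP=> i j.
    rewrite !mxE; have [->|ji] := eqVneq j (neg i); last by rewrite Jn0 // mul0r mulr0 addr0.
    by rewrite cN rmorphN /= mulrN mulrC subrr.
  rewrite -fr => -[x _ xE].
  have xh : x \in h by apply/hd; rewrite xE diag_mx_is_diag.
  exists (Subvs xh) => i j _; rewrite add_lfunE opp_lfunE !dwtE /= xE !mxE !eqxx !mulr1n.
  by rewrite rmorphB.
have mirror x y : w (neg y) - w (neg x) = w x - w y.
  suff wN z : w (neg z) = - w z by rewrite !wN opprK addrC.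
  apply/lfunP => H; rewrite opp_lfunE !dwtE.
  have : skewJ J (f (vsval H)) by rewrite -fr; exists (vsval H).
  move=> /(skew_entry z z); rewrite mulrC -mulrDr => /eqP; rewrite mulf_eq0 (negPf (j0 z)) /=.
  by rewrite addrC addr_eq0 => /eqP.
have w_inj x y a b : x != y -> a != b -> w x - w y = w a - w b ->
    (a = x /\ b = y) \/ (a = neg y /\ b = neg x).
  by move=> xy ab; apply: (root_pair_eq negK fixed sep).
have rE x y : adm x y -> root_space (w x - w y) (E x y) /\ E x y != 0.
  move=> a; split; last first.
    by apply: contraTneq (Exy _ _ a) => ->; rewrite linear0 mxE eqxx.
  apply: (root_space_intro fL hd) => k l /Enz[[-> ->]//|[-> ->]].
  by rewrite mirror.
have skf v : skewJ J (f v) by rewrite -fr; exists v.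
have opp v x y : f v x y = 0 -> f v (neg y) (neg x) = 0.
  move=> z; have := skew_entry x y (skf v); rewrite z mul0r add0r => /eqP.
  by rewrite mulf_eq0 (negPf (j0 x)) => /eqP.
have diff0 x y : x != y -> w x - w y != 0.
  move=> xy; apply/eqP => w0.
  case: (@w_inj x y y x) => //; first by rewrite eq_sym.
  - by rewrite w0 -opprB w0 oppr0.
  - by case=> yx _; rewrite yx eqxx in xy.
  - by case=> ny nx; case/eqP: xy; apply: fixed.
have line x y v : adm x y -> root_space (w x - w y) v -> exists c, v = c *: E x y.
  move=> a rv; exists (f v x y / f (E x y) x y); set c := _ / _.
  apply/eqP; rewrite -subr_eq0; apply/eqP; set u := v - _.
  have uxy : f u x y = 0.
    by rewrite linearB linearZ /= [LHS]mxE [X in _ + X]mxE [X in _ - X]mxE divfK ?subrr // Exy.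
  have ru : root_space (w x - w y) u.
    move=> H; rewrite linearB linearZ /= (rE x y a).1 rv scalerBr.
    by congr (_ - _); rewrite !scalerA mulrC.
  apply: contrapT => /eqP u0.
  have [i [j [ij nz e1]]] := root_entry fL hd (diff0 _ _ (admn _ _ a)) ru u0.
  case: (w_inj _ _ _ _ (admn _ _ a) ij e1) => -[ei ej].
    by rewrite ei ej uxy eqxx in nz.
  by rewrite ei ej (opp _ _ _ uxy) eqxx in nz.
have all alpha v : alpha != 0 -> root_space alpha v -> v != 0 ->
    exists x y, adm x y /\ alpha = w x - w y.
  move=> a0 rv v0; have [i [j [ij nz e1]]] := root_entry fL hd a0 rv v0.
  exists i, j; split=> //; rewrite /adm ij /=.
  case: (boolP lng) => //= nl; apply/eqP => inj.
  have e1' : e = 1 by case: eP => // e2; rewrite e2 eqxx in nl.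
  have := skew_entry i j (skf v); rewrite inj negK => /eqP.
  rewrite jC e1' mul1r mulrC -mulr2n mulrn_eq0 /= mulf_eq0 (negPf (j0 _)) -inj => /eqP.
  by move/eqP; rewrite (negPf nz).
have prodE (A B : 'M[F]_n) i k l : (forall b, b != k -> A i b * B b l = 0) ->
    (A *m B) i l = A i k * B k l.
  by move=> h0; rewrite mxE (bigD1 k) //= big1 ?addr0 // => b bk; apply: h0.
have prod0 (A B : 'M[F]_n) i l : (forall b, A i b * B b l = 0) -> (A *m B) i l = 0.
  by move=> h0; rewrite mxE big1 // => b _; apply: h0.
have Ez x y a b : (a = x -> b = y -> False) -> (a = neg y -> b = neg x -> False) ->
    f (E x y) a b = 0.
  move=> h1 h2; apply/eqP/negPn/negP => /Enz[[ea eb]|[ea eb]]; first exact: h1.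
  exact: h2.
have ratio x y : f (E x y) (neg y) (neg x) = - (f (E x y) x y * j_ y / j_ x).
  have := skew_entry x y (skf (E x y)); rewrite addrC => /eqP.
  rewrite addr_eq0 mulrC => /eqP h1; apply: (mulIf (j0 x)).
  by rewrite h1 mulNr divfK.
have brk x y z : adm x y -> adm y z -> adm x z -> lie (E x y) (E y z) != 0.
  move=> axy ayz axz; apply/eqP => l0; case: (fL) => _ flie.
  have := flie (E x y) (E y z); rewrite l0 linear0.
  have [nxy nyz nxz] := And3 (admn _ _ axy) (admn _ _ ayz) (admn _ _ axz).
  move=> /matrixP/(_ x z); rewrite mxE [RHS]mxE [X in _ + X]mxE.
  rewrite (prodE _ _ _ y) => [|b bY]; last first.
    rewrite (Ez x y x b) ?mul0r // => [_ ey|ex ebx]; first by rewrite ey eqxx in bY.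
    by case/eqP: bY; rewrite ebx ex negK.
  case: (eqVneq x (neg z)) => [xz|nxnz].
    have l : lng.
      by case/and3P: axz => _ _; rewrite {1}xz eqxx orbF.
    have zx : z = neg x by rewrite xz negK.
    rewrite (prodE _ _ _ (neg y)) => [|b bY]; last first.
      rewrite (Ez y z x b) ?mul0r // => [ex|_ ey]; first by rewrite ex eqxx in nxy.
      by rewrite ey eqxx in bY.
    have r1 := ratio y (neg x); rewrite negK jC (eqP l) mulN1r in r1.
    have p0 := Exy _ _ axy; have q0 := Exy _ _ ayz.
    subst z; rewrite r1 ratio => /eqP.
    set p := f (E x y) x y in p0 *; set q := f (E y (neg x)) y (neg x) in q0 *.
    have -> : p * q - - (q * - j_ x / j_ y) * - (p * j_ y / j_ x) = (p * q) *+ 2.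
      by field; rewrite !j0.
    by rewrite eq_sym mulrn_eq0 mulf_eq0 (negPf p0) (negPf q0).
  rewrite prod0 => [/eqP|b].
    by rewrite subr0 eq_sym mulf_eq0 (negPf (Exy _ _ axy)) (negPf (Exy _ _ ayz)).
  rewrite (Ez y z x b) ?mul0r // => [ex|exz]; first by rewrite ex eqxx in nxy.
  by rewrite exz eqxx in nxnz.
have sl2 x y : adm x y -> lie (lie (E x y) (E y x)) (E x y) != 0.
  move=> axy; have ayx : adm y x by rewrite admC.
  have xy := admn _ _ axy; have yx := admn _ _ ayx.
  have p0 := Exy _ _ axy; have q0 := Exy _ _ ayx.
  set d := lie (E x y) (E y x).
  have rd : root_space (w x - w y + (w y - w x)) d.
    move=> H; rewrite /d lie_leibniz (rE x y axy).1 (rE y x ayx).1.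
    by rewrite lieZl linearZ /= -scalerDl [in RHS]add_lfunE.
  have dh : d \in h.
    apply/hd/is_diag_mxP => i j ij; apply/eqP/negPn/negP => nz.
    have := root_space_entry fL hd rd nz; rewrite addrC subrKA subrr => /esym/eqP.
    by rewrite (negPf (diff0 _ _ ij)).
  apply/eqP => l0; have := lie_diag fL hd (E x y) x y dh.
  rewrite l0 linear0 mxE => /esym/eqP; rewrite mulf_eq0 (negPf p0) orbF.
  case: (fL) => _ flie; rewrite /d flie.
  rewrite mxE [X in _ + X - _]mxE [X in _ - X]mxE [X in _ - (_ + X)]mxE.
  have pyx := ratio x y; have pxy := ratio y x.
  set p := f (E x y) x y in p0 pyx; set q := f (E y x) y x in q0 pxy.
  have e1 : (f (E x y) *m f (E y x)) x x = p * q.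
    apply: prodE => b bY; rewrite (Ez x y x b) ?mul0r // => [_ ey|ex ebx].
      by rewrite ey eqxx in bY.
    by case/eqP: bY; rewrite ebx ex negK.
  have e2 : (f (E y x) *m f (E x y)) y y = p * q.
    rewrite mulrC; apply: prodE => b bX; rewrite (Ez y x y b) ?mul0r // => [_ ex|ey eby].
      by rewrite ex eqxx in bX.
    by case/eqP: bX; rewrite eby ey negK.
  have e3 : (f (E y x) *m f (E x y)) x x = (x == neg x)%:R * (p * q).
    rewrite (prodE _ _ _ (neg y)) => [|b bY]; last first.
      rewrite (Ez y x x b) ?mul0r // => [ex|_ eb]; first by rewrite ex eqxx in xy.
      by rewrite eb eqxx in bY.
    have [ex|nx] := eqVneq x (neg x); last first.
      rewrite (Ez y x x (neg y)) ?mul0r // => [ex|ex]; first by rewrite ex eqxx in xy.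
      by rewrite -ex eqxx in nx.
    have -> : f (E y x) x (neg y) = f (E y x) (neg x) (neg y) by rewrite -ex.
    have -> : f (E x y) (neg y) x = f (E x y) (neg y) (neg x) by rewrite -ex.
    by rewrite pyx pxy mul1r; field; rewrite !j0.
  have e4 : (f (E x y) *m f (E y x)) y y = (y == neg y)%:R * (p * q).
    rewrite (prodE _ _ _ (neg x)) => [|b bY]; last first.
      rewrite (Ez x y y b) ?mul0r // => [ey|_ eb]; first by rewrite ey eqxx in yx.
      by rewrite eb eqxx in bY.
    have [ey|ny] := eqVneq y (neg y); last first.
      rewrite (Ez x y y (neg x)) ?mul0r // => [ey|ey]; first by rewrite ey eqxx in yx.
      by rewrite -ey eqxx in ny.
    have -> : f (E x y) y (neg x) = f (E x y) (neg y) (neg x) by rewrite -ey.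
    have -> : f (E y x) (neg x) y = f (E y x) (neg x) (neg y) by rewrite -ey.
    by rewrite pyx pxy mul1r; field; rewrite !j0.
  rewrite e1 e2 e3 e4.
  have -> : p * q - (x == neg x)%:R * (p * q) - ((y == neg y)%:R * (p * q) - p * q) =
     (2%:R - (x == neg x)%:R - (y == neg y)%:R) * (p * q) by ring.
  rewrite !mulf_eq0 (negPf p0) (negPf q0) !orbF.
  have [ex|_] := eqVneq x (neg x); have [ey|_] := eqVneq y (neg y).
  - by case/eqP: xy; apply: fixed.
  - by rewrite subr0 -(natrB _ (isT : (1 <= 2)%N)) pnatr_eq0.
  - by rewrite subr0 -(natrB _ (isT : (1 <= 2)%N)) pnatr_eq0.
  - by rewrite !subr0 pnatr_eq0.
exists E; split=> //.
- move=> v; pose d : 'rV[F]_n := \row_i f v i i.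
  have : skewJ J (diag_mx d).
    rewrite /skewJ /= tr_diag_mx mul_diag_mx mul_mx_diag; apply/matrixP=> i j.
    rewrite !mxE; have [->|ji] := eqVneq j (neg i); last by rewrite Jn0 // mul0r mulr0 addr0.
    by have := skew_entry i i (skf v).
  rewrite -fr => -[v0 _ v0E].
  exists v0, (fun x y => f v x y / 2%:R); split.
    by apply/hd; rewrite v0E diag_mx_is_diag.
  case: (fL) => finj _; apply: finj; apply/eqP; rewrite linearD /= addrC -subr_eq; apply/eqP.
  have e1 : f v - f v0 = 2%:R^-1 *: skew_proj J (f (v - v0)).
    rewrite (skew_proj_id (skf _)) -scaler_nat scalerA mulVf ?scale1r ?linearB //.
    by rewrite pnatr_eq0.
  rewrite e1 linear_sum /= {1}[f (v - v0)]matrix_sum_delta.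
  have pL : linear (skew_proj J).
    by move=> a A B; rewrite /skew_proj linearP /= mulmxDr mulmxDl -!scalemxAr -!scalemxAl scalerBr opprD addrACA.
  have pD A B : skew_proj J (A + B) = skew_proj J A + skew_proj J B.
    by have := pL 1 A B; rewrite !scale1r.
  have p0' : skew_proj J 0 = 0 by rewrite /skew_proj linear0 mulmx0 mul0mx subr0.
  have pZ a A : skew_proj J (a *: A) = a *: skew_proj J A.
    by have := pL a A 0; rewrite !addr0 p0' addr0.
  rewrite (big_morph _ pD p0') scaler_sumr; apply: eq_bigr => x _.
  rewrite linear_sum /= (big_morph _ pD p0') scaler_sumr [RHS]big_mkcond; apply: eq_bigr => y _.
  rewrite pZ scalerA.
  have -> : f (v - v0) x y = f v x y - diag_mx d x y.
    by rewrite linearB /= v0E [LHS]mxE [X in _ + X]mxE.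
  have -> : f ((f v x y / 2%:R) *: E x y) = (f v x y / 2%:R) *: skew_proj J (delta_mx x y).
    by rewrite linearZ /= EE.
  rewrite !mxE.
  case: ifPn => axy.
    by rewrite (negPf (admn _ _ axy)) mulr0n subr0 mulrC.
  have [->|xy] := eqVneq x y; first by rewrite mulr1n subrr mulr0 scale0r.
  rewrite mulr0n subr0; suff -> : f v x y = 0 by rewrite mulr0 scale0r.
  apply/eqP/negPn/negP => nz; case/negP: axy; rewrite /adm xy /=.
  case: (boolP lng) => //= nl; apply/eqP => inj.
  have e1' : e = 1 by case: eP => // e2; rewrite e2 eqxx in nl.
  have := skew_entry x y (skf v); rewrite inj negK => /eqP.
  rewrite jC e1' mul1r mulrC -mulr2n mulrn_eq0 /= mulf_eq0 (negPf (j0 _)) -inj => /eqP.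
  by move/eqP; rewrite (negPf nz).
- exact: diag_abelian fL hd.
Qed.

End SkewCoordinates.

(** * Sums of roots *)

Section Roots.
Variables (F : numClosedFieldType) (g : lieAlgType F) (h : {vspace g}).
Local Notation wt := 'Hom(subvs_of h, F^o).
Variables (X : finType) (neg : X -> X) (lk : rel X) (lng : bool).
Variables (e : X -> wt) (E : X -> X -> g).
Hypothesis hX : coordinates neg lk lng e E.
Local Notation adm := (adm neg lk lng).
Local Notation root x y := (e x - e y).
Local Notation subsystem := (subsystem neg lk lng).
Implicit Types (t : {vspace g}) (alpha beta : wt) (T : rel X).

Let negK := coord_negK hX.
Let lkC := coord_lkC hX.
Let lkT := coord_lkT hX.
Let lk_neg := coord_lk_neg hX.
Let fixed := coord_fixed hX.
Let sep := coord_eval hX.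
Let mirror := coord_mirror hX.
Let rE x y (a : adm x y) := (coord_root hX a).1.
Let E0 x y (a : adm x y) := (coord_root hX a).2.
Let line := coord_line hX.
Let admT x y (a : adm x y) := adm_lk a.
Let abel := coord_abelian hX.
Let adm_sym x y : adm x y = adm y x. Proof. exact: admC. Qed.

Lemma peq x y a b : adm x y -> adm a b -> root x y = root a b ->
  (a = x /\ b = y) \/ (a = neg y /\ b = neg x).
Proof.
move=> /and3P[l1 n1 _] /and3P[l2 n2 _].
exact: (root_pair_eq negK fixed sep).
Qed.

Lemma root_neq0 x y : x != y -> lk x y -> root x y != 0.
Proof.
move=> xy lxy; apply/eqP => r0.
have r0' : root x y = root y x by rewrite r0 -opprB r0 oppr0.
have [||[yx _]|[ny nx]] := root_pair_eq negK fixed sep xy _ lxy _ r0'.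
- by rewrite eq_sym.
- by rewrite lkC.
- by rewrite yx eqxx in xy.
- by case/eqP: xy; apply: fixed.
Qed.

Lemma e_inj x y : lk x y -> e x = e y -> x = y.
Proof.
move=> l exy; apply/eqP/negPn/negP => /root_neq0/(_ l).
by rewrite exy subrr eqxx.
Qed.

Lemma DeltaP t alpha : Delta t alpha ->
  exists x y, [/\ adm x y, alpha = root x y & E x y \in t].
Proof.
case=> a0 [v v0 rv] st; have [x [y [a e1]]] := coord_all hX a0 rv v0.
by exists x, y; split=> //; apply: st; rewrite e1; apply: rE.
Qed.

Lemma DeltaE t x y : adm x y -> Delta t (root x y) <-> E x y \in t.
Proof.
move=> a; split=> [[_ _ st]|Et]; first by apply: st; apply: rE.
split; first by case/and3P: a => l n _; apply: root_neq0.
  by exists (E x y); [exact: E0|exact: rE].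
by move=> v /(line a)[c ->]; apply: memvZ.
Qed.

Lemma Delta_lk t x y : lk x y -> Delta t (root x y) -> adm x y.
Proof.
move=> l d; have [a [b [ab e1 _]]] := DeltaP d.
have xy : x != y by case: d => /eqP r0 _ _; apply/eqP => xy; apply: r0; rewrite xy subrr.
have [lab nab _] := and3P ab.
case: (root_pair_eq negK fixed sep xy nab l lab e1) => -[ea eb].
  by rewrite -ea -eb.
by rewrite -adm_neg // -ea -eb.
Qed.

Lemma Delta_full t alpha : Delta t alpha -> Delta fullv alpha.
Proof. by case=> a0 ex _; split=> // v _; rewrite /= memvf. Qed.

Definition same_pair z w a b := (z = a /\ w = b) \/ (z = neg b /\ w = neg a).

Lemma same_pair_root z w a b : same_pair z w a b -> lk a b -> root z w = root a b.
Proof. by case=> -[-> ->] // l; rewrite mirror. Qed.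

(** The linear form of the indicator function of [x], [z], [neg y], [neg w] takes a
    value at least [3] at the sum, while it is at most [2] at every root. *)
Lemma root_cancel x y z w : adm x y -> adm z w ->
  [/\ x <> w, y <> z, x <> neg z & y <> neg w] ->
  ~ Delta fullv (root x y + root z w) /\ root x y + root z w <> 0.
Proof.
move=> axy azw [xw yz xz yw].
pose M s := (s \in [:: x; z; neg y; neg w]).
pose c s : int := (M s)%:Z - (M (neg s))%:Z.
have cN s : c (neg s) = - c s by rewrite /c negK opprB.
have [H HE] := sep cN.
have ninj := inj_eq (can_inj negK).
have fx s (s' := s) : (neg s == s) = (s == neg s) by rewrite eq_sym.
have xy := adm_neq axy; have zw := adm_neq azw.
have Mn s : M (neg s) = (s \in [:: neg x; neg z; y; w]).
  rewrite /M !inE -[neg s == neg y]/(_ == _) !ninj.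
  by rewrite -[x in neg s == x]negK ninj -[z in neg s == z]negK ninj.
have cx : c x = 1 - (x == neg x)%:Z.
  rewrite /c Mn /M !inE eqxx /=.
  by move/eqP/negPf: xy => ->; move/eqP/negPf: xw => ->; move/eqP/negPf: xz => ->; rewrite !orbF.
have cz : c z = 1 - (z == neg z)%:Z.
  rewrite /c Mn /M !inE eqxx orbT /= [z == y]eq_sym [z == neg x]eq_sym.
  have zx : neg x == z = false by apply/eqP => e1; apply: xz; rewrite -e1 negK.
  by move/eqP/negPf: zw => ->; move/eqP/negPf: yz => ->; rewrite zx !orbF.
have cy : c y = (y == neg y)%:Z - 1.
  rewrite /c Mn /M !inE eqxx !orbT /= [y == x]eq_sym.
  by move/eqP/negPf: xy => ->; move/eqP/negPf: yz => ->; move/eqP/negPf: yw => ->; rewrite !orbF.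
have cw : c w = (w == neg w)%:Z - 1.
  rewrite /c Mn /M !inE eqxx !orbT /= [w == x]eq_sym [w == z]eq_sym.
  have wy : w == neg y = false by apply/eqP => e1; apply: yw; rewrite e1 negK.
  by move/eqP/negPf: xw => ->; move/eqP/negPf: zw => ->; rewrite wy.
have HS : (root x y + root z w) H = (c x - c y + (c z - c w))%:~R.
  by rewrite add_lfunE !HE ?rmorphD //; apply: admT.
have big : 3 <= c x - c y + (c z - c w).
  rewrite cx cy cz cw.
  have one a b : a <> b -> (a == neg a) && (b == neg b) = false.
    by move=> ab; apply/negP => /andP[/eqP ea /eqP eb]; apply: ab; apply: fixed.
  have h1 := one _ _ xy; have h2 := one _ _ xw; have h3 := one _ _ yz; have h4 := one _ _ zw.
  have h5 : (x == neg x) && (z == neg z) = false.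
    apply/negP => /andP[/eqP ex /eqP ez]; apply: xz; rewrite -ez; exact: fixed.
  have h6 : (y == neg y) && (w == neg w) = false.
    apply/negP => /andP[/eqP ey /eqP ew]; apply: yw; rewrite -ew; exact: fixed.
  move: h1 h2 h3 h4 h5 h6.
  by case: (x == neg x); case: (y == neg y); case: (z == neg z); case: (w == neg w).
have small s : -1 <= c s <= 1 by rewrite /c; case: (M s); case: (M (neg s)).
split=> [/DeltaP[a [b [ab e1 _]]]|r0].
  move: HS; rewrite e1 HE ?admT // => /intr_inj e2.
  by move: big; rewrite -e2; have := small a; have := small b; lia.
by move: HS; rewrite r0 zero_lfunE => /esym/eqP; rewrite intr_eq0 => /eqP e2; rewrite e2 in big.
Qed.

(** By [root_cancel] the two roots share an index, and under one of its names the
    second one continues the first. *)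
Lemma root_add x y z w : adm x y -> adm z w ->
  Delta fullv (root x y + root z w) ->
  exists s, (same_pair z w s x /\ adm s y) \/ (same_pair z w y s /\ adm x s).
Proof.
move=> axy azw d; have [lxy lzw] := (admT axy, admT azw).
have key a b c d' : root x y + root z w = root a d' -> lk a b -> lk b d' -> lk a d'.
  by move=> _; apply: lkT.
case: (pselect (x = w)) => [e1|xw].
  subst w; exists z; left; split; first by left.
  apply: (Delta_lk (t := fullv)); first exact: lkT lzw lxy.
  by rewrite -[root z y](subrKA (e x)) addrC in d *.
case: (pselect (y = z)) => [e1|yz].
  subst z; exists w; right; split; first by left.
  apply: (Delta_lk (t := fullv)); first exact: lkT lxy lzw.
  by rewrite -[root x w](subrKA (e y)).
case: (pselect (x = neg z)) => [e1|xz].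
  exists (neg w); left; split; first by right; rewrite negK e1 negK.
  have l1 : lk (neg w) x by rewrite e1 lk_neg lkC.
  apply: (Delta_lk (t := fullv)); first exact: lkT l1 lxy.
  by rewrite -(mirror lzw) -e1 addrC subrKA in d.
case: (pselect (y = neg w)) => [e1|yw].
  exists (neg z); right; split; first by right; rewrite negK e1 negK.
  have l1 : lk y (neg z) by rewrite e1 lk_neg lkC.
  apply: (Delta_lk (t := fullv)); first exact: lkT lxy l1.
  by rewrite -(mirror lzw) -e1 subrKA in d.
by case: (root_cancel axy azw (And4 xw yz xz yw)).
Qed.

Lemma lie_root alpha beta u v : root_space alpha u -> root_space beta v ->
  root_space (h := h) (alpha + beta) (lie u v).
Proof.
move=> ru rv H; rewrite lie_leibniz ru rv lieZl linearZ /= -scalerDl.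
by rewrite add_lfunE.
Qed.

Lemma not_root_space0 alpha v : alpha != 0 -> ~ Delta fullv alpha ->
  root_space alpha v -> v = 0.
Proof.
move=> a0 nd rv; apply: contrapT => /eqP v0; apply: nd.
by split=> //; [exists v|move=> w _; rewrite /= memvf].
Qed.

Definition rootR (t : {vspace g}) x y := adm x y && (E x y \in t).

Lemma rootR_sub t : lie_subalgebra t -> subsystem (rootR t).
Proof.
move=> st.
have hneg x y : rootR t x y -> rootR t (neg y) (neg x).
  case/andP=> a Et; have a' : adm (neg y) (neg x) by rewrite adm_neg.
  rewrite /rootR a' /=; have := rE a'; rewrite mirror ?admT //.
  by case/(line a) => c ->; apply: memvZ.
split=> [x y /andP[]//|x y|x y z /andP[axy Exy] /andP[ayz Eyz] axz].
  by apply/idP/idP => /hneg; rewrite ?negK.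
rewrite /rootR axz /=.
have := lie_root (rE axy) (rE ayz); rewrite subrKA => /(line axz)[c cE].
have c0 : c != 0.
  apply: contraTneq (coord_bracket hX axy ayz axz) => c0.
  by rewrite cE c0 scale0r eqxx.
have := st _ _ Exy Eyz; rewrite cE => /(memvZ c^-1).
by rewrite scalerA mulVf // scale1r.
Qed.

(** Applying [y] minus its eigenvalue for one weight removes this weight from the
    sum; induction on the number of weights. *)
Lemma weight_component (U : {vspace g}) (W : seq wt) (V : wt -> g) gam :
  (forall y v, y \in h -> v \in U -> lie y v \in U) ->
  uniq W -> (forall d, d \in W -> root_space d (V d)) ->
  \sum_(d <- W) V d \in U -> gam \in W -> V gam \in U.
Proof.
move=> Ust; have [m] := ubnP (size W); elim: m W V => // m IH W V szW uW rV sU gW.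
case: (boolP (has (predC1 gam) W)) => [/hasP[d dW /= dg]|/hasPn no]; last first.
  suff <- : \sum_(d <- W) V d = V gam by [].
  rewrite (big_rem gam) //= big_seq big1 ?addr0 // => d.
  rewrite mem_rem_uniq // inE => /andP[dg dW].
  by have := no d dW; rewrite /= dg.
have [H dH] : exists H, d H != gam H.
  apply: contrapT => no; case/eqP: dg; apply/lfunP => H.
  by apply/eqP/negPn/negP => dH; apply: no; exists H.
pose V' (k : wt) : g := (k H - d H : F) *: V k.
have : V' gam \in U.
  apply: (IH (rem d W)).
  - by rewrite size_rem //; move: szW; case: (W) dW => //= ? ? _; rewrite ltnS.
  - exact: rem_uniq.
  - move=> k kW; rewrite /V' => H'; rewrite linearZ /= rV ?(mem_rem kW) //.
    by rewrite !scalerA mulrC.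
  - suff -> : \sum_(k <- rem d W) V' k =
       lie (vsval H) (\sum_(k <- W) V k) - (d H : F) *: \sum_(k <- W) V k.
      by rewrite memvB ?memvZ // Ust ?subvsP.
    rewrite linear_sum /= scaler_sumr -sumrB.
    rewrite [RHS](big_rem d) //= [X in _ = X + _](_ : _ = 0) ?add0r; last first.
      by rewrite rV // subrr.
    rewrite !big_seq; apply: eq_bigr => k kW.
    by rewrite rV ?(mem_rem kW) // /V' scalerBl.
  - by rewrite mem_rem_uniq // inE gW eq_sym dg.
rewrite /V' => /(memvZ (gam H - d H : F)^-1).
by rewrite scalerA mulVf ?scale1r // subr_eq0 eq_sym.
Qed.

Lemma root_components (U : {vspace g}) (s : seq (wt * g)) gam :
  (forall y v, y \in h -> v \in U -> lie y v \in U) ->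
  (forall p, p \in s -> root_space p.1 p.2) ->
  \sum_(p <- s) p.2 \in U -> \sum_(p <- s | p.1 == gam) p.2 \in U.
Proof.
move=> Ust rs sU; case: (boolP (gam \in [seq p.1 | p <- s])) => [gs|/negP gs]; last first.
  rewrite big_seq_cond big1 ?mem0v // => p /andP[ps /eqP pg].
  by case: gs; rewrite -pg map_f.
pose V (k : wt) : g := \sum_(p <- s | p.1 == k) p.2.
apply: (@weight_component U (undup [seq p.1 | p <- s]) V) => //.
- exact: undup_uniq.
- move=> d _ H; rewrite /V linear_sum scaler_sumr /= [LHS]big_seq_cond [RHS]big_seq_cond.
  by apply: eq_bigr => p /andP[ps /eqP <-]; rewrite rs.
- suff <- : \sum_(p <- s) p.2 = \sum_(d <- undup [seq p.1 | p <- s]) V d by [].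
  rewrite /V (exchange_big_dep predT) //= [LHS]big_seq [RHS]big_seq; apply: eq_bigr => p ps.
  rewrite (big_rem p.1) /= ?mem_undup ?map_f // eqxx big_seq_cond big1 ?addr0 //.
  move=> d /andP[]; rewrite mem_rem_uniq ?undup_uniq // inE => /andP[/negPf dp _].
  by rewrite eq_sym dp.
- by rewrite mem_undup.
Qed.

(** * Subalgebras spanned by root spaces *)

Hypothesis hself : self_normalizing h.

Lemma adm_root_neq0 x y : adm x y -> root x y != 0.
Proof. by move=> /and3P[l n _]; apply: root_neq0 n l. Qed.

Lemma root_space0 v : root_space (0 : wt) v -> v \in h.
Proof.
move=> r0; apply: hself => y yh; rewrite lieC memvN.
by have := r0 (Subvs yh); rewrite zero_lfunE scale0r /= => ->; apply: mem0v.
Qed.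

Lemma cartan_root0 y : y \in h -> root_space (0 : wt) y.
Proof. by move=> yh H; rewrite zero_lfunE scale0r abel ?subvsP. Qed.

Lemma lie_span (s s' : seq g) (W : {vspace g}) :
  (forall a b, a \in s -> b \in s' -> lie a b \in W) ->
  forall a b, a \in <<s>>%VS -> b \in <<s'>>%VS -> lie a b \in W.
Proof.
move=> hW a b as_ bs; rewrite (@coord_span _ _ _ (in_tuple s) a as_).
rewrite (@coord_span _ _ _ (in_tuple s') b bs) lie_suml memv_suml // => i _.
rewrite lieZl memvZ // linear_sum memv_suml // => j _.
by rewrite linearZ /= memvZ // hW // mem_nth.
Qed.

Definition hseq T : seq g :=
  vbasis h ++ [seq E p.1 p.2 | p <- enum [pred p | T p.1 p.2]].
Definition hull T : {vspace g} := <<hseq T>>%VS.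

Lemma mem_hseq T v : v \in hseq T ->
  v \in h \/ exists x y, T x y /\ v = E x y.
Proof.
rewrite mem_cat => /orP[/vbasis_mem|/mapP[[x y]]]; first by left.
by rewrite mem_enum inE /= => Txy ->; right; exists x, y.
Qed.

Lemma hull_root T x y : T x y -> E x y \in hull T.
Proof.
move=> Txy; apply/memv_span; rewrite mem_cat; apply/orP; right.
by apply/mapP; exists (x, y); rewrite // mem_enum.
Qed.

Lemma hull_cartan T : (h <= hull T)%VS.
Proof. by rewrite -[h in (h <= _)%VS](span_basis (vbasisP h)) /hull /hseq span_cat addvSl. Qed.

Lemma hull_sub T t : (h <= t)%VS -> (forall x y, T x y -> E x y \in t) -> (hull T <= t)%VS.
Proof.
move=> ht hT; apply/span_subvP => v /mem_hseq[/(subvP ht)//|[x [y [Txy ->]]]].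
exact: hT.
Qed.

Lemma hull_subalgebra T : subsystem T -> lie_subalgebra (hull T).
Proof.
move=> sT; have [Tadm Tneg Ttr] := sT.
have Tp a b z w : same_pair z w a b -> T z w -> T a b.
  by case=> -[-> ->]; rewrite ?Tneg.
move=> a b; apply: lie_span => {}a {}b.
case/mem_hseq=> [ah|[x [y [Txy ->]]]].
  case/mem_hseq=> [bh|[x [y [Txy ->]]]]; first by rewrite abel // mem0v.
  have := rE (Tadm _ _ Txy) (Subvs ah); rewrite /= => ->.
  by rewrite memvZ // hull_root.
case/mem_hseq=> [bh|[z [w [Tzw ->]]]].
  rewrite lieC memvN; have := rE (Tadm _ _ Txy) (Subvs bh); rewrite /= => ->.
  by rewrite memvZ // hull_root.
have [axy azw] := (Tadm _ _ Txy, Tadm _ _ Tzw).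
have rl := lie_root (rE axy) (rE azw).
have [r0|r0] := eqVneq (root x y + root z w) 0.
  by rewrite r0 in rl; apply: (subvP (hull_cartan T)); apply: root_space0.
case: (pselect (Delta fullv (root x y + root z w))) => [d|nd]; last first.
  by rewrite (not_root_space0 r0 nd rl) mem0v.
have [s [[sp a1]|[sp a1]]] := root_add axy azw d.
  have Tsx := Tp _ _ _ _ sp Tzw.
  have e1 : root x y + root z w = root s y.
    rewrite (same_pair_root sp (adm_lk (Tadm _ _ Tsx))) addrC.
    by rewrite subrKA.
  rewrite e1 in rl; have [c ->] := line a1 rl.
  by rewrite memvZ // hull_root // (Ttr _ x).
have Tys := Tp _ _ _ _ sp Tzw.
have e1 : root x y + root z w = root x s.
  by rewrite (same_pair_root sp (adm_lk (Tadm _ _ Tys))) subrKA.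
rewrite e1 in rl; have [c ->] := line a1 rl.
by rewrite memvZ // hull_root // (Ttr _ y).
Qed.

Definition hwt T (p : option (X * X)) : wt := if p is Some q then root q.1 q.2 else 0.

Lemma hseq_root T v : (forall x y, T x y -> adm x y) -> v \in hseq T ->
  exists p, [/\ root_space (hwt T p) v &
    forall q, p = Some q -> T q.1 q.2].
Proof.
move=> Ta /mem_hseq[vh|[x [y [Txy ->]]]].
  by exists None; split=> //; apply: cartan_root0.
exists (Some (x, y)); split=> [|q [<-] //].
exact/rE/Ta.
Qed.

Lemma hull_rootE T x y : subsystem T -> adm x y -> E x y \in hull T -> T x y.
Proof.
move=> sT axy Eh; have [Tadm Tneg _] := sT.
have Th i : (in_tuple (hseq T))`_i \in hseq T \/ (size (hseq T) <= i)%N.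
  by case: (ltnP i (size (hseq T))) => ii; [left; apply: mem_nth|right].
pose n := size (hseq T).
have /choice[k kP] : forall i : 'I_n, exists p,
    root_space (hwt T p) (in_tuple (hseq T))`_i /\ forall q, p = Some q -> T q.1 q.2.
  move=> i; have := @hseq_root T (in_tuple (hseq T))`_i Tadm (mem_nth _ (ltn_ord i)).
  by case=> p [h1 h2]; exists p.
pose s := (root x y, - E x y) ::
  [seq (hwt T (k i), coord (in_tuple (hseq T)) i (E x y) *: (in_tuple (hseq T))`_i) | i <- enum 'I_n].
have s0 : \sum_(p <- s) p.2 = 0.
  rewrite /s big_cons big_map /= big_enum /=.
  by rewrite -(@coord_span _ _ _ (in_tuple (hseq T)) _ Eh) addNr.
have : \sum_(p <- s | p.1 == root x y) p.2 \in (0%VS : {vspace g}).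
  apply: root_components => [y' v _|p|].
  - by rewrite memv0 => /eqP->; rewrite linear0 mem0v.
  - rewrite inE => /predU1P[->|/mapP[i _ ->]] H /=.
      by rewrite linearN /= rE // scalerN.
    by rewrite linearZ /= (kP i).1 !scalerA mulrC.
  - by rewrite s0 mem0v.
rewrite memv0 big_cons /= eqxx big_map /= => /eqP.
case: (pickP (fun i : 'I_n => hwt T (k i) == root x y)) => [i /eqP ki _|no]; last first.
  rewrite big_enum_cond big1 => [/eqP|i /andP[_ /eqP ki]]; last by have := no i; rewrite ki eqxx.
  by rewrite addr0 oppr_eq0 (negPf (E0 axy)).
have [_ kT] := kP i; case: (k i) ki kT => [[a b]|] /= ki kT; last first.
  by have := adm_root_neq0 axy; rewrite -ki eqxx.
have Tab : T a b by apply: (kT (a, b)).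
case: (peq (Tadm _ _ Tab) axy ki) => -[-> ->] //.
by rewrite Tneg.
Qed.

(** The weight components of an element of [t] are in [t], and they are multiples of
    root vectors or lie in [h]. *)
Lemma sub_hull t : lie_subalgebra t -> (h <= t)%VS -> (t <= hull (rootR t))%VS.
Proof.
move=> st ht; apply/subvP => v vt.
have [v0 [c [v0h vE]]] := coord_decomp hX v.
pose s : seq (wt * g) := (0, v0) ::
  [seq (root p.1 p.2, c p.1 p.2 *: E p.1 p.2) | p <- enum [pred p : X * X | adm p.1 p.2]].
have sv : \sum_(p <- s) p.2 = v.
  rewrite vE /s big_cons /= big_map big_enum /=; congr (_ + _).
  by rewrite pair_big_dep.
have rs p : p \in s -> root_space p.1 p.2.
  rewrite inE => /predU1P[->|/mapP[q]]; first exact: cartan_root0.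
  rewrite mem_enum inE => aq -> H /=.
  by rewrite linearZ /= rE // !scalerA mulrC.
have sU gam : \sum_(p <- s | p.1 == gam) p.2 \in t.
  apply: root_components => //; last by rewrite sv.
  by move=> y u yh ut; apply: st => //; apply: subvP ht _ yh.
move: (s) sv rs sU => {}s sv rs sU.
have -> : v = \sum_(d <- undup [seq p.1 | p <- s]) \sum_(p <- s | p.1 == d) p.2.
  rewrite (exchange_big_dep predT) //= -[LHS]sv [LHS]big_seq [RHS]big_seq.
  apply: eq_bigr => p ps.
  rewrite (big_rem p.1) /= ?mem_undup ?map_f // eqxx big_seq_cond big1 ?addr0 //.
  move=> d /andP[]; rewrite mem_rem_uniq ?undup_uniq // inE => /andP[/negPf dp _].
  by rewrite eq_sym dp.
apply: memv_suml => d _; have := sU d; set u := \sum_(p <- s | _) _ => ut.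
have ru : root_space d u.
  move=> H; rewrite /u linear_sum scaler_sumr /= [LHS]big_seq_cond [RHS]big_seq_cond.
  by apply: eq_bigr => p /andP[ps /eqP <-]; rewrite rs.
have [d0|d0] := eqVneq d 0.
  by rewrite d0 in ru; apply: (subvP (hull_cartan _)); apply: root_space0.
have [->|u0] := eqVneq u 0; first exact: mem0v.
have [x [y [axy dE]]] := coord_all hX d0 ru u0.
rewrite dE in ru; have [k uE] := line axy ru; rewrite uE; apply/memvZ/hull_root.
rewrite /rootR axy /=; have k0 : k != 0.
  by apply: contraNneq u0 => k0; rewrite uE k0 scale0r.
by move: ut; rewrite uE => /(memvZ k^-1); rewrite scalerA mulVf // scale1r.
Qed.

(** * Borel subalgebras *)

Section Positive.
Variable psi : X -> int.
Hypothesis psiN : forall x, psi (neg x) = - psi x.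
Definition posR x y := adm x y && (psi y < psi x).

Lemma posR_sub : subsystem posR.
Proof.
split=> [x y /andP[]//|x y|x y z /andP[_ xy] /andP[_ yz] a].
  by rewrite /posR adm_neg // !psiN ltrN2.
by rewrite /posR a (lt_trans yz xy).
Qed.

Definition level k : {vspace g} :=
  <<[seq E p.1 p.2 | p <- enum [pred p : X * X |
     adm p.1 p.2 && (k%:Z <= psi p.1 - psi p.2)%R]]>>%VS.

Lemma mem_level k x y : adm x y -> k%:Z <= psi x - psi y -> E x y \in level k.
Proof.
move=> a l; apply/memv_span/mapP; exists (x, y) => //.
by rewrite mem_enum inE /= a.
Qed.

Lemma level_seq k v : v \in [seq E p.1 p.2 | p <- enum [pred p : X * X |
     adm p.1 p.2 && (k%:Z <= psi p.1 - psi p.2)%R]] ->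
  exists x y, [/\ adm x y, k%:Z <= psi x - psi y & v = E x y].
Proof.
by case/mapP=> -[x y]; rewrite mem_enum inE /= => /andP[a l] ->; exists x, y.
Qed.

Lemma lie_level x y z w k : adm x y -> adm z w -> 0 < k%:Z ->
  k%:Z <= psi x - psi y + (psi z - psi w) -> lie (E x y) (E z w) \in level k.
Proof.
move=> axy azw k0 le; have rl := lie_root (rE axy) (rE azw).
have [H HE] := sep psiN.
have HS : (root x y + root z w) H = (psi x - psi y + (psi z - psi w))%:~R.
  by rewrite add_lfunE !HE ?rmorphD // (adm_lk axy, adm_lk azw).
have r0 : root x y + root z w != 0.
  apply/eqP => r0; move: HS; rewrite r0 zero_lfunE => /esym/eqP.
  rewrite intr_eq0 => /eqP e0; move: le; rewrite e0 => le.
  by move: (lt_le_trans k0 le); rewrite ltxx.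
have [->|l0] := eqVneq (lie (E x y) (E z w)) 0; first exact: mem0v.
have [u [v [auv e1]]] := coord_all hX r0 rl l0.
rewrite e1 in rl; have [c ->] := line auv rl; apply/memvZ/mem_level => //.
by move: HS; rewrite e1 HE ?(adm_lk auv) // => /intr_inj ->.
Qed.

(** Brackets add the heights for [psi], so that the derived series goes up through
    the levels, which vanish eventually. *)
Lemma hull_solvable : lie_solvable (hull posR).
Proof.
pose D (V : {vspace g}) := lieprod V V.
have it k : (iter k.+1 D (hull posR) <= level k.+1)%VS.
  elim: k => [|k IH].
    rewrite /=; apply: lieprod_sub; apply: lie_span => a b.
    case/mem_hseq=> [ah|[x [y [/andP[axy pxy] ->]]]];
      case/mem_hseq=> [bh|[z [w [/andP[azw pzw] ->]]]].
    - by rewrite (coord_abelian hX) // mem0v.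
    - have := rE azw (Subvs ah); rewrite /= => ->; apply/memvZ/mem_level => //.
      by rewrite -subr_gt0 in pzw; lia.
    - rewrite lieC memvN; have := rE axy (Subvs bh); rewrite /= => ->.
      by apply/memvZ/mem_level => //; rewrite -subr_gt0 in pxy; lia.
    - by apply: lie_level => //; lia.
  rewrite iterS; apply: (subv_trans (_ : _ <= D (level k.+1)))%VS.
    apply: lieprod_sub => u v uI vI; apply: mem_lieprod; exact: subvP IH _ _.
  apply: lieprod_sub; apply: lie_span => a b.
  case/level_seq=> [x [y [axy pxy ->]]]; case/level_seq=> [z [w [azw pzw ->]]].
  by apply: lie_level => //; lia.
pose M := \max_(p : X * X) `|psi p.1 - psi p.2|%N.
exists M.+1; apply/eqP; rewrite -subv0; apply: subv_trans (it M) _.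
apply/span_subvP => v /level_seq[x [y [_ le _]]].
have := leq_bigmax (F := fun p : X * X => `|psi p.1 - psi p.2|%N) (x, y).
by rewrite -/M /=; lia.
Qed.

End Positive.

(** The vectors [E x y], [E y x] and their bracket stay in all the derived
    algebras. *)
Lemma sl2_not_solvable t x y : lie_subalgebra t -> lie_solvable t -> adm x y ->
  E x y \in t -> E y x \in t -> False.
Proof.
move=> st [k hk] axy Et E't; have ayx : adm y x by rewrite admC.
pose H := lie (E x y) (E y x).
have Hh : H \in h.
  have := lie_root (rE axy) (rE ayx); rewrite addrC subrKA subrr.
  exact: root_space0.
pose a : F := root x y (Subvs Hh).
have HE : lie H (E x y) = a *: E x y by apply: (rE axy (Subvs Hh)).
have HE' : lie H (E y x) = - a *: E y x.
  by have := rE ayx (Subvs Hh); rewrite -[root y x]opprB opp_lfunE.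
have a0 : a != 0.
  by apply: contraTneq (coord_sl2 hX axy) => a0; rewrite -/H HE a0 scale0r eqxx.
have ind (V : {vspace g}) : E x y \in V -> E y x \in V -> H \in V ->
    [/\ E x y \in lieprod V V, E y x \in lieprod V V & H \in lieprod V V].
  move=> EV E'V HV; split; last exact: mem_lieprod.
    have : lie H (E x y) \in lieprod V V by apply: mem_lieprod.
    by rewrite HE => /(memvZ a^-1); rewrite scalerA mulVf // scale1r.
  have : lie H (E y x) \in lieprod V V by apply: mem_lieprod.
  by rewrite HE' => /(memvZ (- a)^-1); rewrite scalerA mulVf ?oppr_eq0 // scale1r.
have all_in : [/\ E x y \in iter k (fun V => lieprod V V) t,
    E y x \in iter k (fun V => lieprod V V) t & H \in iter k (fun V => lieprod V V) t].
  elim: {hk} k => [|k [h1 h2 h3]]; first by split=> //; apply: st.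
  by rewrite iterS; apply: ind.
case: all_in; rewrite hk memv0 => /eqP Exy0 _ _.
by have := E0 axy; rewrite Exy0 eqxx.
Qed.

(** An antisymmetric injective function of the indices; it breaks the ties in
    [borel_total]. *)
Definition tie x : int :=
  if x == neg x then 0 else
  if (enum_rank x < enum_rank (neg x))%N then (enum_rank x).+1%:Z
  else - (enum_rank (neg x)).+1%:Z.

Lemma tieN x : tie (neg x) = - tie x.
Proof.
rewrite /tie negK eq_sym; case: eqP => // nx.
have : enum_rank x != enum_rank (neg x) :> nat.
  by apply/eqP => /val_inj/enum_rank_inj.
by case: (ltngtP (enum_rank x) (enum_rank (neg x))) => //; rewrite ?opprK.
Qed.

Lemma tie_inj : injective tie.
Proof.
have key x y : tie x = tie y -> 0 < tie x -> x = y.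
  rewrite /tie; case: eqP => // _; case: ifP => // _; case: eqP => // _; case: ifP => // _.
  by move=> [/val_inj/enum_rank_inj].
move=> x y; case: (ltgtP (tie x) 0) => [x0|x0|x0] e1.
- apply: (can_inj negK); apply: key; first by rewrite !tieN e1.
  by rewrite tieN oppr_gt0.
- exact: key e1 x0.
- have fx z : tie z = 0 -> z = neg z.
    by rewrite /tie; case: eqP => // _; case: ifP.
  have ex := fx _ x0; have ey := fx y (esym (etrans (esym x0) e1)).
  by apply: (coord_fixed hX).
Qed.

Lemma tie_bound x : `|tie x| <= #|X|%:Z.
Proof.
rewrite /tie; case: ifP => _; first by rewrite normr0.
case: ifP => _; rewrite ?normrN ger0_norm // lez_nat; exact: ltn_ord.
Qed.

Section Given.
Variable b : {vspace g}.
Hypotheses (hb : (h <= b)%VS) (bB : borel_subalgebra b).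
Local Notation B := (rootR b).

Lemma borel_sub : subsystem B.
Proof. by case: bB => sb _ _; apply: rootR_sub sb. Qed.

Lemma borel_anti x y : B x y -> ~~ B y x.
Proof.
move=> /andP[axy Exy]; apply/negP => /andP[ayx Eyx].
by case: bB => sb solb _; apply: sl2_not_solvable sb solb axy Exy Eyx.
Qed.

(** The order of [b] is refined to a function [psi] without ties. The root spaces
    that are positive for [psi] span with [h] a solvable subalgebra containing [b],
    which is [b] by maximality. *)
Lemma borel_total x y : adm x y -> B x y || B y x.
Proof.
(* [M] exceeds every difference of values of [tie], so that [psi] compares first
   by [d] *)
pose M : int := (2 * #|X| + 1)%N.
pose d z : int := (rank neg B z)%:Z - (rank neg B (neg z))%:Z.
pose psi z : int := d z * M + tie z.
have dN z : d (neg z) = - d z by rewrite /d negK opprB.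
have psiN z : psi (neg z) = - psi z by rewrite /psi dN tieN mulNr opprD.
have tb u v : tie u - tie v < M.
  by have := tie_bound u; have := tie_bound v; rewrite /M; lia.
have dpsi u v : d v < d u -> psi v < psi u.
  move=> duv; have h1 : d v + 1 <= d u by lia.
  have h2 := tb v u; have M0 : 0 < M by rewrite /M; lia.
  have : (d v + 1) * M <= d u * M by rewrite ler_pM2r.
  by rewrite mulrDl mul1r /psi; lia.
have Bpsi u v : B u v -> psi v < psi u.
  move=> Buv; apply: dpsi.
  have lt1 := elt_rank negK lkC lkT borel_sub borel_anti (eltW neg Buv).
  have Bn : B (neg v) (neg u) by case: borel_sub => _ -> _.
  have lt2 := elt_rank negK lkC lkT borel_sub borel_anti (eltW neg Bn).
  by move: lt1 lt2; rewrite /d; lia.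
have [sb solb maxb] := bB.
have sp := posR_sub psiN; have solp := hull_solvable psiN.
have bp : (b <= hull (posR psi))%VS.
  apply: subv_trans (sub_hull sb hb) _; apply: hull_sub.
    exact: hull_cartan.
  move=> u v Buv; apply: hull_root; rewrite /posR Bpsi // andbT.
  by case/andP: Buv.
have eb := maxb _ (hull_subalgebra sp) solp bp.
move=> axy; have ayx : adm y x by rewrite admC.
have hull_b u v : adm u v -> psi v < psi u -> B u v.
  by move=> a p; rewrite /rootR a -eb hull_root // /posR a.
case: (ltgtP (psi x) (psi y)) => [lt|lt|e1].
- by rewrite (hull_b y x) ?orbT.
- by rewrite (hull_b x y).
exfalso; case: (ltgtP (d x) (d y)) => [lt|lt|ed].
- by have := dpsi _ _ lt; rewrite e1 ltxx.
- by have := dpsi _ _ lt; rewrite e1 ltxx.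
move: e1; rewrite /psi ed => /addrI/tie_inj e1.
by case: (adm_neq axy).
Qed.

End Given.

(** * From the cone condition to cycles *)

Variables (l b : {vspace g}).
Hypotheses (hl : root_subalgebra h l) (hb : (h <= b)%VS)
  (bB : borel_subalgebra b) (nb : (part_n h l `<=` [set` b])%classic).
Local Notation L := (rootR l).
Local Notation B := (rootR b).
Local Notation K := (symR L).
Local Notation N := (nilR L).
Local Notation sing := (sing neg lk lng L B).
Local Notation sing2 := (sing2 neg lk lng L B).
Local Notation solution := (solution neg lk lng L B).
Local Notation "x ~< y" := (elt neg N x y) (at level 70, no associativity).

Let sL : subsystem L. Proof. by apply: rootR_sub; case: hl. Qed.
Let sB : subsystem B := borel_sub bB.

Lemma L_adm x y : L x y -> adm x y. Proof. by case/andP. Qed.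

Lemma nil_adm x y : N x y -> adm x y. Proof. by case/andP => /L_adm. Qed.

Lemma Delta_L x y : adm x y -> Delta l (root x y) <-> L x y.
Proof. by move=> a; rewrite (DeltaE) // /rootR a. Qed.

Lemma Delta_kE x y : adm x y -> Delta_k l (root x y) <-> K x y.
Proof.
move=> a; have a' : adm y x by rewrite admC.
rewrite /Delta_k /= opprB /symR.
split=> [[/(Delta_L a)-> /(Delta_L a')->] //|/andP[h1 h2]].
by split; [apply/Delta_L|apply/Delta_L].
Qed.

Lemma Delta_nE x y : adm x y -> Delta_n l (root x y) <-> N x y.
Proof.
move=> a; rewrite /Delta_n /setD /= /nilR; split.
  case=> /(Delta_L a) h1 h2; rewrite h1; apply/negP => h3; apply: h2.
  by apply/(Delta_kE a); rewrite /symR h1.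
case/andP=> h1 /negP h2; split; first exact/Delta_L.
by move/(Delta_kE a) => /andP[].
Qed.

Lemma Delta_nP alpha : Delta_n l alpha -> exists x y, N x y /\ alpha = root x y.
Proof.
move=> d; have [x [y [a e1 _]]] := DeltaP d.1.
by exists x, y; split=> //; apply/(Delta_nE a); rewrite -e1.
Qed.

Lemma N_borel x y : N x y -> B x y.
Proof.
move=> n; have a := nil_adm n; rewrite /rootR a; apply: nb.
exists [:: E x y]; last exact: memv_span (mem_head _ _).
move=> v /=; rewrite inE => /eqP->; exists (root x y); last exact: rE.
by apply/Delta_nE.
Qed.

Lemma K_borel x y : K x y -> B x y || B y x.
Proof. by move=> /andP[/L_adm a _]; apply: (borel_total hb bB a). Qed.

Lemma same_pairN z w a c R : subsystem R -> same_pair z w a c -> R z w -> R a c.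
Proof. by move=> [_ Rn _] [] [-> ->]; rewrite ?Rn. Qed.

Lemma subK : subsystem K.
Proof.
split=> [x y /andP[/L_adm]//|x y|x y z].
  exact: (K_neg sL).
move=> h1 h2 a; apply: (K_trans negK lkC sL h1 h2 a).
Qed.

Lemma subN : subsystem N. Proof. exact (subsystemN negK lkC sL). Qed.

Lemma Sing_sing alpha : Sing fullv l b alpha -> exists x y, sing x y /\ alpha = root x y.
Proof.
case=> -[d nd] hs; have [x [y [a e1 _]]] := DeltaP d; exists x, y; split=> //.
subst alpha; have full z w : adm z w -> Delta fullv (root z w).
  by move=> azw; apply/(DeltaE _ azw); rewrite memvf.
apply: sing_intro => //.
- by apply/negP => /(Delta_L a).
- move=> z k bz azy; have azx : adm z x by case: subK => + _ _; apply.
  apply: (hs (root z x)).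
  + by apply/(DeltaE _ azx); case/andP: bz.
  + exact/Delta_kE.
  + by rewrite addrC subrKA; apply: full.
- move=> z k bz axz; have ayz : adm y z by case: subK => + _ _; apply.
  apply: (hs (root y z)).
  + by apply/(DeltaE _ ayz); case/andP: bz.
  + exact/Delta_kE.
  + by rewrite subrKA; apply: full.
Qed.

(** If no arrows lead from [b0] to [a0], the indicator function [C] of the indices
    reachable from [b0] gives a linear form that contradicts the relation. Each root
    contributes the right sign because both of its names are arrows. *)
Lemma cone_solution : ~ cone_condition h fullv l b -> solution.
Proof.
move=> hn; apply: contrapT => no; apply: hn.
have zero I : coneQ I (0 : wt) by exists [::]; split=> //; rewrite big_nil.
apply/seteqP; split=> [omega|omega /= ->]; last by split; apply: zero.
case=> -[s [sP es]] [r [rP er]]; apply: contrapT => /= omega0.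
have [p0 [p0s q0]] : exists p, p \in s /\ p.1 != 0.
  apply: contrapT => none; apply: omega0; rewrite es big_seq big1 // => p ps.
  have [->|q0] := eqVneq p.1 0; first by rewrite rmorph0 scale0r.
  by case: none; exists p.
have [b0 [a0 [nba e0]]] := Delta_nP (sP _ p0s).2.
pose C z := connect (fun x y => sing x y || nilR L y x) b0 z.
have Ca : C a0 = false.
  apply/negP => ca; apply: no; apply: solutionP nba ca => //.
  - exact: (borel_anti bB).
  - exact: N_borel.
  - exact: K_borel.
have Cb : C b0 by exact: connect0.
have Cs x y : sing x y -> C x -> C y.
  by move=> sxy cx; apply: connect_trans cx (connect1 _); rewrite sxy.
have Cn x y : N x y -> C y -> C x.
  by move=> nxy cy; apply: connect_trans cy (connect1 _); rewrite nxy orbT.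
pose c z : int := (C z)%:Z - (C (neg z))%:Z.
have cN z : c (neg z) = - c z by rewrite /c negK opprB.
have [H HE] := sep cN.
have Hs x y : sing x y -> root x y H <= 0.
  move=> sxy; rewrite HE ?(adm_lk (sing_adm sxy)) // lerz0 /c.
  have := Cs _ _ sxy; have := Cs _ _ (sing_neg negK lkC lk_neg sL sB sxy).
  by case: (C x); case: (C y); case: (C (neg x)); case: (C (neg y)) => // h1 h2;
    first [by have := h1 isT | by have := h2 isT].
have Hn x y : N x y -> 0 <= root x y H.
  move=> nxy; rewrite HE ?(adm_lk (nil_adm nxy)) // ler0z /c.
  have nxy' : N (neg y) (neg x) by case: subN => _ -> _.
  have := Cn _ _ nxy; have := Cn _ _ nxy'.
  by case: (C x); case: (C y); case: (C (neg x)); case: (C (neg y)) => // h1 h2;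
    first [by have := h1 isT | by have := h2 isT].
have H1 : 0 < root b0 a0 H.
  rewrite HE ?(adm_lk (nil_adm nba)) // ltr0z /c Ca Cb.
  have nxy' : N (neg a0) (neg b0) by case: subN => _ -> _.
  have := Cn _ _ nxy'.
  by case: (C (neg a0)); case: (C (neg b0)) => // /(_ isT).
have sumE (u : seq (rat * wt)) : (\sum_(p <- u) (ratr p.1 : F) *: p.2) H =
    \sum_(p <- u) (ratr p.1 : F) * (p.2 H : F) :> F.
  by rewrite sum_lfunE; apply: eq_bigr => p _; rewrite scale_lfunE.
have le0 : omega H <= 0 :> F.
  rewrite er sumE big_seq; apply: sumr_le0 => p /rP[q1 /Sing_sing[x [y [sxy ->]]]].
  by rewrite mulr_ge0_le0 ?ler0q // Hs.
have ge0 p : p \in s -> 0 <= (ratr p.1 : F) * (p.2 H : F).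
  by move=> /sP[q1 /Delta_nP[x [y [nxy ->]]]]; rewrite mulr_ge0 ?ler0q // Hn.
have : 0 < omega H :> F.
  rewrite es sumE (big_rem p0) //= ltr_pwDl //; last first.
    by rewrite big_seq; apply: sumr_ge0 => p /mem_rem; apply: ge0.
  rewrite e0 mulr_gt0 // ltr0q lt_neqAle eq_sym q0.
  by case: (sP _ p0s).
by move=> /lt_le_trans/(_ le0); rewrite ltxx.
Qed.

(** * Strictly infinite weights from pairs of indices *)

Section Ambient.
Variable t : {vspace g}.
Hypotheses (st : lie_subalgebra t) (ht : (h <= t)%VS)
  (Kt : forall x y, K x y -> E x y \in t).
Local Notation T := (rootR t).

Let sT : subsystem T := rootR_sub st.

Lemma Delta_n_cap x y : N x y -> T x y -> Delta_n (l :&: t)%VS (root x y).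
Proof.
move=> n /andP[a Et]; have a' : adm y x by rewrite admC.
have [n1 n2] := andP n.
have lE : E x y \in l by case/andP: n1.
split; first by apply/(DeltaE _ a); rewrite memv_cap lE.
case=> _; rewrite opprB => /(DeltaE _ a'); rewrite memv_cap => /andP[lE' _].
by case/negP: n2; rewrite /rootR a'.
Qed.

(** Since [k] is contained in [t], a root of [l] in [t] whose opposite lies in [l]
    has this opposite in [t]. *)
Lemma Delta_n_capP beta : Delta_n (l :&: t)%VS beta ->
  exists x y, [/\ N x y, T x y & beta = root x y].
Proof.
case=> d nd; have [x [y [a e1]]] := DeltaP d.
rewrite memv_cap => /andP[lE tE]; exists x, y; rewrite /rootR a; split=> //.
rewrite /nilR /rootR a lE /=; apply/negP => /andP[a' lE']; apply: nd; split=> //.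
rewrite e1 opprB; apply/(DeltaE _ a'); rewrite memv_cap lE'.
by apply: Kt; rewrite /symR /rootR a a' lE lE'.
Qed.

Lemma Sing_cap x y : sing x y -> T x y ->
  Sing t (l :&: t)%VS (b :&: t)%VS (root x y).
Proof.
move=> s Txy; have a := sing_adm s; split.
  split; first by apply/(DeltaE _ a); case/andP: Txy.
  move/(DeltaE _ a); rewrite memv_cap => /andP[lE _].
  by apply: (sing_L s); rewrite /rootR a.
move=> delta /(DeltaP)[z [w [azw -> ]]]; rewrite memv_cap => /andP[bE _].
case=> /(DeltaE _ azw); rewrite memv_cap => /andP[lE _].
have awz : adm w z by rewrite admC.
rewrite opprB => /(DeltaE _ awz); rewrite memv_cap => /andP[lE' _].
have k : K z w by rewrite /symR /rootR azw awz lE lE'.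
have bzw : B z w by rewrite /rootR azw.
move/Delta_full/(root_add a azw) => [v [[sp av]|[sp av]]].
  apply: (sing_l s _ _ av); first exact: same_pairN (subK) sp k.
  exact: same_pairN sB sp bzw.
apply: (sing_r s _ _ av); first exact: same_pairN (subK) sp k.
exact: same_pairN sB sp bzw.
Qed.

(** A nonzero bracket of the two root vectors is a root vector whose root is composed
    of [(x, y)] and of a pair in [N] next to it, hence lies in [n] by two-sidedness.
    The composition stays in [t], which is a subalgebra. *)
Lemma sing2_part_n x y u v : sing2 x y -> T x y -> root_space (root x y) u ->
  part_n h (l :&: t)%VS v -> part_n h (l :&: t)%VS (lie u v).
Proof.
move=> s Txy ru [vs hvs vin]; have axy := sing_adm (sing2_sing s).
exists [seq lie u w | w <- vs]; last first.
  rewrite (@coord_span _ _ _ (in_tuple vs) v vin) linear_sum memv_suml // => i _.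
  by rewrite linearZ memvZ // memv_span // map_f // mem_nth.
move=> _ /= /mapP[w /hvs[beta nbeta rw] ->].
have [l0|l0] := eqVneq (lie u w) 0.
  by exists beta => //; rewrite l0 => H; rewrite linear0 scaler0.
have [z [z' [n Tz eb]]] := Delta_n_capP nbeta; subst beta.
have azz := nil_adm n; have rl := lie_root ru rw.
have r0 : root x y + root z z' != 0.
  apply/eqP => r0; have e1 : root y x = root z z'.
    by apply/esym/eqP; rewrite -[root y x]opprB -addr_eq0 addrC r0.
  have ayx : adm y x by rewrite admC.
  case: (sing2_N s); case: (peq ayx azz e1) => -[ez ez']; subst z z' => //.
  by case: (subN) n => _ ->.
case: (pselect (Delta fullv (root x y + root z z'))) => [d|nd]; last first.
  by case/eqP: l0; apply: (not_root_space0 r0 nd rl).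
have [_ _ Tt] := sT.
have [k [[sp ak]|[sp ak]]] := root_add axy azz d.
- have Nk := same_pairN (subN) sp n; have Tk := same_pairN sT sp Tz.
  have e1 : root x y + root z z' = root k y.
    rewrite (same_pair_root sp (adm_lk (nil_adm Nk))) addrC.
    by rewrite subrKA.
  exists (root k y); last by rewrite -e1.
  by apply: Delta_n_cap; [apply: sing2_l s Nk ak|apply: Tt Tk Txy ak].
- have Nk := same_pairN (subN) sp n; have Tk := same_pairN sT sp Tz.
  have e1 : root x y + root z z' = root x k.
    by rewrite (same_pair_root sp (adm_lk (nil_adm Nk))) subrKA.
  exists (root x k); last by rewrite -e1.
  by apply: Delta_n_cap; [apply: sing2_r s Nk ak|apply: Tt Txy Tk ak].
Qed.

Local Notation term := (nat * (X * X))%type.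
Implicit Types s : seq term.
Definition weight s : wt := \sum_(p <- s) root p.2.1 p.2.2 *+ p.1.
Definition nterm (p : term) := [&& (0 < p.1)%N, N p.2.1 p.2.2 & T p.2.1 p.2.2].
(** Both orders are required: [t] may contain a root without its opposite, so that
    the difference of the two roots has to be excluded with both signs. *)
Definition orthogonal_terms (p q : term) :=
  `[< strongly_orthogonal t (root p.2.1 p.2.2) (root q.2.1 q.2.2) /\
      strongly_orthogonal t (root q.2.1 q.2.2) (root p.2.1 p.2.2) >].

Lemma orthogonal_termsP k x y k' z w :
  reflect (strongly_orthogonal t (root x y) (root z w) /\
           strongly_orthogonal t (root z w) (root x y))
          (orthogonal_terms (k, (x, y)) (k', (z, w))).
Proof. exact: asboolP. Qed.

(** The difference of the ranks of [x] and of [neg x] for the order of [n] gives a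
    linear form which is positive on the roots of [n]. *)
Lemma weight_neq0 s : s != [::] -> all nterm s -> weight s <> 0.
Proof.
pose c x : int := (rank neg N x)%:Z - (rank neg N (neg x))%:Z.
have cN x : c (neg x) = - c x by rewrite /c negK opprB.
have [H HE] := sep cN.
have pos (p : term) : nterm p -> 0 < (root p.2.1 p.2.2 *+ p.1 : wt) H :> F.
  case: p => k [x y] /and3P[/= k0 n _].
  have -> : (root x y *+ k : wt) H = (root x y H : F) *+ k.
    rewrite -scaler_nat scale_lfunE.
    exact: mulr_natl.
  rewrite pmulrn_lgt0 // HE ?(adm_lk (nil_adm n)) // ltr0z /c.
  have [sN N_a] := (subN, @N_anti X L).
  have h1 := elt_rank negK lkC lkT sN N_a (eltW neg n).
  have n' : N (neg y) (neg x) by case: sN => _ -> _.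
  have h2 := elt_rank negK lkC lkT sN N_a (eltW neg n').
  by move: h1 h2; lia.
case: s => // p s _ /= /andP[np ns] w0.
have : 0 < (weight (p :: s)) H :> F.
  rewrite /weight big_cons add_lfunE ltr_pwDl ?pos // sum_lfunE.
  rewrite big_seq; apply: sumr_ge0 => q qs; apply: ltW; apply: pos.
  exact: (allP ns).
by rewrite w0 zero_lfunE ltxx.
Qed.

Lemma strictly_infiniteP x y u v s : sing2 x y -> sing2 u v -> T x y -> T u v ->
  s != [::] -> all nterm s -> pairwise orthogonal_terms s ->
  weight s = root x y + root u v ->
  strictly_infinite t (l :&: t)%VS (b :&: t)%VS (root x y + root u v).
Proof.
move=> s1 s2 t1 t2 s0 ns so ws; have w0 := weight_neq0 s0 ns.
pose al (i : 'I_2) : wt := if i == ord0 then root x y else root u v.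
pose p0 : term := (0%N, (x, x)).
pose c (i : 'I_(size s)) := (nth p0 s i).1.
pose be (i : 'I_(size s)) : wt := root (nth p0 s i).2.1 (nth p0 s i).2.2.
have nsi (i : 'I_(size s)) : nterm (nth p0 s i) by apply: (allP ns); rewrite mem_nth.
have eW : root x y + root u v = \sum_i be i *+ c i.
  by rewrite -ws /weight (big_nth p0) big_mkord.
have nW i : (0 < c i)%N /\ Delta_n (l :&: t)%VS (be i).
  by have /and3P[-> n Ti] := nsi i; split=> //; apply: Delta_n_cap.
split.
  exists 2, (fun=> 1%N), al, (size s), c, be; split; last first.
    move=> i x' y'; rewrite /al; case: ifP => _; exact: sing2_part_n.
  split=> //; first by rewrite -ws.
  - by rewrite !big_ord_recl big_ord0 addr0 !mulr1n.
  - move=> i; split=> //; rewrite /al; case: ifP => _; apply: Sing_cap => //; exact: sing2_sing.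
exists (size s), c, be; split=> // i j ij.
have /pairwiseP := so; move/(_ p0) => h1.
case: (ltngtP i j) => [lt|lt|/val_inj e1].
- by have /asboolP[] := h1 i j (ltn_ord i) (ltn_ord j) lt.
- by have /asboolP[] := h1 j i (ltn_ord j) (ltn_ord i) lt.
- by rewrite e1 eqxx in ij.
Qed.

End Ambient.

Let N_a := @N_anti X L.
Let ltT y x z : x ~< y -> y ~< z -> x ~< z. Proof. exact: (elt_trans negK lkC lkT subN N_a). Qed.
Let ltI x : x ~< x -> False. Proof. by rewrite (elt_irr subN N_a). Qed.
Let ltN x y : (neg y ~< neg x) = (x ~< y). Proof. exact: (elt_neg negK subN). Qed.
Let lt_lk x y : x ~< y -> lk x y. Proof. exact: (elt_lk lkT subN). Qed.
Let NN x y : N (neg y) (neg x) = N x y. Proof. by case: subN => _ + _; apply. Qed.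
Let NW x y : N x y -> x ~< y. Proof. exact: eltW. Qed.
Let no_sing2 x y : x ~< y -> sing2 x y -> False. Proof. exact: (lt_sing2 negK lkC sL). Qed.
Let Kadm x y : K x y -> adm x y. Proof. by case: subK => + _ _; apply. Qed.
Let KK x y : K (neg y) (neg x) = K x y. Proof. by case: subK => _ + _; apply. Qed.

Local Notation term := (nat * (X * X))%type.
Implicit Types s d : seq term.

Lemma lt_long x y : lng -> x ~< y -> N x y.
Proof.
move=> lg xy; apply: (elt_adm subN xy).
case: (linkP neg lng (lt_lk xy)) => // [e1|]; last by rewrite lg.
by case: (@ltI x); rewrite {2}e1.
Qed.

(** * Strongly orthogonal decompositions *)

Section Full.
Local Notation nterm := (nterm fullv).
Local Notation orthogonal_terms := (orthogonal_terms fullv).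

Lemma ntermE k x y : nterm (k, (x, y)) = (0 < k)%N && N x y.
Proof.
rewrite /nterm /=; case: (ltnP 0 k) => // _; case: (boolP (N x y)) => //= n.
by rewrite /rootR memvf (nil_adm n).
Qed.

(** The indices that may occur in a decomposition of [e x - e v]. *)
Definition between x v : pred X := fun z =>
  [|| z == x, z == neg x, z == v, z == neg v |
      [&& x ~< z, z ~< v, x ~< neg z & neg z ~< v]].

Lemma orthogonal_indep (p q : term) : nterm p -> nterm q ->
  (forall z w, z \in [:: p.2.1; p.2.2] -> w \in [:: q.2.1; q.2.2] -> z <> w /\ z <> neg w) ->
  orthogonal_terms p q.
Proof.
case: p q => [k [x y]] [k' [z w]]; rewrite !ntermE /= => /andP[_ n] /andP[_ n'] ne.
have [a a'] := (nil_adm n, nil_adm n'); have [a1 a1'] : adm y x /\ adm w z by rewrite !(adm_sym y) (adm_sym w).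
have [||xz xnz] := ne x z; rewrite ?inE ?eqxx //.
have [||xw xnw] := ne x w; rewrite ?inE ?eqxx ?orbT //.
have [||yz ynz] := ne y z; rewrite ?inE ?eqxx ?orbT //.
have [||yw ynw] := ne y w; rewrite ?inE ?eqxx ?orbT //.
have nC u v : u <> neg v -> v <> neg u by move=> h1 h2; apply: h1; rewrite h2 negK.
have [p1 p2] := root_cancel a a' (And4 xw yz xnz ynw).
have [p3 p4] := root_cancel a a1' (And4 xz yw xnw ynz).
have [p5 p6] := root_cancel a' a1 (And4 (nesym xz) (nesym yw) (nC _ _ ynz) (nC _ _ xnw)).
have dE i j k1 k2 : root i j - root k1 k2 = root i j + root k2 k1 by rewrite opprB.
by split; split; rewrite ?dE // addrC.
Qed.

(** When [e x - e v] is not a root, [v = neg x] and there is [w] with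
    [x ~< w ~< neg x]. The roots [e x - e w] and [e w - e (neg x)] have sum
    [e x - e (neg x)] and difference [e (neg w) - e w], neither of which is a root.
    The two roots coincide if [w = neg w]. *)
Lemma decompose x v : x ~< v -> exists d,
  [/\ d != [::], all nterm d, pairwise orthogonal_terms d, weight d = root x v &
      all (fun p => between x v p.2.1 && between x v p.2.2) d].
Proof.
move=> xv; have lxv := lt_lk xv; case: (boolP (N x v)) => [n|nn].
  exists [:: (1%N, (x, v))]; split; rewrite // /weight ?big_cons ?big_nil /=.
  - by rewrite ntermE n.
  - by rewrite addr0.
  - by rewrite /between !eqxx !orbT.
have nl : ~~ lng by apply: contra nn => lg; apply: lt_long.
case/orP: (xv) => [n|/andP[/eqP ev /existsP[w /andP[xw wx]]]]; first by rewrite n in nn.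
subst v; have [axw awx] := (nil_adm xw, nil_adm wx).
have bw : between x (neg x) w.
  have l3 : x ~< neg w by rewrite -ltN negK NW.
  by rewrite /between l3 ltN (NW xw) (NW wx) !orbT.
have bx : between x (neg x) x by rewrite /between eqxx.
have bnx : between x (neg x) (neg x) by rewrite /between eqxx orbT.
have noadm z : adm z (neg z) = false by rewrite /adm (negPf nl) negK eqxx !andbF.
have xnx : x <> neg x by move=> e1; apply: (@ltI x); rewrite {2}e1.
have [ew|nw] := eqVneq w (neg w).
  exists [:: (2%N, (x, w))]; split; rewrite // /weight ?big_cons ?big_nil /= ?bx ?bw //.
    by rewrite ntermE xw.
  rewrite addr0 mulr2n -{1}(mirror (adm_lk axw)) -ew.
  by rewrite addrC subrKA.
exists [:: (1%N, (x, w)); (1%N, (w, neg x))]; split;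
  rewrite // /weight ?big_cons ?big_nil /= ?bx ?bw ?bnx //.
- by rewrite !ntermE xw wx.
- rewrite !andbT; apply/orthogonal_termsP.
  have lw : lk w (neg w).
    by apply: lkT (adm_lk awx) _; rewrite lk_neg (adm_lk axw).
  have sE : root x w + root w (neg x) = root x (neg x) by rewrite subrKA.
  have dE : root x w - root w (neg x) = root (neg w) w.
    have := mirror (adm_lk awx); rewrite negK => <-.
    by rewrite opprB addrC subrKA.
  have s1 : ~ Delta fullv (root x (neg x)) by move/(Delta_lk lxv); rewrite noadm.
  have s2 : root x (neg x) <> 0.
    by move/eqP; rewrite subr_eq0 => /eqP/(e_inj lxv).
  have s3 : ~ Delta fullv (root (neg w) w).
    by rewrite lkC in lw; move/(Delta_lk lw); rewrite adm_sym noadm.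
  have s3' : ~ Delta fullv (root w (neg w)) by move/(Delta_lk lw); rewrite noadm.
  have s4 : root w (neg w) <> 0.
    by move/eqP; rewrite subr_eq0 => /eqP/(e_inj lw)/eqP; rewrite (negPf nw).
  have s4' : root (neg w) w <> 0 by move=> e1; apply: s4; rewrite -opprB e1 oppr0.
  have dE' : root w (neg x) - root x w = root w (neg w) by rewrite -opprB dE opprB.
  have sE' : root w (neg x) + root x w = root x (neg x) by rewrite addrC.
  by split; split; rewrite ?sE ?sE' ?dE ?dE'.
- by rewrite addr0 subrKA.
Qed.

(** The indices between [x] and [v] are distinct up to sign from those between [u]
    and [y]: a common index would make [x ~< y] or [u ~< v], and a two-sided root
    cannot be comparable for [n]. *)
Lemma disjoint_decomposition x y u v : sing2 x y -> sing2 u v -> x ~< v -> u ~< y ->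
  [/\ u <> neg x, v <> neg y, x <> neg y & u <> neg v] ->
  exists d, [/\ d != [::], all nterm d, pairwise orthogonal_terms d &
    weight d = root x y + root u v].
Proof.
move=> s1 s2 xv uy [unx vny xny unv].
have [d1 [d10 n1 o1 w1 b1]] := decompose xv.
have [d2 [d20 n2 o2 w2 b2]] := decompose uy.
exists (d1 ++ d2); split.
- by case: (d1) d10.
- by rewrite all_cat n1.
- rewrite pairwise_cat o1 o2 !andbT; apply/allrelP => p q pd qd.
  apply: orthogonal_indep; [exact: (allP n1)|exact: (allP n2)|].
  have betweenN a c z : between a c z -> between a c (neg z).
    case/or4P => [/eqP->|/eqP->|/eqP->|/orP[/eqP->|/and4P[h1 h2 h3 h4]]];
      by rewrite /between ?negK ?h1 ?h2 ?h3 ?h4 ?eqxx ?orbT.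
  have near a c z : between a c z ->
      [\/ z = a \/ z = neg a, z = c \/ z = neg c | a ~< z /\ z ~< c].
    case/or4P => [/eqP->|/eqP->|/eqP->|/orP[/eqP->|/and4P[zc za _ _]]].
    - by constructor 1; left.
    - by constructor 1; right.
    - by constructor 2; left.
    - by constructor 2; right.
    - by constructor 3.
  have no1 : x ~< y -> False by move/no_sing2; apply.
  have no2 : u ~< v -> False by move/no_sing2; apply.
  have xu : x <> u by move=> xu; apply: no1; rewrite xu.
  have vy : v <> y by move=> vy; apply: no1; rewrite -vy.
  have xy : x <> y by move=> xy; apply: (adm_neq (sing_adm (sing2_sing s1))).
  have vu : v <> u by move=> vu; apply: (adm_neq (sing_adm (sing2_sing s2))).
  have xnu : x <> neg u by move=> xu'; apply: unx; rewrite xu' negK.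
  have vnu : v <> neg u by move=> vu'; apply: unv; rewrite vu' negK.
  have inside (s z : X) : s = z \/ s = neg z -> between u y s -> between u y z.
    by case=> -> // /betweenN; rewrite negK.
  have inside' (s z : X) : s = z \/ s = neg z -> between x v s -> between x v z.
    by case=> -> // /betweenN; rewrite negK.
  have out (s : X) : s <> u -> s <> neg u -> s <> y -> s <> neg y -> between u y s ->
      u ~< s /\ s ~< y.
    by move=> h1 h2 h3 h4 /near[[]|[]|].
  have ind z : between x v z -> between u y z -> False.
    move=> bz bw; case: (near _ _ _ bz) => [zx|zv|[xz zv]].
    - have [ux _] := out x xu xnu xy xny (inside _ _ zx bw).
      exact/no2/(ltT ux).
    - by have [/no2] := out v vu vnu vy vny (inside _ _ zv bw).
    - case: (near _ _ _ bw) => [zu|zy|[uz zy]]; last exact/no1/(ltT xz).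
        case: (near _ _ _ (inside' _ _ zu bz)) => [[/esym/xu//|/unx//]|[/esym/vu//|ev]|[xu' _]].
          by apply: vnu; rewrite ev negK.
        exact/no1/(ltT xu').
      case: (near _ _ _ (inside' _ _ zy bz)) => [[/esym/xy//|ey]|[/esym/vy//|ey]|[/no1//]].
        by apply: xny; rewrite ey negK.
      by apply: vny; rewrite ey negK.
  have /andP[bp1 bp2] := allP b1 _ pd; have /andP[bq1 bq2] := allP b2 _ qd.
  move=> z w zp wq; have bz : between x v z.
    by move: zp; rewrite !inE => /orP[/eqP->|/eqP->].
  have bw : between u y w by move: wq; rewrite !inE => /orP[/eqP->|/eqP->].
  split=> ezw; subst z; [exact: ind bz bw|exact: ind bz (betweenN _ _ _ bw)].
- have -> : weight (d1 ++ d2) = weight d1 + weight d2 by exact: big_cat.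
  rewrite w1 w2.
  by rewrite [LHS]addrACA [RHS]addrACA [- e v + _]addrC.
Qed.

End Full.

Local Notation orthogonal_list t d :=
  [/\ d != [::], all (nterm t) d & pairwise (orthogonal_terms t) d].

Lemma strictly_infinite_fullv x y u v d : sing2 x y -> sing2 u v ->
  orthogonal_list fullv d -> weight d = root x y + root u v ->
  strictly_infinite fullv l b (root x y + root u v).
Proof.
move=> s1 s2 [d0 nd od] wd.
have full (z : g) : z \in fullv by rewrite memvf.
have sF : lie_subalgebra (fullv : {vspace g}) by [].
have := strictly_infiniteP sF (subvf h) (fun x y _ => full (E x y)) s1 s2 _ _ d0 nd od wd.
rewrite !capvf; apply; rewrite /rootR full andbT.
  exact: sing_adm (sing2_sing s1).
exact: sing_adm (sing2_sing s2).
Qed.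

(** If two of the indices cancel, [omega] is the difference of the two others. *)
Lemma telescoping x y u v : sing2 x y -> sing2 u v -> x ~< v ->
  (u == y) || (u ~< y) ->
  (exists2 d, orthogonal_list fullv d & weight d = root x y + root u v) \/
  [/\ u ~< y, u <> neg x & v <> neg y].
Proof.
move=> s1 s2 xv uy; have [l1 l2] := (adm_lk (sing_adm (sing2_sing s1)), adm_lk (sing_adm (sing2_sing s2))).
have one z w : z ~< w -> root z w = root x y + root u v ->
    exists2 d, orthogonal_list fullv d & weight d = root x y + root u v.
  move=> zw ew; have [d [h1 h2 h3 h4 _]] := decompose zw.
  by exists d; rewrite // h4.
have [e1|nuy] := eqVneq u y.
  by left; apply: (one x v) => //; rewrite e1 subrKA.
rewrite (negPf nuy) /= in uy.
have [e1|nux] := eqVneq u (neg x).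
  left; apply: (one (neg v) y).
    apply: (ltT (_ : neg v ~< neg x)); first by rewrite ltN.
    by rewrite -e1.
  have -> : root u v = root (neg v) x by rewrite -(mirror l2) e1 negK.
  by rewrite [RHS]addrC subrKA.
have [e1|nvy] := eqVneq v (neg y).
  left; apply: (one x (neg u)).
    by apply: ltT xv _; rewrite e1 ltN.
  have -> : root u v = root y (neg u) by rewrite -(mirror l2) e1 negK.
  by rewrite subrKA.
by right; split=> //; apply/eqP.
Qed.

Lemma solution_strict : ~~ lng -> solution -> exists omega : wt, strictly_infinite fullv l b omega.
Proof.
move=> nl [x [y [u [v [s1 s2 xv uy]]]]]; exists (root x y + root u v).
have [a1 a2] := (sing_adm (sing2_sing s1), sing_adm (sing2_sing s2)).
case: (telescoping s1 s2 xv uy) => [[d od wd]|[uy' nux nvy]].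
  exact: strictly_infinite_fullv od wd.
have [|d [h1 h2 h3 h4]] := disjoint_decomposition s1 s2 xv uy'.
  by split=> //; [exact: (admNneg nl a1)|exact: (admNneg nl a2)].
exact: (@strictly_infinite_fullv _ _ _ _ d).
Qed.

(** * A long and a short root *)

Section LongShort.
Hypothesis lg : lng.
Variables (x p q : X).
Hypotheses (s1 : sing2 x (neg x)) (s2 : sing2 p q) (npq : p <> neg q)
  (xq : N x q) (px : N p (neg x)).

(** The equivalence relation of [k] on the indices; it is transitive because all the
    linked pairs of distinct indices are roots here. *)
Definition akin z w := (z == w) || K z w.
(** The orbits under [k] of the first indices of the pairs [(x, neg x)], [(p, q)] and
    [(x, q)], [(p, neg x)], in both their names. *)
Definition src z := [|| akin z x, akin z p | akin z (neg q)].
(** As no index is in [src] together with its opposite, two pairs from [src] to the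
    opposite of [src] never compose, and so these pairs can be added to [k] without
    generating anything else. The difference [e (neg p) - e q] of the two roots in
    the decomposition of [omega] is left out. *)
Definition ambient z w := K z w || [&& adm z w, src z & src (neg w)].

Let Ktr y z w : K y z -> K z w -> adm y w -> K y w.
Proof. exact: (K_trans negK lkC sL). Qed.
Let KC z w : K z w = K w z. Proof. exact: KC. Qed.

Let link z w : lk z w -> z = w \/ adm z w.
Proof. by move=> lzw; case: (linkP neg lng lzw); auto; rewrite lg. Qed.

Lemma akinC z w : akin z w = akin w z.
Proof. by rewrite /akin eq_sym KC. Qed.

Lemma akinN z w : akin (neg z) (neg w) = akin z w.
Proof. by rewrite /akin neg_eq // KK KC. Qed.

Lemma akin_trans z w r : akin z w -> akin w r -> akin z r.
Proof.
case/orP=> [/eqP->//|zw] /orP[/eqP<-|wr]; first by rewrite /akin zw orbT.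
case: (link (lkT (adm_lk (Kadm zw)) (adm_lk (Kadm wr)))) => [->|a].
  by rewrite /akin eqxx.
by rewrite /akin (Ktr zw wr a) orbT.
Qed.

Lemma not_akin_N z w : N z w -> ~ akin z w.
Proof. by move=> n /orP[/eqP/(adm_neq (nil_adm n))|/(N_NK n)]. Qed.

Lemma akin_N z w r (s : X) : akin z w -> N w r -> akin r s -> z ~< s.
Proof.
move=> zw wr rs; have zr : z ~< r.
  case/orP: zw => [/eqP->|zw]; first exact: NW.
  by case: (Klt negK lkC lkT lk_neg sL zw (NW wr)) => // -[]; rewrite lg.
case/orP: rs => [/eqP<-//|rs].
by case: (ltK negK lkC lkT lk_neg sL zr rs) => // -[]; rewrite lg.
Qed.

Lemma sing2_not_akin u v : sing2 u v -> ~ akin u v.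
Proof.
move=> s /orP[/eqP/(adm_neq (sing_adm (sing2_sing s)))//|/andP[luv _]].
exact: sing_L (sing2_sing s) luv.
Qed.

Let xx : ~ (x ~< neg x). Proof. by move/no_sing2; apply. Qed.
Let nxp : N x (neg p). Proof. by rewrite -NN negK. Qed.
Let qx : N (neg q) (neg x). Proof. by rewrite NN. Qed.

Lemma akin_pp : ~ akin p (neg p).
Proof.
move=> k; apply: xx; rewrite akinC in k.
have : neg p ~< neg x by apply: (akin_N k px); rewrite /akin eqxx.
exact: ltT (NW nxp).
Qed.

Lemma akin_qq : ~ akin q (neg q).
Proof.
move=> k; apply: xx; apply: ltT (NW xq) _.
by apply: (akin_N k qx); rewrite /akin eqxx.
Qed.

(** An equivalence between a member of [x], [p], [neg q] and the opposite of one would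
    turn a root of [n] or a singular root into a root of [k], or produce
    [x ~< neg x] although [(x, neg x)] is singular. *)
Lemma src_disjoint z : src z -> src (neg z) -> False.
Proof.
have key u v : ~ akin u (neg v) -> akin z u -> akin (neg z) v -> False.
  move=> nuv zu zv; apply: nuv; rewrite akinC in zu; apply: akin_trans zu _.
  by rewrite -akinN negK.
have keyC u v : ~ akin u (neg v) -> ~ akin v (neg u).
  by move=> nuv vu; apply: nuv; rewrite -akinN negK akinC.
have n1 : ~ akin x (neg x) by apply: sing2_not_akin.
have n2 : ~ akin x (neg p) by apply: not_akin_N.
have n3 : ~ akin x (neg (neg q)) by rewrite negK; apply: not_akin_N.
have n4 : ~ akin p (neg (neg q)) by rewrite negK; apply: sing2_not_akin.
have n5 : ~ akin (neg q) (neg (neg q)) by rewrite akinN; apply: akin_qq.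
by case/or3P=> [zx|zp|zq] /or3P[z'x|z'p|z'q];
  eauto using (key _ _ akin_pp).
Qed.

Lemma src_l z w : K z w -> src w -> src z.
Proof.
move=> zw; have {}zw : akin z w by rewrite /akin zw orbT.
by case/or3P=> wr; apply/or3P; [constructor 1|constructor 2|constructor 3]; apply: akin_trans zw wr.
Qed.

Lemma ambient_sub : subsystem ambient.
Proof.
split=> [z w /orP[/Kadm//|/andP[]//]|z w|z w r].
  rewrite /ambient KK adm_neg // negK; congr (_ || _ && _).
  exact: andbC.
case/orP=> [zw|/and3P[azw sz sw]] /orP[wr|/and3P[awr sw' sr]] a.
- by rewrite /ambient (Ktr zw wr a).
- by rewrite /ambient a (src_l zw sw') sr orbT.
- rewrite /ambient a sz (src_l _ sw) ?orbT // KK KC.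
  by rewrite KC.
- by case: (src_disjoint sw' sw).
Qed.

(** One of [(neg p, q)] and [(q, neg p)] is in [b]. If they were in [k], it would raise
    [(p, q)] to [(p, neg p)] or [(neg q, q)], which are roots in type C, while
    [(p, q)] is singular. *)
Let not_K : ~ K (neg p) q.
Proof.
move=> k; have sing_pq := sing2_sing s2; have a := sing_adm sing_pq.
have k' : K (neg q) p by rewrite -KK negK.
have lp : adm p (neg p).
  have lqp : lk q (neg p) by rewrite lkC (adm_lk (Kadm k)).
  case: (link (lkT (adm_lk a) lqp)) => // e1.
  by case: akin_pp; rewrite /akin -e1 eqxx.
have lq : adm (neg q) q.
  case: (link (lkT (adm_lk (Kadm k')) (adm_lk a))) => // e1.
  by case: akin_qq; rewrite /akin e1 eqxx.
case/orP: (K_borel k) => [bpq|bqp].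
  apply: (sing_l sing_pq k' _ lq).
  by case: (borel_sub bB) => _ <- _; rewrite negK.
by apply: (sing_r sing_pq _ bqp lp); rewrite KC.
Qed.

Lemma long_short_infinite : infinite_weight l b (root x (neg x) + root p q).
Proof.
have [sxx spq] := (sing2_sing s1, sing2_sing s2).
have sx : src x by rewrite /src /akin eqxx.
have sp : src p by rewrite /src /akin eqxx !orbT.
have sq : src (neg q) by rewrite /src /akin eqxx !orbT.
pose t := hull ambient.
have st : lie_subalgebra t := hull_subalgebra ambient_sub.
have ht : (h <= t)%VS by exact: hull_cartan.
have Tt z w : ambient z w -> rootR t z w.
  move=> zw; rewrite /rootR hull_root // andbT.
  by case: ambient_sub => + _ _; apply.
have Kt z w : K z w -> E z w \in t by move=> k; apply: hull_root; rewrite /ambient k.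
have tT z w : lk z w -> Delta t (root z w) -> ambient z w.
  move=> lzw d; have a := Delta_lk lzw d.
  by apply: (hull_rootE ambient_sub a); apply/(DeltaE _ a).
have Tx : ambient x (neg x) by rewrite /ambient (sing_adm sxx) negK sx orbT.
have Tp : ambient p q by rewrite /ambient (sing_adm spq) sp sq orbT.
have Txq : ambient x q by rewrite /ambient (nil_adm xq) sx sq orbT.
have Tpx : ambient p (neg x) by rewrite /ambient (nil_adm px) negK sx sp orbT.
exists t; split; first by split.
  move=> v [vs hvs vin]; apply: subvP vin; apply/span_subvP => w /hvs[wh|[alpha [dk dk'] rw]].
    exact: (subvP ht).
  have [z [z' [a e1 lE]]] := DeltaP dk; subst alpha.
  have [c ->] := coord_line hX a rw; apply/memvZ/Kt.
  by apply/(Delta_kE a).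
apply: (strictly_infiniteP st ht Kt s1 s2 (Tt _ _ Tx) (Tt _ _ Tp)
  (s := [:: (1%N, (x, q)); (1%N, (p, neg x))])) => //.
- by rewrite /= /nterm /= xq px !Tt.
- have lpq : lk (neg p) q.
    apply: lkT (adm_lk (nil_adm xq)); rewrite -lk_neg negK.
    exact: adm_lk (nil_adm px).
  have lqp : lk q (neg p) by rewrite lkC.
  have dE : root x q - root p (neg x) = root (neg p) q.
    rewrite -(mirror (adm_lk (nil_adm px))) negK opprB addrC.
    by rewrite subrKA.
  have dE' : root p (neg x) - root x q = root q (neg p) by rewrite -opprB dE opprB.
  have npq' : neg p <> q by move=> e1; apply: npq; rewrite -e1 negK.
  have [sum1 sum2] : ~ Delta fullv (root x q + root p (neg x)) /\ root x q + root p (neg x) <> 0.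
    apply: (root_cancel (nil_adm xq) (nil_adm px)); rewrite negK; split.
    - exact: adm_neq (sing_adm sxx).
    - by apply: nesym; apply: adm_neq (sing_adm spq).
    - exact: adm_neq (nil_adm nxp).
    - by apply: nesym; apply: adm_neq (nil_adm xq).
  rewrite /= !andbT; apply/orthogonal_termsP; split; split; rewrite ?dE ?dE' ?(addrC (root p _)) //.
  + by move/Delta_full.
  + move/(tT _ _ lpq)/orP=> [/not_K//|/and3P[_ snp _]].
    exact: src_disjoint sp snp.
  + by move/eqP; rewrite subr_eq0 => /eqP/(e_inj lpq).
  + by move/Delta_full.
  + move/(tT _ _ lqp)/orP=> [|/and3P[_ snq _]]; last exact: src_disjoint snq sq.
    by rewrite KC => /not_K.
  + by move/eqP; rewrite subr_eq0 => /eqP/(e_inj lqp)/esym.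
- rewrite /weight !big_cons big_nil addr0 /=.
  by rewrite [LHS]addrACA [RHS]addrACA [- e q + _]addrC.
Qed.

End LongShort.

Lemma strict_infinite omega : strictly_infinite fullv l b omega ->
  infinite_weight (h := h) l b omega.
Proof.
move=> si; exists fullv; rewrite !capvf; split=> //.
  by split; [move=> *; apply: memvf|apply: subvf].
by move=> v _; rewrite /= memvf.
Qed.

Lemma solution_infinite : lng -> solution -> exists omega : wt, infinite_weight l b omega.
Proof.
move=> lg [x [y [u [v [s1 s2 xv uy]]]]].
have [a1 a2] := (sing_adm (sing2_sing s1), sing_adm (sing2_sing s2)).
case: (telescoping s1 s2 xv uy) => [[d od wd]|[uy' nux nvy]].
  exists (root x y + root u v).
  exact/strict_infinite/(strictly_infinite_fullv s1 s2 od wd).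
have nxv := lt_long lg xv; have nuy := lt_long lg uy'.
have [exy|nxy] := eqVneq y (neg x); have [euv|nuv] := eqVneq v (neg u).
- subst y v; exists (root x (neg x) + root u (neg u)).
  apply: strict_infinite; apply: (strictly_infinite_fullv s1 s2 (d := [:: (2%N, (x, neg u))])).
    by split=> //=; rewrite ntermE nxv.
  rewrite /weight big_cons big_nil addr0 mulr2n /=.
  rewrite -{2}(mirror (adm_lk (nil_adm nxv))) negK.
  by rewrite [LHS]addrACA [RHS]addrACA [- e (neg u) + _]addrC.
- subst y; exists (root x (neg x) + root u v).
  apply: long_short_infinite => //; first by move=> e1; case/eqP: nuv; rewrite e1 negK.
- subst v; exists (root u (neg u) + root x y).
  apply: long_short_infinite => //; by move=> e1; case/eqP: nxy; rewrite e1 negK.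
exists (root x y + root u v); apply: strict_infinite.
have [|d [h1 h2 h3 h4]] := disjoint_decomposition s1 s2 xv uy'.
  split=> //.
    by move=> e1; case/eqP: nxy; rewrite e1 negK.
  by move=> e1; case/eqP: nuv; rewrite e1 negK.
exact: (@strictly_infinite_fullv _ _ _ _ d).
Qed.

End Roots.

(** * The classical algebras *)

Section ClassicalForms.
Variable F : numClosedFieldType.

Lemma so_skewJ n : so F n = skewJ (1%:M : 'M[F]_n).
Proof.
apply/seteqP; split=> A; rewrite /so /skewJ /= mulmx1 mul1mx.
  by move=> ->; rewrite subrr.
by move/eqP; rewrite addrC addr_eq0 => /eqP.
Qed.

Lemma symplectic_sqr n : symplectic_mx F n *m symplectic_mx F n = - 1%:M.
Proof.
rewrite /symplectic_mx mulmx_block !mul0mx !mulmx0 !addr0 !add0r mul1mx mulmx1.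
by rewrite [in RHS](@scalar_mx_block _ n n) opp_block_mx oppr0.
Qed.

Lemma symplectic_unit n : symplectic_mx F n \in unitmx.
Proof.
by case: (@mulmx1_unit _ _ (symplectic_mx F n) (- symplectic_mx F n)) => //;
  rewrite mulmxN symplectic_sqr opprK.
Qed.

Lemma symplectic_tr n : (symplectic_mx F n)^T = -1 *: symplectic_mx F n.
Proof.
rewrite scaleN1r /symplectic_mx tr_block_mx opp_block_mx !trmx0 oppr0 opprK.
by rewrite linearN /= trmx1.
Qed.

Lemma sp_skewJ n : sp F n = skewJ (symplectic_mx F n).
Proof.
set W := symplectic_mx F n.
have swap (A B : 'M[F]_(n + n)) : A *m W + W *m B = 0 -> B *m W + W *m A = 0.
  move=> h; have : W *m (A *m W + W *m B) *m W = 0 by rewrite h mulmx0 mul0mx.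
  rewrite mulmxDr mulmxDl !mulmxA -(mulmxA _ W W) !symplectic_sqr.
  rewrite mulmxN mulmx1 !mulNmx mul1mx -opprD => /eqP.
  by rewrite oppr_eq0 addrC => /eqP.
by apply/seteqP; split=> A; rewrite /sp /skewJ /=; apply: swap.
Qed.

End ClassicalForms.

Section Classical.
Variables (F : numClosedFieldType) (g : lieAlgType F) (h : {vspace g}).
Local Notation wt := 'Hom(subvs_of h, F^o).
Hypotheses (gS : lie_simple g) (hC : cartan_subalgebra h).

Lemma simple_nonempty (f : {linear g -> 'M[F]_0}) : injective f -> False.
Proof.
move=> finj; case: gS => -[x [y /eqP xy]] _; apply: xy; apply: finj.
by apply/matrixP; case.
Qed.

Lemma sl_structure n : lie_iso_matrix g (sl F n) ->
  exists (X : finType) (neg : X -> X) (lk : rel X) (e : X -> wt) (E : X -> X -> g),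
    coordinates neg lk false e E.
Proof.
case: n => [|n'] [f [finj flie fr]]; first by case: (simple_nonempty finj).
have [f' [f'L f'r hd]] := sl_frame hC (conj finj flie) fr.
have [E cE] := sl_coordinates f'L hd f'r.
by eexists _, _, _, _, E; exact: cE.
Qed.

Lemma skew_structure n (J : 'M[F]_n) e : lie_iso_matrix g (skewJ J) ->
  (e = 1 \/ e = -1) -> J \in unitmx -> J^T = e *: J ->
  exists (X : finType) (neg : X -> X) (lk : rel X) (ew : X -> wt) (E : X -> X -> g),
    coordinates neg lk (e == -1) ew E.
Proof.
case: n J => [|n'] J [f [finj flie fr]] eP Ju Je.
  by case: (simple_nonempty finj).
have [f' [J' [neg [[f'L f'r] hd [Ju' Je'] [negK Jneg] fixed]]]] :=
  skew_frame hC (conj finj flie) fr eP Ju Je.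
have [E cE] := skew_coordinates f'L hd f'r eP Ju' Je' negK Jneg fixed.
by eexists _, _, _, _, E; exact: cE.
Qed.

Lemma so_structure n : lie_iso_matrix g (so F n) ->
  exists (X : finType) (neg : X -> X) (lk : rel X) (e : X -> wt) (E : X -> X -> g),
    coordinates neg lk false e E.
Proof.
rewrite so_skewJ => iso.
have [||X [neg [lk [e [E]]]]] := skew_structure iso (or_introl erefl).
- exact: unitmx1.
- by rewrite trmx1 scale1r.
rewrite -subr_eq0 opprK -(natrD _ 1 1) pnatr_eq0 /= => cE.
by exists X, neg, lk, e, E.
Qed.

Lemma sp_structure n : lie_iso_matrix g (sp F n) ->
  exists (X : finType) (neg : X -> X) (lk : rel X) (e : X -> wt) (E : X -> X -> g),
    coordinates neg lk true e E.
Proof.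
rewrite sp_skewJ => iso.
have [X [neg [lk [e [E]]]]] := skew_structure iso (or_intror erefl)
  (symplectic_unit _ n) (symplectic_tr _ n).
by rewrite eqxx => cE; exists X, neg, lk, e, E.
Qed.

Variables (l b : {vspace g}).
Hypotheses (hl : root_subalgebra h l) (bB : borel_subalgebra b) (hb : (h <= b)%VS)
  (nb : (part_n h l `<=` [set` b])%classic) (nc : ~ cone_condition h fullv l b).

Let hself : self_normalizing h. Proof. by case: hC. Qed.

Lemma strict_of_coordinates (X : finType) (neg : X -> X) (lk : rel X)
    (e : X -> wt) (E : X -> X -> g) :
  coordinates neg lk false e E ->
  exists omega : wt, strictly_infinite fullv l b omega.
Proof.
move=> cE; have sol := cone_solution cE hself hl hb bB nb nc.
exact: (solution_strict cE hl hb bB _ sol).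
Qed.

Lemma infinite_of_coordinates (X : finType) (neg : X -> X) (lk : rel X)
    (e : X -> wt) (E : X -> X -> g) :
  coordinates neg lk true e E ->
  exists omega : wt, infinite_weight l b omega.
Proof.
move=> cE; have sol := cone_solution cE hself hl hb bB nb nc.
exact: (solution_infinite cE hself hl hb bB _ sol).
Qed.

End Classical.

Local Open Scope classical_set_scope.

Theorem corollary5p6 (R : realType) (g : lieAlgType R[i])
    (h l b : {vspace g}) :
  classical_simple g ->
  cartan_subalgebra h ->
  root_subalgebra h l ->
  borel_subalgebra b ->
  (h <= b)%VS ->
  part_n h l `<=` [set` b] ->
  ~ cone_condition h fullv l b ->
  (type_A g \/ type_B g \/ type_D g ->
     exists omega : 'Hom(subvs_of h, R[i]^o),
       strictly_infinite fullv l b omega) /\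
  (type_C g ->
     exists omega : 'Hom(subvs_of h, R[i]^o),
       infinite_weight l b omega).
Proof.
move=> [gS _] hC hl bB hb nb nc; split.
  have strict X neg lk e E := @strict_of_coordinates _ _ _ hC _ _ hl bB hb nb nc X neg lk e E.
  case=> [[n iso]|[[n iso]|[n iso]]].
  - by have [X [neg [lk [e [E /strict]]]]] := sl_structure gS hC iso.
  - by have [X [neg [lk [e [E /strict]]]]] := so_structure gS hC iso.
  - by have [X [neg [lk [e [E /strict]]]]] := so_structure gS hC iso.
case=> n iso; have [X [neg [lk [e [E cE]]]]] := sp_structure gS hC iso.
exact: (infinite_of_coordinates hC hl bB hb nb nc cE).
Qed.
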